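(* Let $\varrho$ be a primitive substitution on a finite alphabet, and consider the corresponding geometric inflation rule with inflation multiplier $\lambda=\lambda_{\mathrm{PF}}$ for intervals of natural length. Let $B(k)$ be its Fourier matrix, let $$\chi^B(k)=\limsup_{n\to\infty}\frac1n\log\big\|B^{(n)}(k)\big\|,\qquad B^{(n)}(k)=B(k)B(\lambda k)\cdots B(\lambda^{n-1}k),$$ be the maximal Lyapunov exponent of the Fourier matrix cocycle, and assume that $\det(B(k))\neq0$ for at least one $k\in\mathbb{R}$. If there is some $\varepsilon>0$ such that $\chi^B(k)\leqslant\frac12\log(\lambda)-\varepsilon$ holds for Lebesgue-a.e. $k\in\mathbb{R}$, then $\widehat\Upsilon_{\mathsf{ac}}=0$, and the diffraction measure of the system is singular (with respect to Lebesgue measure).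
   Context: Let $\varrho$ be a primitive substitution on the alphabet $\{a_1,\dots,a_L\}$, with substitution matrix $M$, where $M_{ij}$ is the number of letters $a_i$ in $\varrho(a_j)$, and Perron--Frobenius (PF) eigenvalue $\lambda>1$. The geometric inflation rule uses $L$ intervals (prototiles, one per letter, distinguished by labels if congruent) of natural lengths, that is, with lengths proportional to the entries of the left PF eigenvector of $M$. It scales each interval by $\lambda$ and dissects the result into prototiles in the order given by $\varrho$. The tiling hull is the closure of the $\mathbb{R}$-translation orbit of a tiling of $\mathbb{R}$ that is fixed under some power of the inflation. The reference point of a tile is its left endpoint. $T_{ij}$ is the set of relative positions (via left endpoints) of the intervals of type $i$ in the inflated interval of type $j$. The Fourier matrix is the $L\times L$ matrix $B(k)$ with $B_{ij}(k)=\sum_{t\in T_{ij}}e^{2\pi ikt}$. The norm $\|\cdot\|$ is any sub-multiplicative matrix norm. For a tiling in the hull, let $\Lambda_i$ be the set of reference points of tiles of type $i$ and $\Lambda=\dot\bigcup_i\Lambda_i$. The pair correlation coefficients are $\nu_{ij}(z)=\operatorname{dens}(\Lambda_i\cap(\Lambda_j-z))/\operatorname{dens}(\Lambda)$; they exist and do not depend on the chosen tiling of the hull. The pair correlation measures are $\Upsilon_{ij}=\sum_{z\in S_{ij}}\nu_{ij}(z)\,\delta_z$ with $S_{ij}=\Lambda_j-\Lambda_i$, and $\Upsilon=(\Upsilon_{11},\Upsilon_{12},\dots,\Upsilon_{LL})$. All $\Upsilon_{ij}$ are Fourier-transformable as measures (convention $\widehat g(k)=\int e^{-2\pi ikx}g(x)\,\mathrm{d}x$),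 $\widehat\Upsilon$ is taken componentwise, and $\widehat\Upsilon_{\mathsf{ac}}$ is its absolutely continuous part with respect to Lebesgue measure, componentwise. The diffraction measure of the system is the Fourier transform $\widehat\gamma$ of the autocorrelation $\gamma$ of a Dirac comb $\sum_iu_i\,\delta_{\Lambda_i}$ with complex weights $u_i$, where $\gamma=\operatorname{dens}(\Lambda)\sum_{i,j}\overline{u_i}\,u_j\,\Upsilon_{ij}$. *)

(* Defs.v *)
From HB Require Import structures.
From mathcomp Require Import all_boot all_order all_algebra.
From mathcomp Require Import all_classical all_reals all_analysis.
From mathcomp Require Import finmap complex.
Set Implicit Arguments.
Unset Strict Implicit.
Unset Printing Implicit Defensive.
Import Order.TTheory GRing.Theory Num.Theory.
Import numFieldNormedType.Exports.
Local Open Scope classical_set_scope.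
Local Open Scope ring_scope.
Local Open Scope complex_scope.

Section Substitution.
Variables (R : realType) (L : nat).
Implicit Types (rho : 'I_L -> seq 'I_L) (lam : R) (ell : 'rV[R]_L).

Definition subst_mx rho : 'M[R]_L := \matrix_(i, j) (count_mem i (rho j))%:R.

Definition primitive rho : Prop :=
  exists2 n : nat, (0 < n)%N & forall i j, 0 < (subst_mx rho ^+ n) i j.

(* The eigenvalue of the substitution matrix, among all its complex
   eigenvalues, that strictly dominates all others in modulus. *)
Definition pf_eigenvalue rho lam : Prop :=
  eigenvalue (subst_mx rho) lam /\
  forall z : R[i], eigenvalue (map_mx (real_complex R) (subst_mx rho)) z ->
    z != lam%:C -> `|z| < lam%:C.

Definition natural_lengths rho lam ell : Prop :=
  (forall i, 0 < ell 0 i) /\ ell *m subst_mx rho = lam *: ell.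

(* T_ij as a list; its entries are distinct because lengths are positive. *)
Definition rel_pos rho ell (i j : 'I_L) : seq R :=
  [seq \sum_(a <- take p (rho j)) ell 0 a
     | p <- iota 0 (size (rho j)) & onth (rho j) p == Some i].

(* exp(2 pi i x) *)
Definition cexp (x : R) : R[i] := cos (2 * pi * x) +i* sin (2 * pi * x).

Definition fourier_mx rho ell (k : R) : 'M[R[i]]_L :=
  \matrix_(i, j) \sum_(t <- rel_pos rho ell i j) cexp (k * t).

Definition fourier_cocycle rho lam ell (n : nat) (k : R) : 'M[R[i]]_L :=
  \prod_(0 <= m < n) fourier_mx rho ell (lam ^+ m * k).

Definition submult_norm (N : 'M[R[i]]_L -> R) : Prop :=
  [/\ forall A, N A = 0 -> A = 0,
      forall A B, N (A + B) <= N A + N B,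
      forall c A, N (c *: A) = complex.Re `|c| * N A
    & forall A B, N (A *m B) <= N A * N B].

(* [lne] is the extended logarithm: lne 0 = -oo. *)
Definition lyapunov (N : 'M[R[i]]_L -> R) rho lam ell (k : R) : \bar R :=
  limn_esup (fun n : nat =>
    ((n%:R^-1)%:E * lne (N (fourier_cocycle rho lam ell n k))%:E)%E).

(* A set of tiles: (i, x) is the tile of type i with left endpoint x. *)
Definition tile_set := set ('I_L * R).
Implicit Types T : tile_set.

Definition is_tiling ell T : Prop :=
  forall y : R, exists! p : 'I_L * R,
    T p /\ p.2 <= y < p.2 + ell 0 p.1.

Definition inflate rho lam ell T : tile_set :=
  [set q | exists2 p, T p &
     exists2 t, t \in rel_pos rho ell q.1 p.1 & q.2 = lam * p.2 + t].

Definition translate (s : R) T : tile_set := [set p | T (p.1, p.2 - s)].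

Definition agree_on ell (r : R) T1 T2 : Prop :=
  forall p : 'I_L * R, p.2 <= r -> - r <= p.2 + ell 0 p.1 -> (T1 p <-> T2 p).

(* Closure of the translation orbit in the local topology: two tilings are
   e-close if, up to a translation by at most e, they agree on the ball of
   radius 1/e around 0. *)
Definition hull ell T0 : set tile_set :=
  [set T | is_tiling ell T /\
     forall e : R, 0 < e -> exists s t : R, `|s| <= e /\
       agree_on ell e^-1 (translate s T) (translate t T0)].

Definition fixed_tiling rho lam ell T0 : Prop :=
  is_tiling ell T0 /\
  exists2 p : nat, (0 < p)%N & iter p (inflate rho lam ell) T0 = T0.

Definition points T (i : 'I_L) : set R := [set x | T (i, x)].
Definition all_points T : set R := [set x | exists i, points T i x].

Definition has_dens (X : set R) (d : R) : Prop :=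
  (fun r : R => #|` fset_set (X `&` `[- r, r])|%:R / (2 * r)) @ +oo --> d.

Definition point_density ell T0 (d : R) : Prop :=
  forall T, hull ell T0 T -> has_dens (all_points T) d.

(* nu i j z is dens (Lambda_i \cap (Lambda_j - z)) / d, where d is the density
   of all points; the coefficients are those of the hull, that is, common to
   all of its tilings. *)
Definition pair_correlation ell T0 (d : R) (nu : 'I_L -> 'I_L -> R -> R) :=
  forall T, hull ell T0 T -> forall (i j : 'I_L) (z : R),
    exists2 a, has_dens [set x | points T i x /\ points T j (x + z)] a
             & nu i j z = a / d.

End Substitution.

Section ComplexMeasures.
Variable R : realType.
Notation mu1 := (@lebesgue_measure R).
Implicit Types (f g : R -> R[i]) (m : set R -> R[i]).

Definition integralC g : R[i] :=
  Rintegral mu1 setT (fun x => complex.Re (g x))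
  +i* Rintegral mu1 setT (fun x => complex.Im (g x)).

Definition Cc : set (R -> R[i]) :=
  [set f : R -> R[i] | [/\ continuous (fun x => complex.Re (f x)),
               continuous (fun x => complex.Im (f x))
             & exists r : R, forall x, r < `|x| -> f x = 0]].

(* f * f~ with f~(x) = conj (f (-x)) *)
Definition autoconv f (x : R) : R[i] :=
  integralC (fun y => f y * (f (y - x))^*).

(* The inverse Fourier transform. *)
Definition invfourier f (k : R) : R[i] :=
  integralC (fun x => cexp (k * x) * f x).

(* A (possibly unbounded) complex Radon measure, given as a complex linear
   combination of four positive ones. Values on bounded Borel sets and
   integrals do not depend on the decomposition; absolute integrability with
   respect to the total variation measure amounts to [cintegrable] for the
   Jordan decomposition of the real and imaginary parts. *)
Record cmeasure := CMeasure {
  re_pos : {measure set (measurableTypeR R) -> \bar R};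
  re_neg : {measure set (measurableTypeR R) -> \bar R};
  im_pos : {measure set (measurableTypeR R) -> \bar R};
  im_neg : {measure set (measurableTypeR R) -> \bar R};
  cmeasure_loc_fin : forall a b : R,
    [/\ (re_pos `[a, b]%classic < +oo)%E, (re_neg `[a, b]%classic < +oo)%E,
        (im_pos `[a, b]%classic < +oo)%E & (im_neg `[a, b]%classic < +oo)%E]
}.

Definition cmeasure_val (mu : cmeasure) (A : set R) : R[i] :=
  (fine (re_pos mu A) - fine (re_neg mu A))
  +i* (fine (im_pos mu A) - fine (im_neg mu A)).

Definition cintegrable (mu : cmeasure) (h : R -> R) : Prop :=
  [/\ (re_pos mu).-integrable setT (EFin \o h),
      (re_neg mu).-integrable setT (EFin \o h),
      (im_pos mu).-integrable setT (EFin \o h)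
    & (im_neg mu).-integrable setT (EFin \o h)].

Definition cintegral (mu : cmeasure) (h : R -> R) : R[i] :=
  (Rintegral (re_pos mu) setT h - Rintegral (re_neg mu) setT h)
  +i* (Rintegral (im_pos mu) setT h - Rintegral (im_neg mu) setT h).

(* A measure mu, viewed as a linear functional on C_c(R), is
   Fourier-transformable with transform muhat if
   mu(f * f~) = muhat(|invfourier f|^2) for every f in C_c(R), the right-hand
   integrand being absolutely integrable. *)
Definition is_fourier_transform (mu : (R -> R[i]) -> R[i]) (muhat : cmeasure) :=
  forall f, Cc f ->
    let h (k : R) : R := complex.Re `|invfourier f k| ^+ 2 in
    cintegrable muhat h /\ mu (autoconv f) = cintegral muhat h.

Definition bounded_borel (A : set R) : Prop :=
  measurable (A : set (measurableTypeR R)) /\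
  exists a b : R, A `<=` `[a, b].

Definition abs_cont m : Prop :=
  forall A, bounded_borel A -> mu1 A = 0%E -> m A = 0.

Definition singular m : Prop :=
  exists N : set R,
    [/\ measurable (N : set (measurableTypeR R)), mu1 N = 0%E
      & forall A, bounded_borel A -> A `<=` ~` N -> m A = 0].

(* mac is the absolutely continuous part of m in its (unique) Lebesgue
   decomposition. *)
Definition is_ac_part m mac : Prop :=
  abs_cont mac /\ singular (fun A => m A - mac A).

(* The measure \sum_(z in S) w(z) delta_z, S locally finite, as a functional
   on C_c(R); for g in C_c(R), the sum is finite. *)
Definition dirac_comb (S : set R) (w : R -> R[i]) : (R -> R[i]) -> R[i] :=
  fun g => \sum_(z \in S) (w z * g z).

End ComplexMeasures.

Section Correlation.
Variables (R : realType) (L : nat).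
Implicit Types (T : tile_set R L) (nu : 'I_L -> 'I_L -> R -> R).

Definition diff_set T (i j : 'I_L) : set R :=
  [set z | exists2 x, points T i x & points T j (x + z)].

Definition Upsilon T nu (i j : 'I_L) : (R -> R[i]) -> R[i] :=
  dirac_comb (diff_set T i j) (fun z => (nu i j z)%:C).

(* Autocorrelation of the Dirac comb \sum_i u_i delta_(Lambda_i). *)
Definition autocorrelation T (d : R) nu (u : 'I_L -> R[i]) :
    (R -> R[i]) -> R[i] :=
  fun g => d%:C * \sum_i \sum_j (u i)^* * u j * Upsilon T nu i j g.

End Correlation.

(* Main.v *)
(* The tiling T0 is fixed by q-fold inflation for arbitrarily large q. Comparing
   densities, this expresses nu through its values on the coarser scale lam^q,
   and polarization carries the relation over to the transforms: on bounded sets,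
     Uhat_ij = lam^(-2q) sum_(m,n) B^(q)_im conj(B^(q)_jn) . Uhat_mn(lam^q .).
   A gliding-hump argument shows that a positive measure that integrates all
   functions |invfourier f|^2, with f in C_c, is translation bounded, so
   Uhat_mn(lam^q A) grows at most like lam^q. On a bounded set A where
   ||B^(n)(k)||^2 <= C lam^n e^(- eps n) for all large n, the relation then gives
   |Uhat_ij(A)| = O(e^(- eps q)), hence Uhat_ij(A) = 0. By the assumption on the
   Lyapunov exponent, such sets exhaust R up to a Lebesgue null set. *)
Require Import Defs.
From HB Require Import structures.
From mathcomp Require Import all_boot all_order all_algebra.
From mathcomp Require Import all_classical all_reals all_analysis.
From mathcomp Require Import finmap complex measurable_realfun.
From mathcomp Require Import ring lra.
Set Implicit Arguments.
Unset Strict Implicit.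
Unset Printing Implicit Defensive.
Import Order.TTheory GRing.Theory Num.Theory.
Import numFieldNormedType.Exports.
Local Open Scope classical_set_scope.
Local Open Scope ring_scope.
Local Open Scope complex_scope.

(** * Affine changes of variables, complex integrals, polarization *)

(** A transform is accessible only through the nonnegative test functions |invfourier f|^2, not
    through Borel sets or translates. Two obstacles follow. A translate of f * f~ is not of this
    form; polarization repairs this on both sides at once. And an identity tested on power spectra
    must be turned into one on bounded Borel sets: dilated and modulated tents supply an approximate
    identity whose decay 1 / (1 + k^2) every translation bounded measure integrates, so that
    dominated limits lead from kernels to intervals and on to Borel sets. Complex measures come as
    four positive components, each of which integrates the power spectra by itself; hence uniqueness
    is stated for finite families of positive measures with bounded weights. In lam^(-2q), one
    factor lam^(-q) comes from densities and one from the dilation of f, while the mass of lam^q A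
    returns lam^q; the rest, lam^(-q) ||B^(q)||^2, is where the threshold log(lam) / 2 originates.
    The renormalization is derived for T0 and carries over to T because nu is common to the hull. *)

Section Analysis.
Variable R : realType.
Notation mu1 := (@lebesgue_measure R).
Implicit Types (f g : R -> R[i]) (c t k x : R).

Lemma measurable_affine c t :
  measurable_fun [set: measurableTypeR R] ((fun x : R => c * x + t) : _ -> measurableTypeR R).
Proof.
apply: continuous_measurable_fun => x; apply: cvgD; last exact: cvg_cst.
by apply: cvgM; [exact: cvg_cst|exact: cvg_id].
Qed.

Definition affine_image c t (mu : set (measurableTypeR R) -> \bar R) :
    set (measurableTypeR R) -> \bar R :=
  pushforward mu (fun x : R => c * x + t).

Section affine_image_measure.
Variables (c t : R) (mu : {measure set (measurableTypeR R) -> \bar R}).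

Let affine_image0 : affine_image c t mu set0 = 0%E.
Proof. by rewrite /affine_image measure0//; exact: measurable_affine. Qed.

Let affine_image_ge0 A : (0 <= affine_image c t mu A)%E.
Proof. by rewrite /affine_image measure_ge0//; exact: measurable_affine. Qed.

Let affine_image_sigma_additive : semi_sigma_additive (affine_image c t mu).
Proof.
have mf := measurable_affine c t.
move=> F mF tF mUF; rewrite /affine_image /pushforward preimage_bigcup.
apply: measure_semi_sigma_additive.
- by move=> n; rewrite -[X in measurable X]setTI; exact: mf.
- apply/trivIsetP => /= i j _ _ ij; rewrite -preimage_setI.
  by move/trivIsetP : tF => /(_ _ _ _ _ ij) ->//; rewrite preimage_set0.
- by rewrite -preimage_bigcup -[X in measurable X]setTI; exact: mf.
Qed.

HB.instance Definition _ := isMeasure.Build _ _ _ (affine_image c t mu)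
  affine_image0 affine_image_ge0 affine_image_sigma_additive.

End affine_image_measure.

(** Lebesgue measure is determined by its values on half-open intervals, so the rescaled image
    measure need only be compared with it there. *)
Lemma lebesgue_measure_affine c t (A : set (measurableTypeR R)) :
  0 < c -> measurable A ->
  mu1 A = (c%:E * mu1 ((fun x : R => c * x + t)%R @^-1` A))%E.
Proof.
move=> c0 mA.
have := @lebesgue_measure_unique R (mscale (NngNum (ltW c0)) (affine_image c t mu1)).
apply=> // _ [[a b] _ <-] /=.
rewrite /mscale /= /affine_image /pushforward.
have -> : (fun x : R => c * x + t) @^-1` `]a, b] =
    `](a - t) / c, (b - t) / c]%classic.
  apply/seteqP; split => x /=; rewrite !in_itv /= ltr_pdivrMr// ler_pdivlMr//.
    by move=> /andP[h1 h2]; apply/andP; split; lra.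
  by move=> /andP[h1 h2]; apply/andP; split; lra.
rewrite !lebesgue_measure_itv /= !lte_fin ltr_pM2r ?invr_gt0// ltrD2r.
case: ifP => ab; last by rewrite mule0.
by rewrite -!EFinB -EFinM; congr (_%:E); field; rewrite gt_eqF.
Qed.

Lemma ge0_integral_affine c t (h : R -> \bar R) : 0 < c ->
  measurable_fun [set: measurableTypeR R] h -> (forall x, (0 <= h x)%E) ->
  (\int[mu1]_x h x = c%:E * \int[mu1]_x h (c * x + t)%R)%E.
Proof.
move=> c0 mh h0.
pose m2 := mscale (NngNum (ltW c0)) (affine_image c t mu1).
have -> : (\int[mu1]_x h x = \int[m2]_x h x)%E.
  apply: eq_measure_integral => A mA _; rewrite /m2 /= /mscale /= /affine_image /pushforward.
  exact: lebesgue_measure_affine.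
by rewrite ge0_integral_mscale// ge0_integral_pushforward//; exact: measurable_affine.
Qed.

Lemma integrable_affine c t (h : R -> R) : 0 < c ->
  mu1.-integrable setT (EFin \o h) ->
  mu1.-integrable setT (EFin \o (fun x => h (c * x + t))).
Proof.
move=> c0 /integrableP[mh ih]; apply/integrableP; split.
  apply/measurable_EFinP.
  move/measurable_EFinP : mh => mh.
  exact: (measurableT_comp mh (measurable_affine c t)).
move: ih; rewrite (ge0_integral_affine t c0)//; last first.
  by apply: measurableT_comp => //; exact: mh.
by rewrite !ltey; apply: contra_neq => ->; rewrite gt0_muley ?lte_fin.
Qed.

Lemma Rintegral_affine c t (h : R -> R) : 0 < c ->
  mu1.-integrable setT (EFin \o h) ->
  Rintegral mu1 setT (fun x => h (c * x + t)) = c^-1 * Rintegral mu1 setT h.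
Proof.
move=> c0 ih; have /integrableP[mh _] := ih.
rewrite /Rintegral.
rewrite [in RHS](@integralE _ _ _ mu1 setT (EFin \o h)).
rewrite [in LHS](@integralE _ _ _ mu1).
rewrite (ge0_integral_affine t c0 (h := (EFin \o h)^\+%E))//; last exact: measurable_funepos.
rewrite (ge0_integral_affine t c0 (h := (EFin \o h)^\-%E))//; last exact: measurable_funeneg.
have ih2 := integrable_affine t c0 ih.
pose g : R -> \bar R := EFin \o (fun x => h (c * x + t)%R).
have -> : (fun x => (EFin \o h)^\+%E (c * x + t)%R) = g^\+%E.
  by apply/funext => x; rewrite !funeposE.
have -> : (fun x => (EFin \o h)^\-%E (c * x + t)%R) = g^\-%E.
  by apply/funext => x; rewrite !funenegE.
rewrite -[X in fine X = _]/(\int[mu1]_x g^\+%E x - \int[mu1]_x g^\-%E x)%E.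
have f1 := integrable_fin_num measurableT (integrable_funepos measurableT ih2).
have f2 := integrable_fin_num measurableT (integrable_funeneg measurableT ih2).
rewrite -[(\int[mu1]_x g^\+%E x)%E]fineK// -[(\int[mu1]_x g^\-%E x)%E]fineK//.
by rewrite -!EFinM -!EFinB /= -mulrBr mulKf ?gt_eqF.
Qed.

End Analysis.

(** Expanding the product leaves the terms with powers [i ^ l], [1], [i ^ (2 l)] and [i ^ l]; only
    the constant one survives the sum over the fourth roots of unity. *)
Lemma polarization4 (R : rcfType) (a b a' b' : R[i]) :
  \sum_(l < 4) 'i%C ^+ l * ((a + 'i%C ^+ l * b) * (a' + 'i%C ^+ l * b')^*) = 4 * (a * b'^*).
Proof.
rewrite !big_ord_recl big_ord0 /bump /= !exprS !expr0.
rewrite (_ : 4 = (4 : R)%:C); last by rewrite rmorph_nat.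
case: a b a' b' => [a1 a2] [b1 b2] [c1 c2] [d1 d2].
apply/eqP; rewrite eq_complex; apply/andP; split; apply/eqP => /=; ring.
Qed.

Section ComplexIntegral.
Variable R : realType.
Notation mu1 := (@lebesgue_measure R).
Implicit Types (f g w : R -> R[i]) (c t k x : R) (z : R[i]).

Lemma compact_support_integrable (h : R -> R) (r : R) : continuous h ->
  (forall x, r < `|x| -> h x = 0) -> mu1.-integrable setT (EFin \o h).
Proof.
move=> ch h0.
have mI : measurable (`[- r, r]%classic : set (measurableTypeR R)).
  exact: measurable_itv.
have -> : EFin \o h = (EFin \o h) \_ `[- r, r].
  apply/funext => x; rewrite patchE; case: ifPn => //.
  rewrite notin_setE /= in_itv /= => /negP; rewrite -ler_norml -ltNge => xr.
  by rewrite h0.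
have H : mu1.-integrable `[- r, r] (EFin \o h).
  apply: continuous_compact_integrable; first exact: segment_compact.
  exact: continuous_subspaceT.
by have [H2 _] := @integrable_mkcond _ _ _ mu1 _ (EFin \o h) mI; exact: H2.
Qed.

Definition continuousC g : Prop :=
  continuous (fun x => complex.Re (g x)) /\ continuous (fun x => complex.Im (g x)).

Definition integrableC (m : {measure set (measurableTypeR R) -> \bar R}) g : Prop :=
  m.-integrable setT (EFin \o (fun x => complex.Re (g x))) /\
  m.-integrable setT (EFin \o (fun x => complex.Im (g x))).

(** For Lebesgue measure this unfolds to [integralC], so the linearity lemmas below serve both. *)
Definition mintegralC (m : {measure set (measurableTypeR R) -> \bar R}) g : R[i] :=
  Rintegral m setT (fun x => complex.Re (g x))
  +i* Rintegral m setT (fun x => complex.Im (g x)).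

Lemma eqC z1 z2 : complex.Re z1 = complex.Re z2 -> complex.Im z1 = complex.Im z2 ->
  z1 = z2 :> R[i].
Proof. by case: z1 z2 => [a b] [a' b'] /= -> ->. Qed.

Lemma ReD z1 z2 : complex.Re (z1 + z2 : R[i]) = complex.Re z1 + complex.Re z2.
Proof. by case: z1 z2 => [a b] [a' b']. Qed.
Lemma ImD z1 z2 : complex.Im (z1 + z2 : R[i]) = complex.Im z1 + complex.Im z2.
Proof. by case: z1 z2 => [a b] [a' b']. Qed.
Lemma ReM z1 z2 : complex.Re (z1 * z2 : R[i]) =
  complex.Re z1 * complex.Re z2 - complex.Im z1 * complex.Im z2.
Proof. by case: z1 z2 => [a b] [a' b']. Qed.
Lemma ImM z1 z2 : complex.Im (z1 * z2 : R[i]) =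
  complex.Re z1 * complex.Im z2 + complex.Im z1 * complex.Re z2.
Proof. by case: z1 z2 => [a b] [a' b']. Qed.
Lemma ReN z : complex.Re (- z) = - complex.Re z. Proof. by case: z. Qed.
Lemma ImN z : complex.Im (- z) = - complex.Im z. Proof. by case: z. Qed.
Lemma ReJ z : complex.Re (z^*) = complex.Re z. Proof. by case: z. Qed.
Lemma ImJ z : complex.Im (z^*) = - complex.Im z. Proof. by case: z. Qed.
Definition ReImE := (ReD, ImD, ReM, ImM, ReN, ImN, ReJ, ImJ).

Lemma Re_sum (I : Type) (s : seq I) (P : pred I) (F : I -> R[i]) :
  complex.Re (\sum_(i <- s | P i) F i) = \sum_(i <- s | P i) complex.Re (F i).
Proof. exact: (big_morph (fun z : R[i] => complex.Re z) ReD erefl). Qed.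
Lemma Im_sum (I : Type) (s : seq I) (P : pred I) (F : I -> R[i]) :
  complex.Im (\sum_(i <- s | P i) F i) = \sum_(i <- s | P i) complex.Im (F i).
Proof. exact: (big_morph (fun z : R[i] => complex.Im z) ImD erefl). Qed.

Lemma sqr_normC z : complex.Re `|z| ^+ 2 = complex.Re z ^+ 2 + complex.Im z ^+ 2.
Proof. by rewrite normc_def /= sqr_sqrtr// addr_ge0 ?sqr_ge0. Qed.

Lemma cexpD x y : cexp (x + y) = cexp x * cexp y.
Proof.
apply: eqC; rewrite ?ReImE /cexp /= mulrDr.
  by rewrite cosD.
by rewrite sinD addrC.
Qed.

Lemma cexpN x : cexp (- x) = (cexp x)^*.
Proof. by rewrite /cexp mulrN cosN sinN. Qed.

Lemma continuous_affine c t : continuous (fun x : R => c * x + t).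
Proof.
move=> x; apply: cvgD; last exact: cvg_cst.
by apply: cvgM; [exact: cvg_cst|exact: cvg_id].
Qed.

Lemma continuous_compR (u h : R -> R) : continuous u -> continuous h ->
  continuous (fun x => h (u x)).
Proof. by move=> cu ch x; apply: (@continuous_comp _ _ _ u h x); [exact: cu|exact: ch]. Qed.

Lemma continuousC_comp_affine g c t : continuousC g -> continuousC (fun x => g (c * x + t)).
Proof.
move=> [h1 h2]; split.
  exact: (continuous_compR (@continuous_affine c t) h1).
exact: (continuous_compR (@continuous_affine c t) h2).
Qed.

Lemma continuousC_cst z : continuousC (fun=> z).
Proof. by split=> x; exact: cvg_cst. Qed.

Lemma continuousC_cexp k : continuousC (fun x => cexp (k * x)).
Proof.
have h : continuous (fun x : R => 2 * pi * (k * x)).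
  move=> x; apply: cvgM; first exact: cvg_cst.
  by apply: cvgM; [exact: cvg_cst|exact: cvg_id].
split; rewrite /cexp /=.
  exact: (continuous_compR h (@continuous_cos R)).
exact: (continuous_compR h (@continuous_sin R)).
Qed.

Lemma continuousRD (u h : R -> R) : continuous u -> continuous h ->
  continuous (fun x => u x + h x).
Proof. by move=> cu ch x; apply: cvgD; [exact: cu|exact: ch]. Qed.

Lemma continuousRM (u h : R -> R) : continuous u -> continuous h ->
  continuous (fun x => u x * h x).
Proof. by move=> cu ch x; apply: cvgM; [exact: cu|exact: ch]. Qed.

Lemma continuousRN (u : R -> R) : continuous u -> continuous (fun x => - u x).
Proof. by move=> cu x; apply: cvgN; exact: cu. Qed.

Lemma continuousCD f g : continuousC f -> continuousC g -> continuousC (fun x => f x + g x).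
Proof.
move=> [h1 h2] [h3 h4]; split.
  rewrite (funext (fun x => ReD (f x) (g x))); exact: continuousRD.
rewrite (funext (fun x => ImD (f x) (g x))); exact: continuousRD.
Qed.

Lemma continuousCM f g : continuousC f -> continuousC g -> continuousC (fun x => f x * g x).
Proof.
move=> [h1 h2] [h3 h4]; split.
  rewrite (funext (fun x => ReM (f x) (g x))); apply: continuousRD.
    exact: continuousRM.
  by apply: continuousRN; exact: continuousRM.
rewrite (funext (fun x => ImM (f x) (g x))); apply: continuousRD; exact: continuousRM.
Qed.

Lemma continuousC_conj f : continuousC f -> continuousC (fun x => (f x)^*).
Proof.
move=> [h1 h2]; split.
  by rewrite (funext (fun x => ReJ (f x))).
by rewrite (funext (fun x => ImJ (f x))); exact: continuousRN.
Qed.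

Lemma Cc_continuousC f : Cc f -> continuousC f.
Proof. by case=> h1 h2 _; split. Qed.

Lemma Cc_integrableC f : Cc f -> integrableC mu1 f.
Proof.
move=> [h1 h2 [r fr]]; split.
  by apply: (compact_support_integrable (r := r)) => // x /fr ->.
by apply: (compact_support_integrable (r := r)) => // x /fr ->.
Qed.

Lemma CcM w f : continuousC w -> Cc f -> Cc (fun x => w x * f x).
Proof.
move=> cw cf; have [h1 h2] := continuousCM cw (Cc_continuousC cf).
by case: cf => _ _ [r fr]; split => //; exists r => x /fr ->; rewrite mulr0.
Qed.

Lemma CcD f g : Cc f -> Cc g -> Cc (fun x => f x + g x).
Proof.
move=> cf cg; have [h1 h2] := continuousCD (Cc_continuousC cf) (Cc_continuousC cg).
case: cf => _ _ [r fr]; case: cg => _ _ [s gs]; split => //.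
exists (Num.max r s) => x; rewrite gt_max => /andP[xr xs].
by rewrite fr// gs// addr0.
Qed.

Lemma Cc_affine f c t : 0 < c -> Cc f -> Cc (fun x => f (c * x + t)).
Proof.
move=> c0 cf; have [h1 h2] := continuousC_comp_affine c t (Cc_continuousC cf).
case: cf => _ _ [r fr]; split => //; exists ((r + `|t|) / c) => x.
rewrite ltr_pdivrMr// => h; apply: fr.
have : `|c * x| <= `|c * x + t| + `|t|.
  by rewrite -{1}[c * x](addrK t); apply: ler_normB.
by rewrite normrM (gtr0_norm c0) mulrC; lra.
Qed.

Section any_measure.
Variable m : {measure set (measurableTypeR R) -> \bar R}.

Lemma mintegralCD f g : integrableC m f -> integrableC m g ->
  mintegralC m (fun x => f x + g x) = mintegralC m f + mintegralC m g.
Proof.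
move=> [h1 h2] [h3 h4]; apply: eqC; rewrite ?ReImE /=.
  by under eq_Rintegral do rewrite ReD; rewrite RintegralD.
by under eq_Rintegral do rewrite ImD; rewrite RintegralD.
Qed.

Lemma integrableCD f g : integrableC m f -> integrableC m g ->
  integrableC m (fun x => f x + g x).
Proof.
move=> [h1 h2] [h3 h4]; split.
  rewrite (_ : _ \o _ = (fun x => (complex.Re (f x))%:E + (complex.Re (g x))%:E)%E).
    exact: integrableD.
  by apply/funext => x /=; rewrite ReD EFinD.
rewrite (_ : _ \o _ = (fun x => (complex.Im (f x))%:E + (complex.Im (g x))%:E)%E).
  exact: integrableD.
by apply/funext => x /=; rewrite ImD EFinD.
Qed.

Let integrableRZ (a : R) (h : R -> R) : m.-integrable setT (EFin \o h) ->
  m.-integrable setT (EFin \o (fun x => a * h x)).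
Proof.
move=> ih; rewrite (_ : _ \o _ = (fun x => a%:E * (h x)%:E)%E)//.
exact: integrableZl.
Qed.

Lemma integrableCZ z f : integrableC m f -> integrableC m (fun x => z * f x).
Proof.
move=> [h1 h2]; split.
  rewrite (_ : _ \o _ = (fun x => (complex.Re z * complex.Re (f x))%:E -
      (complex.Im z * complex.Im (f x))%:E)%E).
    by apply: integrableB => //; exact: integrableRZ.
  by apply/funext => x /=; rewrite ReM EFinB.
rewrite (_ : _ \o _ = (fun x => (complex.Re z * complex.Im (f x))%:E +
      (complex.Im z * complex.Re (f x))%:E)%E).
  by apply: integrableD => //; exact: integrableRZ.
by apply/funext => x /=; rewrite ImM EFinD.
Qed.

Lemma mintegralCZ z f : integrableC m f ->
  mintegralC m (fun x => z * f x) = z * mintegralC m f.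
Proof.
move=> [h1 h2].
apply: eqC; rewrite ?ReImE /=.
  under eq_Rintegral do rewrite ReM.
  by rewrite RintegralB ?RintegralZl//; exact: integrableRZ.
under eq_Rintegral do rewrite ImM.
by rewrite RintegralD ?RintegralZl//; exact: integrableRZ.
Qed.

Lemma integrableC0 : integrableC m (fun=> 0).
Proof. by split; exact: integrable0. Qed.

Lemma integrableC_sum (I : Type) (s : seq I) (F : I -> R -> R[i]) :
  (forall i, integrableC m (F i)) -> integrableC m (fun x => \sum_(i <- s) F i x).
Proof.
move=> iF; elim: s => [|i s IH].
  by under eq_fun do rewrite big_nil; exact: integrableC0.
by under eq_fun do rewrite big_cons; exact: integrableCD.
Qed.

Lemma mintegralC_sum (I : Type) (s : seq I) (F : I -> R -> R[i]) :
  (forall i, integrableC m (F i)) ->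
  mintegralC m (fun x => \sum_(i <- s) F i x) = \sum_(i <- s) mintegralC m (F i).
Proof.
move=> iF; elim: s => [|i s IH].
  rewrite big_nil; under eq_fun do rewrite big_nil.
  by apply: eqC => /=; rewrite Rintegral_cst// mul0r.
rewrite big_cons -IH; under eq_fun do rewrite big_cons.
by apply: mintegralCD => //; exact: integrableC_sum.
Qed.

End any_measure.

Lemma integralC_affine f c t : 0 < c -> integrableC mu1 f ->
  integralC (fun x => f (c * x + t)) = (c^-1)%:C * integralC f.
Proof.
move=> c0 [h1 h2]; apply: eqC; rewrite ?ReImE /=.
  by rewrite (Rintegral_affine t c0 (h := fun x => complex.Re (f x)))// mul0r subr0.
by rewrite (Rintegral_affine t c0 (h := fun x => complex.Im (f x)))// mul0r addr0.
Qed.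

Lemma integrableC_fourier f k : Cc f -> integrableC mu1 (fun x => cexp (k * x) * f x).
Proof. by move=> cf; apply: Cc_integrableC; apply: CcM => //; exact: continuousC_cexp. Qed.

Lemma invfourierD f g k : Cc f -> Cc g ->
  invfourier (fun x => f x + g x) k = invfourier f k + invfourier g k.
Proof.
move=> cf cg; rewrite /invfourier -(mintegralCD (m := mu1)); [|exact: integrableC_fourier..].
by congr (mintegralC _ _); apply/funext => x; rewrite mulrDr.
Qed.

Lemma invfourierZ z f k : Cc f ->
  invfourier (fun x => z * f x) k = z * invfourier f k.
Proof.
move=> cf; rewrite /invfourier -(mintegralCZ (m := mu1)); [|exact: integrableC_fourier].
by congr (mintegralC _ _); apply/funext => x; rewrite mulrCA.
Qed.

Lemma invfourier_affine f c t k : 0 < c -> Cc f ->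
  invfourier (fun x => f (c * x + t)) k =
  (c^-1)%:C * cexp (- (k * t / c)) * invfourier f (k / c).
Proof.
move=> c0 cf; rewrite /invfourier.
transitivity (integralC (fun x => cexp (- (k * t / c)) *
    ((fun y => cexp (k / c * y) * f y) (c * x + t)))).
  congr integralC; apply/funext => x; rewrite mulrA -cexpD; congr (cexp _ * _).
  by field; rewrite gt_eqF.
have cg : Cc (fun y => cexp (k / c * y) * f y).
  by apply: CcM => //; exact: continuousC_cexp.
rewrite [LHS](mintegralCZ (m := mu1)); last by apply: Cc_integrableC; exact: (Cc_affine t c0 cg).
rewrite [mintegralC _ _](integralC_affine (f := fun y => cexp (k / c * y) * f y) t c0)//; last exact: Cc_integrableC.
by rewrite mulrCA mulrA.
Qed.

Lemma invfourier_modulate f t k : invfourier (fun x => cexp (t * x) * f x) k =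
  invfourier f (k + t).
Proof.
rewrite /invfourier; congr integralC; apply/funext => x.
by rewrite mulrA -cexpD mulrDl.
Qed.

Lemma Cc_modulate f t : Cc f -> Cc (fun x => cexp (t * x) * f x).
Proof. by move=> cf; apply: CcM => //; exact: continuousC_cexp. Qed.

Lemma Cc_conj_shift f x : Cc f -> continuousC (fun y => (f (y - x))^*).
Proof.
move=> cf; apply: continuousC_conj.
have := continuousC_comp_affine 1 (- x) (Cc_continuousC cf).
by under eq_fun do rewrite mul1r.
Qed.

Lemma Cc_mulJ f g x : Cc f -> Cc g -> Cc (fun y => f y * (g (y - x))^*).
Proof.
move=> cf cg; under eq_fun do rewrite mulrC.
by apply: CcM => //; exact: Cc_conj_shift.
Qed.

(* Translates of [autoconv f] are not autoconvolutions, so the definition of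
   the Fourier transform applies to them only after polarization. *)
Lemma autoconv_polarization f c t x : 0 < c -> Cc f ->
  autoconv f (c * x + t) =
  (c / 4)%:C * \sum_(l < 4) 'i%C ^+ l *
    autoconv (fun y => f (c * y + t) + 'i%C ^+ l * f (c * y + 0)) x.
Proof.
move=> c0 cf.
have cG (l : 'I_4) : Cc (fun y => f (c * y + t) + 'i%C ^+ l * f (c * y + 0)).
  apply: CcD; first exact: Cc_affine.
  by apply: CcM; [exact: continuousC_cst|exact: Cc_affine].
pose H (l : 'I_4) y := 'i%C ^+ l * ((f (c * y + t) + 'i%C ^+ l * f (c * y + 0)) *
   (f (c * (y - x) + t) + 'i%C ^+ l * f (c * (y - x) + 0))^*).
have iH l : integrableC mu1 (H l).
  by apply: integrableCZ; apply: Cc_integrableC; exact: (Cc_mulJ x (cG l) (cG l)).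
transitivity ((c / 4)%:C * mintegralC mu1 (fun y => \sum_(l < 4) H l y)); last first.
  congr (_ * _); rewrite mintegralC_sum//; apply: eq_bigr => l _; rewrite /H mintegralCZ//.
  by apply: Cc_integrableC; exact: (Cc_mulJ x (cG l) (cG l)).
have -> : (fun y => \sum_(l < 4) H l y) =
    (fun y => 4 * ((fun u => f u * (f (u - (c * x + t)))^*) (c * y + t))).
  apply/funext => y; rewrite polarization4.
  by have -> : c * y + t - (c * x + t) = c * (y - x) + 0 by ring.
rewrite mintegralCZ; last first.
  apply: Cc_integrableC; apply: (Cc_affine (f := fun u => f u * (f (u - (c * x + t)))^*) t c0).
  exact: Cc_mulJ.
rewrite [mintegralC _ _](integralC_affine (f := fun u => f u * (f (u - (c * x + t)))^*) t c0); last first.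
  by apply: Cc_integrableC; exact: Cc_mulJ.
rewrite /autoconv !mulrA; set I := integralC _.
rewrite -[LHS]mul1r; congr (_ * _).
have -> : (4 : R[i]) = (4 : R)%:C by rewrite rmorph_nat.
rewrite -!(rmorphM (real_complex R)) -(rmorph1 (real_complex R)).
by congr (_%:C); field; rewrite gt_eqF.
Qed.

Lemma sqr_normCM z : (complex.Re `|z| ^+ 2)%:C = z * z^*.
Proof. by rewrite -normCK -add_Re2_Im2 sqr_normC. Qed.

(** The frequency side of [autoconv_polarization], with the same four test functions: the
    translation by t turns into a phase, the dilation by c into a rescaling of k. *)
Lemma sqr_norm_invfourier_polarization f c t k : 0 < c -> Cc f ->
  (c / 4)%:C * \sum_(l < 4) 'i%C ^+ l *
    (complex.Re `|invfourier (fun y => f (c * y + t) + 'i%C ^+ l * f (c * y + 0)) k| ^+ 2)%:C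
  = (c^-1)%:C * cexp (- (k * t / c)) * (complex.Re `|invfourier f (k / c)| ^+ 2)%:C.
Proof.
move=> c0 cf; set F := invfourier f (k / c).
under eq_bigr => l _.
  rewrite sqr_normCM invfourierD; [|exact: Cc_affine|]; last first.
    by apply: CcM; [exact: continuousC_cst|exact: Cc_affine].
  rewrite invfourierZ ?invfourier_affine//; last exact: Cc_affine.
  rewrite mulr0 mul0r oppr0 [cexp 0](_ : _ = 1) ?mulr1; last first.
    by rewrite /cexp mulr0 cos0 sin0.
  over.
rewrite polarization4 sqr_normCM -/F.
have -> : (((c^-1)%:C * F)^*)%R = ((c^-1)%:C * F^*)%R.
  by rewrite rmorphM /=; congr (_ * _); apply: eqC; rewrite /= ?oppr0.
have e : (c / 4)%:C * 4 * (c^-1)%:C = 1 :> R[i].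
  have -> : (4 : R[i]) = (4 : R)%:C by rewrite rmorph_nat.
  rewrite -!(rmorphM (real_complex R)) -(rmorph1 (real_complex R)).
  by congr (_%:C); field; rewrite gt_eqF.
move: e (cexp _) (F^*)%R; move: (c / 4)%:C (c^-1)%:C => x1 x2 e x3 x4.
by transitivity (x1 * 4 * x2 * (x2 * x3 * (F * x4))); [ring|rewrite e mul1r].
Qed.

End ComplexIntegral.

Lemma integrable_indic_lty d (T : measurableType d) (R : realType)
    (m : {measure set T -> \bar R}) (A : set T) :
  measurable A -> (m A < +oo)%E -> m.-integrable setT (EFin \o \1_A).
Proof.
move=> mA fA; apply/integrableP; split; first exact/measurable_EFinP/measurable_indic.
under eq_integral do rewrite /= ger0_norm ?indicE ?ler0n//.
by rewrite (integral_indic m measurableT mA) setIT.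
Qed.

(** * Translation boundedness of positive transforms *)

Section Tent.
Variable R : realType.
Notation mu1 := (@lebesgue_measure R).

(** The Weierstrass test with an explicit tail: in the gliding hump argument the tail measures how
    much the later humps can undo. *)
Lemma series_geometric_continuous (u : nat -> R -> R) (q : R) : 0 < q < 1 ->
  (forall m, continuous (u m)) -> (forall m x, `|u m x| <= q ^+ m) ->
  exists2 s : R -> R, continuous s &
    forall n x, `|s x - \sum_(0 <= m < n) u m x| <= q ^+ n / (1 - q).
Proof.
move=> /andP[q0 q1] cu uq.
have gq (a : R) : cvgn (series (geometric a q)).
  by apply: is_cvg_geometric_series; rewrite gtr0_norm.
have cs x : cvgn (series (fun m => u m x)).
  apply: normed_cvg; apply: (series_le_cvg (v_ := geometric 1 q)) => //.
  - by move=> n; exact: normr_ge0.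
  - by move=> n; rewrite /= mul1r exprn_ge0// ltW.
  - by move=> n; rewrite /= mul1r.
pose s x := limn (series (fun m => u m x)).
have sb n x : `|s x - \sum_(0 <= m < n) u m x| <= q ^+ n / (1 - q).
  have h : (fun N => `|series (fun m => u m x) N - \sum_(0 <= m < n) u m x|)
      @ \oo --> `|s x - \sum_(0 <= m < n) u m x|.
    by apply: cvg_norm; apply: cvgB; [exact: cs|exact: cvg_cst].
  rewrite -(cvg_lim (@Rhausdorff R) h); apply: limr_le; first exact: cvgP h.
  near=> N.
  have nN : (n <= N)%N by near: N; exact: nbhs_infty_ge.
  rewrite /series /= (big_cat_nat _ nN)//= addrAC subrr add0r.
  apply: (le_trans (ler_norm_sum _ _ _)).
  apply: (@le_trans _ _ (\sum_(n <= i < N) q ^+ i)).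
    by apply: ler_sum => i _; exact: uq.
  rewrite -{1}(subnKC nN) geometric_partial_tail.
  apply: geometric_le_lim => //; first by rewrite exprn_ge0// ltW.
  by rewrite gtr0_norm.
exists s => // x; apply/cvgrPdist_le => e e0.
have e4 : 0 < e / 3 by rewrite divr_gt0.
have [n qn] : exists n, q ^+ n / (1 - q) <= e / 3.
  have : (geometric (1 - q)^-1 q : R^nat) @ \oo --> 0.
    by apply: cvg_geometric; rewrite gtr0_norm.
  move/cvgrPdist_le => /(_ _ e4)[n _ /(_ n (leqnn n))] /=.
  rewrite sub0r normrN ger0_norm; first by rewrite mulrC; exists n.
  by rewrite mulr_ge0 ?invr_ge0 ?exprn_ge0 ?subr_ge0 ?ltW.
have cS : continuous (fun y => \sum_(0 <= m < n) u m y).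
  elim: (n) => [|k IH].
    by under eq_fun do rewrite big_geq//; move=> y; exact: cvg_cst.
  by under eq_fun do rewrite big_nat_recr//=; exact: continuousRD.
have /cvgrPdist_le/(_ _ e4) := cS x.
apply: filterS => y xy.
have := sb n x; have := sb n y; move: xy qn.
set a := s x; set b := s y; set A := (X in `|X - _| <= _); set B := (X in `|_ - X| <= _).
move=> h1 h2 h3 h4.
have -> : a - b = (a - A) + (A - B) - (b - B) by ring.
apply: le_trans (ler_normB _ _) _; apply: le_trans (lerD (ler_normD _ _) (lexx _)) _.
by lra.
Unshelve. all: by end_near. Qed.

(** The positive part of [8^-1 - |x|], written with absolute values so that continuity and the
    Lipschitz bound are inherited from the norm. The half-width 1/8 keeps the phase [2 * pi * k * x]
    within pi / 4 as long as [|k| <= 1]. *)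
Definition tent (x : R) : R := (`|8^-1 - `|x| | + (8^-1 - `|x|)) / 2.

Arguments tent : simpl never.

Lemma continuous_tent : continuous tent.
Proof.
have cn : continuous (fun x : R => 8^-1 - `|x|).
  by move=> x; apply: cvgB; [exact: cvg_cst|apply: cvg_norm; exact: cvg_id].
apply: continuousRM; last by move=> x; exact: cvg_cst.
apply: continuousRD => //.
by move=> x; apply: cvg_norm; exact: cn.
Qed.

Lemma tent_ge0 x : 0 <= tent x.
Proof.
rewrite /tent divr_ge0//; have := ler_norm (- (8^-1 - `|x|)); rewrite normrN; lra.
Qed.

Lemma tent_supp x : 8^-1 < `|x| -> tent x = 0.
Proof. by move=> h; rewrite /tent ltr0_norm ?subr_lt0// addrC subrr mul0r. Qed.

Lemma tent_lipschitz x y : `|tent x - tent y| <= `|x - y|.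
Proof.
have h1 : `| `|x| - `|y| | <= `|x - y| by exact: ler_dist_dist.
have h2 : `| `|8^-1 - `|x| | - `|8^-1 - `|y| | | <= `| `|x| - `|y| |.
  apply: (le_trans (ler_dist_dist _ _)).
  by rewrite -[leRHS]normrN le_eqVlt; apply/orP; left; apply/eqP; congr `| _ |; ring.
rewrite /tent -mulrBl normrM (ger0_norm (x := 2^-1))//.
rewrite ler_pdivrMr// opprD addrACA; apply: (le_trans (ler_normD _ _)).
have -> : 8^-1 - `|x| - (8^-1 - `|y|) = - (`|x| - `|y|) by ring.
by rewrite normrN; lra.
Qed.

Lemma integrable_tent : mu1.-integrable setT (EFin \o tent).
Proof.
by apply: (compact_support_integrable (r := 8^-1)); [exact: continuous_tent|exact: tent_supp].
Qed.

Definition tent_mass : R := Rintegral mu1 setT tent.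

Lemma tent_mass_gt0 : 0 < tent_mass.
Proof.
pose I : set (measurableTypeR R) := `[- 16^-1, 16^-1]%classic.
have mI : measurable I by exact: measurable_itv.
have fI : (mu1 I < +oo)%E.
  by rewrite /I lebesgue_measure_itv; case: ifP => _; rewrite ?ltry// -EFinB ltry.
have iI := integrable_indic_lty mI fI.
apply: (@lt_le_trans _ _ (Rintegral mu1 setT (fun x => 16^-1 * \1_I x))).
  rewrite RintegralZl// /Rintegral integral_indic// setIT.
  rewrite /I /= lebesgue_measure_itv /= lte_fin.
  rewrite (_ : - 16^-1 < 16^-1 :> R); last by lra.
  by rewrite -EFinB /=; lra.
apply: le_Rintegral => //.
- rewrite (_ : _ \o _ = (fun x => (16^-1)%:E * (\1_I x)%:E)%E)//.
  exact: integrableZl.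
- exact: integrable_tent.
- move=> x _; rewrite indicE; case: (boolP (x \in _)) => [|_]; last first.
    by rewrite mulr0; exact: tent_ge0.
  move=> /set_mem; rewrite /I /= in_itv /= -ler_norml => xI.
  rewrite /tent; have /ger0_norm -> : 0 <= 8^-1 - `|x| by lra.
  by rewrite mulr1; lra.
Qed.

Definition tentC (x : R) : R[i] := (tent x)%:C.

Lemma Cc_tentC : Cc tentC.
Proof.
split; first exact: continuous_tent.
  by move=> x; exact: cvg_cst.
by exists 8^-1 => x h; rewrite /tentC tent_supp.
Qed.

(** Since cos (2 y) is nonnegative, the double angle formula forces cos^2 y >= 1/2, which is more
    than 1/4. *)
Lemma cos_ge_half (y : R) : `|y| <= pi / 4 -> 2^-1 <= cos y.
Proof.
have pi0 := pi_gt0 R.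
rewrite ler_norml => /andP[y1 y2].
have c0 : 0 <= cos y by apply: cos_ge0_pihalf; apply/andP; split; lra.
have : 0 <= cos (y *+ 2).
  by apply: cos_ge0_pihalf; rewrite [y *+ 2]mulr2n; apply/andP; split; lra.
rewrite cos_mulr2n -mulr_natl => h.
rewrite leNgt; apply/negP => h2.
have : cos y ^+ 2 < 2^-1 ^+ 2 by rewrite ltr_pXn2r ?nnegrE// ?invr_ge0.
lra.
Qed.

Definition power_spectrum (f : R -> R[i]) (k : R) : R :=
  complex.Re `|invfourier f k| ^+ 2.

Lemma power_spectrum_tentC_ge (k : R) : `|k| <= 1 ->
  tent_mass ^+ 2 / 4 <= power_spectrum tentC k.
Proof.
move=> k1; rewrite /power_spectrum sqr_normC.
suff h : tent_mass / 2 <= complex.Re (invfourier tentC k).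
  apply: (@le_trans _ _ (complex.Re (invfourier tentC k) ^+ 2)); last first.
    by rewrite lerDl sqr_ge0.
  rewrite (_ : _ / 4 = (tent_mass / 2) ^+ 2); last by field.
  by rewrite ler_pXn2r// nnegrE ?divr_ge0 ?(ltW tent_mass_gt0)//;
    apply: le_trans h; rewrite divr_ge0 ?(ltW tent_mass_gt0).
rewrite /tent_mass mulrC -RintegralZl//; last exact: integrable_tent.
apply: le_Rintegral => //.
- rewrite (_ : _ \o _ = (fun x => (2^-1)%:E * (tent x)%:E)%E)//.
  by apply: integrableZl => //; exact: integrable_tent.
- by have [] := integrableC_fourier k Cc_tentC.
move=> x _; rewrite ReM /= mulr0 subr0 -/(tent x).
have [xs|xs] := ltP 8^-1 `|x|; first by rewrite tent_supp// !mulr0.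
apply: ler_wpM2r; first exact: tent_ge0.
apply: cos_ge_half; rewrite !normrM.
have pi0 := pi_gt0 R.
rewrite (gtr0_norm pi0) (ger0_norm (x := 2))//.
have : `|k| * `|x| <= 1 * 8^-1 by apply: ler_pM.
rewrite -[2 * pi * _]mulrAC; set z := `|k| * `|x| => hz.
have : z * pi <= 8^-1 * pi by apply: ler_wpM2r; [exact: ltW|lra].
by lra.
Qed.

End Tent.
Arguments tentC {R} x.
Arguments tent {R} x.

Section RintegralLe.
Context d (T : measurableType d) (R : realType) (m : {measure set T -> \bar R}).
Variables (I : set T) (mI : measurable I).
Implicit Types F G H : T -> R.

Lemma integrable_scale (c : R) F : m.-integrable I (EFin \o F) ->
  m.-integrable I (EFin \o (fun x => c * F x)).
Proof.
move=> iF; rewrite (_ : _ \o _ = (fun x => c%:E * (F x)%:E)%E)//.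
exact: integrableZl.
Qed.

Lemma integrable_add F G : m.-integrable I (EFin \o F) -> m.-integrable I (EFin \o G) ->
  m.-integrable I (EFin \o (fun x => F x + G x)).
Proof.
move=> iF iG; rewrite (_ : _ \o _ = (fun x => (F x)%:E + (G x)%:E)%E)//.
exact: integrableD.
Qed.

Lemma le_Rintegral_2D F G H : m.-integrable I (EFin \o F) ->
  m.-integrable I (EFin \o G) -> m.-integrable I (EFin \o H) ->
  (forall x, 2 * F x <= G x + H x) ->
  2 * Rintegral m I F <= Rintegral m I G + Rintegral m I H.
Proof.
move=> iF iG iH h; rewrite -RintegralZl// -RintegralD//.
by apply: le_Rintegral => //; [exact: integrable_scale|exact: integrable_add].
Qed.

Lemma integrable_const_lty (c : R) : (m I < +oo)%E -> m.-integrable I (EFin \o (fun=> c)).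
Proof. by move=> fI; apply: measurable_bounded_integrable => //; exact: bounded_cst. Qed.

Lemma le_Rintegral_2Dcst F G (c : R) : m.-integrable I (EFin \o F) ->
  m.-integrable I (EFin \o G) -> (m I < +oo)%E ->
  (forall x, G x <= 2 * F x + c) ->
  Rintegral m I G <= 2 * Rintegral m I F + c * fine (m I).
Proof.
move=> iF iG fI h; have ic := integrable_const_lty c fI.
rewrite -RintegralZl// -Rintegral_cst// -RintegralD//; last exact: integrable_scale.
apply: le_Rintegral => //; apply: integrable_add => //; exact: integrable_scale.
Qed.

Lemma cst_le_Rintegral F (c : R) : m.-integrable I (EFin \o F) -> (m I < +oo)%E ->
  (forall x, I x -> c <= F x) -> c * fine (m I) <= Rintegral m I F.
Proof.
move=> iF fI h; rewrite -Rintegral_cst//; apply: le_Rintegral => //.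
exact: integrable_const_lty.
Qed.

Lemma le_Rintegral_setT F : m.-integrable setT (EFin \o F) -> (forall x, 0 <= F x) ->
  Rintegral m I F <= Rintegral m setT F.
Proof.
move=> iF F0; rewrite Rintegral_mkcond; apply: le_Rintegral => //.
  rewrite (_ : _ \o _ = (EFin \o F) \_ I).
    by apply/(integrable_mkcond _ mI).1; apply: integrableS iF.
  by apply/funext => k; rewrite /= !patchE; case: ifP.
by move=> k _; rewrite patchE; case: ifP.
Qed.

End RintegralLe.

(** In units of [A * m * M], the n-th hump contributes 1/4 and the tail costs at most 16/225; half
    of the difference still exceeds 1/16. *)
Lemma gliding_hump_gain (R : realFieldType) (N J V M A m : R) : 0 <= N ->
  N <= A * m -> 0 <= M -> J <= V ->
  A * M / 4 * m <= 2 * J + 16 * (A / 15 ^+ 2) * M * m -> N * (M / 16) <= V.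
Proof.
move=> N0 h1 M0 h2 h3.
have h4 : N * M <= A * m * M by exact: ler_wpM2r.
have h5 : 0 <= N * M by exact: mulr_ge0.
have e1 : A * M / 4 * m - 16 * (A / 15 ^+ 2) * M * m = (4^-1 - 16 / 225) * (A * m * M) by field.
have e2 : N * (M / 16) = 16^-1 * (N * M) by ring.
have h6 : (4^-1 - 16 / 225) * (A * m * M) <= 2 * V by rewrite -e1; lra.
rewrite e2; move: h4 h5 h6; move: (A * m * M) (N * M) => x y *; lra.
Qed.

Section TranslationBounded.
Variable R : realType.
Notation mu1 := (@lebesgue_measure R).
Notation M := (@tent_mass R).
Implicit Types (f Z : R -> R[i]) (k : R).

Lemma power_spectrum_ge0 f k : 0 <= power_spectrum f k.
Proof. by rewrite /power_spectrum sqr_ge0. Qed.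

Lemma power_spectrumE f k : power_spectrum f k =
  complex.Re (invfourier f k) ^+ 2 + complex.Im (invfourier f k) ^+ 2.
Proof. exact: sqr_normC. Qed.

Lemma Cc_mul_tentC Z : continuousC Z -> Cc (fun x => Z x * tentC x).
Proof. by move=> cZ; apply: CcM => //; exact: Cc_tentC. Qed.

(** The real and the imaginary part of the integrand are each at most [2 * kap * tent], so each
    squared integral is at most 4 kap^2 M^2. *)
Lemma power_spectrum_mul_tentC_le Z (kap : R) k : continuousC Z ->
  (forall x, `|complex.Re (Z x)| <= kap) -> (forall x, `|complex.Im (Z x)| <= kap) ->
  power_spectrum (fun x => Z x * tentC x) k <= 8 * kap ^+ 2 * M ^+ 2.
Proof.
move=> cZ Z1 Z2.
have [i1 i2] := integrableC_fourier k (Cc_mul_tentC cZ).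
have kap0 : 0 <= kap by apply: le_trans (Z1 0).
have h (h : R -> R) : mu1.-integrable setT (EFin \o h) ->
    (forall x, `|h x| <= 2 * kap * tent x) ->
    Rintegral mu1 setT h ^+ 2 <= 4 * kap ^+ 2 * M ^+ 2.
  move=> ih hb; rewrite -[X in X <= _]ger0_norm ?sqr_ge0// normrX.
  rewrite (_ : 4 * _ * _ = (2 * kap * M) ^+ 2); last by ring.
  rewrite ler_pXn2r// ?nnegrE// ?mulr_ge0 ?(ltW (tent_mass_gt0 R))//.
  apply: le_trans (le_normr_Rintegral _ ih) _ => //.
  rewrite -RintegralZl//; last exact: integrable_tent.
  apply: le_Rintegral => //.
  - exact: integrable_norm.
  - rewrite (_ : _ \o _ = (fun x => (2 * kap)%:E * (tent x)%:E)%E)//.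
    by apply: integrableZl => //; exact: integrable_tent.
rewrite power_spectrumE.
rewrite (_ : 8 * _ * _ = 4 * kap ^+ 2 * M ^+ 2 + 4 * kap ^+ 2 * M ^+ 2); last by ring.
have hc (a b x y : R) : `|a| <= 1 -> `|b| <= 1 -> `|x| <= kap -> `|y| <= kap ->
    `|a * x + b * y| <= 2 * kap.
  move=> a1 b1 xk yk; apply: le_trans (ler_normD _ _) _; rewrite !normrM.
  by rewrite mulrDl mul1r; apply: lerD; rewrite -[leRHS]mul1r; apply: ler_pM.
apply: lerD.
  apply: h => // x; rewrite !ReImE /= !mulr0 subr0 add0r.
  rewrite mulrA [sin _ * _]mulrA -mulrBl normrM (ger0_norm (tent_ge0 x)).
  apply: ler_wpM2r; first exact: tent_ge0.
  by rewrite -mulNr; apply: hc => //; rewrite ?normrN ?cos_max ?sin_max.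
apply: h => // x; rewrite !ReImE /= !mulr0 subr0 add0r.
rewrite mulrA [sin _ * _]mulrA -mulrDl normrM (ger0_norm (tent_ge0 x)).
apply: ler_wpM2r; first exact: tent_ge0.
by apply: hc => //; rewrite ?cos_max ?sin_max.
Qed.

Lemma power_spectrumD_le f g k : Cc f -> Cc g ->
  power_spectrum (fun x => f x + g x) k <= 2 * power_spectrum f k + 2 * power_spectrum g k.
Proof.
move=> cf cg; rewrite !power_spectrumE invfourierD// !ReImE.
move: (complex.Re _) (complex.Im _) (complex.Re _) (complex.Im _) => a b c d.
have := sqr_ge0 (a - c); have := sqr_ge0 (b - d); rewrite !expr2; lra.
Qed.

Lemma power_spectrum_parallelogram f g k : Cc f -> Cc g ->
  2 * power_spectrum g k <= power_spectrum (fun x => f x + g x) k +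
    power_spectrum (fun x => f x + - 1 * g x) k.
Proof.
move=> cf cg; rewrite !power_spectrumE !invfourierD//; last first.
  by apply: CcM => //; exact: continuousC_cst.
rewrite (invfourierZ (-1))// !mulN1r !ReImE.
move: (complex.Re _) (complex.Im _) (complex.Re _) (complex.Im _) => a b c d.
have := sqr_ge0 a; have := sqr_ge0 b; rewrite !expr2; lra.
Qed.

Lemma power_spectrum_modulated_tentC (c s k : R) :
  power_spectrum (fun x => c%:C * cexp (- s * x) * tentC x) k =
  c ^+ 2 * power_spectrum tentC (k - s).
Proof.
rewrite !power_spectrumE.
have -> : (fun x : R => c%:C * cexp (- s * x) * tentC x) =
    (fun x => c%:C * (cexp (- s * x) * tentC x)) by apply/funext => x; rewrite mulrA.
rewrite invfourierZ; last exact/Cc_modulate/Cc_tentC.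
rewrite invfourier_modulate; move: (invfourier _ _) => z.
by rewrite !ReImE /= !mul0r subr0 addr0; ring.
Qed.

Variable mu : {measure set (measurableTypeR R) -> \bar R}.
Hypothesis mu_fin : forall a b : R, (mu `[a, b]%classic < +oo)%E.
Hypothesis mu_int : forall f, Cc f -> mu.-integrable setT (EFin \o power_spectrum f).

(* Gliding hump: if the mass of [I n] were at least [n.+1 * 16 ^ (2 n)], sum the
   tents modulated towards [I n] with amplitudes [16 ^- n]; by the parallelogram
   law one choice of sign keeps the n-th hump on [I n], and the tail, of size
   [16 ^- n / 15], cannot cancel it since 16 / 15 ^ 2 < 1 / 4. *)
Lemma translation_bounded : exists C : R, forall t : R, (mu `[t, (t + 1)%R]%classic <= C%:E)%E.
Proof.
apply/not_existsP => nb.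
(* The factor 256^n compensates the squared amplitude (16^-n)^2 of the n-th hump; the remaining
   factor n.+1 is what finally exceeds any fixed integral. *)
have /choice[s sP] : forall n, exists s : R,
    n.+1%:R * 256 ^+ n < fine (mu `[s, s + 1]%classic).
  move=> n.
  have /existsNP[t /negP] := nb (n.+1%:R * 256 ^+ n); rewrite -ltNge => ht.
  by exists t; rewrite -lte_fin fineK// ge0_fin_numE.
pose I n : set (measurableTypeR R) := `[s n, s n + 1]%classic.
have mI n : measurable (I n) by exact: measurable_itv.
have fI n : (mu (I n) < +oo)%E by exact: mu_fin.
pose m n := fine (mu (I n)).
have m0 n : 0 <= m n by exact: fine_ge0.
pose q : R := 16^-1.
have q01 : 0 < q < 1 by rewrite /q; lra.
pose e n x : R[i] := (q ^+ n)%:C * cexp (- s n * x).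
pose J n f := Rintegral mu (I n) (power_spectrum f).
(* The modulating factor of the n-th partial sum. The sign of each new hump is decided by comparing
   integrals over [I n]: plus if it already retains the hump, minus otherwise. *)
pose Z := fix Z n : R -> R[i] := if n is n'.+1 then
    if `[< J n' (fun x => e n' x * tentC x) <=
           J n' (fun x => Z n' x * tentC x + e n' x * tentC x) >]
    then fun x => Z n' x + e n' x else fun x => Z n' x + - 1 * e n' x
  else fun=> 0.
have ce n : continuousC (e n).
  by apply: continuousCM; [exact: continuousC_cst|exact: continuousC_cexp].
have cZ n : continuousC (Z n).
  elim: n => [|n IH]; first exact: continuousC_cst.
  rewrite /=; case: ifP => _; apply: continuousCD => //.
  by apply: continuousCM => //; exact: continuousC_cst.
have intI n f : Cc f -> mu.-integrable (I n) (EFin \o power_spectrum f).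
  by move=> cf; apply: integrableS (mu_int cf).
have JZ n : J n (fun x => e n x * tentC x) <= J n (fun x => Z n.+1 x * tentC x).
  rewrite /=; case: asboolP => [|/negP]; rewrite -?ltNge => h.
    rewrite (_ : (fun x => (Z n x + e n x) * tentC x) =
      (fun x => Z n x * tentC x + e n x * tentC x))//.
    by apply/funext => x; rewrite mulrDl.
  rewrite (_ : (fun x => (Z n x + -1 * e n x) * tentC x) =
      (fun x => Z n x * tentC x + -1 * (e n x * tentC x))); last first.
    by apply/funext => x; rewrite mulrDl -(mulrA (-1)).
  have cZb := Cc_mul_tentC (cZ n); have ceb := Cc_mul_tentC (ce n).
  have ceb' : Cc (fun x => -1 * (e n x * tentC x)).
    by apply: CcM => //; exact: continuousC_cst.
  have : 2 * J n (fun x => e n x * tentC x) <=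
      J n (fun x => Z n x * tentC x + e n x * tentC x) +
      J n (fun x => Z n x * tentC x + -1 * (e n x * tentC x)).
    apply: le_Rintegral_2D => //; [exact: intI|exact/intI/CcD|exact/intI/CcD|].
    by move=> k; exact: power_spectrum_parallelogram.
  by move: h; move: (J n _) (J n _) (J n _) => a b c; lra.
have Zd n x : `|complex.Re (Z n.+1 x - Z n x)| <= q ^+ n /\
    `|complex.Im (Z n.+1 x - Z n x)| <= q ^+ n.
  have eq1 : Z n.+1 x - Z n x = e n x \/ Z n.+1 x - Z n x = - e n x.
    rewrite /=; case: ifP => _; rewrite addrAC subrr add0r; first by left.
    by right; rewrite mulN1r.
  have q0 : 0 <= q ^+ n by rewrite exprn_ge0// ltW//; case/andP: q01.
  have [h1 h2] : `|complex.Re (e n x)| <= q ^+ n /\ `|complex.Im (e n x)| <= q ^+ n.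
    rewrite /e !ReImE /= !mul0r subr0 addr0 !normrM (ger0_norm q0).
    by split; rewrite ler_piMr// ?cos_max ?sin_max.
  by case: eq1 => ->; rewrite ?ReImE ?normrN.
(* Writing [Z n] as a telescoping series makes it a partial sum with geometric terms, so that its
   uniform limit [S] exists, separately for real and imaginary parts. *)
have tele (p : R[i] -> R) n x : {morph p : a b / a - b >-> a - b} -> p 0 = 0 ->
    p (Z n x) = \sum_(0 <= m < n) p (Z m.+1 x - Z m x).
  move=> pB p0; elim: n => [|n IH]; first by rewrite big_geq.
  by rewrite big_nat_recr//= -IH -/(Z n.+1) pB addrC subrK.
have cd n : continuousC (fun x => Z n.+1 x - Z n x).
  under eq_fun do rewrite -[- Z n _]mulN1r.
  apply: continuousCD => //; apply: continuousCM => //; exact: continuousC_cst.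
have [S1 cS1 S1b] := series_geometric_continuous q01 (fun n => (cd n).1) (fun n x => (Zd n x).1).
have [S2 cS2 S2b] := series_geometric_continuous q01 (fun n => (cd n).2) (fun n x => (Zd n x).2).
pose S x := S1 x +i* S2 x.
have cS : continuousC S by [].
pose f x := S x * tentC x.
have cf : Cc f by exact: Cc_mul_tentC.
pose V := Rintegral mu setT (power_spectrum f).
have key n : n.+1%:R * (M ^+ 2 / 16) <= V.
  have JfV : J n f <= V.
    apply: le_Rintegral_setT => //; first exact: mu_int.
    exact: power_spectrum_ge0.
  have h1 : (q ^+ n) ^+ 2 * M ^+ 2 / 4 * m n <= J n (fun x => e n x * tentC x).
    apply: cst_le_Rintegral => //; first exact/intI/Cc_mul_tentC.
    move=> k; rewrite /I /= in_itv /= => /andP[k1 k2].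
    rewrite power_spectrum_modulated_tentC -mulrA ler_wpM2l ?sqr_ge0//.
    by apply: power_spectrum_tentC_ge; rewrite ler_norml; apply/andP; split; lra.
  (* The tail starts after the n-th hump, hence the exponent n.+1; with q = 1/16 it is 1/15 of the
     amplitude of that hump. *)
  pose kap := q ^+ n.+1 / (1 - q).
  have h2 : J n (fun x => Z n.+1 x * tentC x) <= 2 * J n f + 16 * kap ^+ 2 * M ^+ 2 * m n.
    have cD : continuousC (fun x => Z n.+1 x - S x).
      under eq_fun do rewrite -[- S _]mulN1r.
      apply: continuousCD => //; apply: continuousCM => //; exact: continuousC_cst.
    have -> : (fun x => Z n.+1 x * tentC x) = (fun x => f x + (Z n.+1 x - S x) * tentC x).
      by apply/funext => x; rewrite /f -mulrDl addrC subrK.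
    apply: le_Rintegral_2Dcst => //; [exact: intI| |].
      by apply: intI; apply: CcD => //; exact: Cc_mul_tentC.
    move=> k; apply: le_trans (power_spectrumD_le k cf (Cc_mul_tentC cD)) _.
    rewrite lerD2l (_ : 16 * _ * _ = 2 * (8 * kap ^+ 2 * M ^+ 2)); last by ring.
      rewrite ler_pM2l//; apply: power_spectrum_mul_tentC_le => // x.
        rewrite ReD ReN distrC (tele (@complex.Re R))//; first exact: S1b.
        by move=> a b; rewrite ReD ReN.
      rewrite ImD ImN distrC (tele (@complex.Im R))//; first exact: S2b.
      by move=> a b; rewrite ImD ImN.
  have kapE : kap = q ^+ n / 15 by rewrite /kap exprS /q; field.
  have h3 := le_trans h1 (le_trans (JZ n) h2).
  have h4 : n.+1%:R <= (q ^+ n) ^+ 2 * m n.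
    have -> : (q ^+ n) ^+ 2 = (256 ^+ n)^-1.
      by rewrite -exprM mulnC exprM -exprVn /q; congr (_ ^+ _); field.
    by rewrite mulrC ler_pdivlMr ?exprn_gt0//; exact: ltW (sP n).
  move: h3; rewrite kapE expr_div_n => h3.
  exact: (gliding_hump_gain (ler0n _ _) h4 (sqr_ge0 M) JfV h3).
have M0 : 0 < M ^+ 2 / 16 by rewrite divr_gt0// exprn_gt0// tent_mass_gt0.
(* For this n the lower bound [key n] already exceeds [V]. *)
pose n := Num.truncn (V / (M ^+ 2 / 16)).
have := key n; apply/negP; rewrite -ltNge -ltr_pdivrMr//.
exact: truncnS_gt.
Qed.

End TranslationBounded.

(** * Uniqueness of transforms *)

Section Kernel.
Variable R : realType.
Notation mu1 := (@lebesgue_measure R).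
Notation Mt := (@tent_mass R).

(** The common majorant for all test functions below: slow enough to dominate the power spectrum of
    the tent, fast enough to be integrable against every translation bounded measure. *)
Definition cauchy_weight (k : R) : R := (1 + k ^+ 2)^-1.

Lemma cauchy_weight_gt0 k : 0 < cauchy_weight k.
Proof. by rewrite invr_gt0 ltr_pwDl// sqr_ge0. Qed.

Lemma cexp_half : cexp (2^-1) = -1 :> R[i].
Proof.
rewrite /cexp mulrAC divff// mul1r cospi sinpi.
by apply: eqC; rewrite /= ?oppr0.
Qed.

(* Shifting by a half period of the character turns the Lipschitz bound for
   the tent into decay of its Fourier transform. *)
Lemma power_spectrum_tentC_decay (k : R) : 1 <= `|k| -> power_spectrum tentC k <= 2 / k ^+ 2.
Proof.
move=> k1.
have k0 : k != 0 by apply/negP => /eqP k0; move: k1; rewrite k0 normr0 ler10.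
pose s := (2 * k)^-1.
have sk : `|s| = (2 * `|k|)^-1 by rewrite /s normfV normrM ger0_norm.
have s1 : `|s| <= 2^-1 by rewrite sk lef_pV2 ?posrE ?mulr_gt0// ?ler_peMr//; lra.
have ct := @Cc_tentC R.
have cts := Cc_affine s (@ltr01 R) ct.
pose g x : R[i] := tentC x + -1 * tentC (1 * x + s).
have cg : Cc g by apply: CcD => //; apply: CcM => //; exact: continuousC_cst.
have e : invfourier g k = 2 * invfourier tentC k.
  rewrite /g invfourierD//; last by apply: CcM => //; exact: continuousC_cst.
  rewrite invfourierZ// invfourier_affine// invr1 !mulr1 rmorph1 mul1r.
  rewrite (_ : - (k * s) = - 2^-1); last by rewrite /s; field.
  rewrite cexpN cexp_half (_ : ((-1 : R[i])^*)%C = -1); last by apply: eqC; rewrite /= ?oppr0.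
  by ring.
pose D : R -> R := fun x => tent x - tent (1 * x + s).
have D0 x : ~~ (`|x| <= 1) -> D x = 0.
  rewrite -ltNge => x1; rewrite /D !tent_supp ?subrr//; last by lra.
  have : `|x| <= `|1 * x + s| + `|s|.
    by rewrite mul1r -{1}[x](addrK s); exact: ler_normB.
  lra.
have Db x : `|D x| <= `|s| * \1_(`[-1, 1]%classic : set R) x.
  have [x1|x1] := boolP (`|x| <= 1).
    rewrite indicE mem_set ?mulr1/=; last by rewrite /= in_itv /= -ler_norml.
    rewrite /D; apply: le_trans (tent_lipschitz _ _) _.
    by rewrite mul1r opprD addrA subrr add0r normrN.
  by rewrite D0// normr0 mulr_ge0// indicE ler0n.
pose I : set (measurableTypeR R) := `[-1, 1]%classic.
have mI : measurable I by exact: measurable_itv.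
have mu1I : mu1 I = (2 : R)%:E.
  rewrite /I lebesgue_measure_itv /= lte_fin (_ : -1 < 1 :> R); last by lra.
  by rewrite -EFinB opprK.
have fI : (mu1 I < +oo)%E by rewrite mu1I ltry.
have iI : mu1.-integrable setT (EFin \o (fun x => `|s| * \1_I x)).
  by apply: integrable_scale => //; exact: integrable_indic_lty.
have h (h : R -> R) : mu1.-integrable setT (EFin \o h) ->
    (forall x, `|h x| <= `|D x|) -> `|Rintegral mu1 setT h| <= 2 * `|s|.
  move=> ih hb; apply: le_trans (le_normr_Rintegral _ ih) _ => //.
  rewrite (_ : 2 * `|s| = Rintegral mu1 setT (fun x => `|s| * \1_I x)); last first.
    rewrite RintegralZl//; last by exact: integrable_indic_lty.
    by rewrite /Rintegral integral_indic// setIT /= mu1I mulrC.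
  apply: le_Rintegral => //; first exact: integrable_norm.
  by move=> x _; apply: le_trans (hb x) (Db x).
have [i1 i2] := integrableC_fourier k cg.
have gE x : g x = (D x)%:C.
  by rewrite /g /D /tentC; apply: eqC; rewrite !ReImE /=; ring.
have hRe : `|complex.Re (2 * invfourier tentC k)| <= 2 * `|s|.
  rewrite -e; apply: h => // x; rewrite gE !ReImE /= mulr0 subr0 normrM.
  by rewrite ler_piMl// cos_max.
have hIm : `|complex.Im (2 * invfourier tentC k)| <= 2 * `|s|.
  rewrite -e; apply: h => // x; rewrite gE !ReImE /= mulr0 add0r normrM.
  by rewrite ler_piMl// sin_max.
rewrite power_spectrumE; move: hRe hIm; move: (invfourier _ _) => z.
have -> : (2 : R[i]) = (2 : R)%:C by rewrite rmorph_nat.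
rewrite !ReImE /= !mul0r subr0 addr0 !normrM (ger0_norm (x := 2))// !ler_pM2l//.
move=> h1 h2.
have hs a : `|a| <= `|s| -> a ^+ 2 <= (4 * k ^+ 2)^-1.
  move=> ha; rewrite -real_normK ?num_real//.
  apply: (@le_trans _ _ (`|s| ^+ 2)); first by rewrite ler_pXn2r// nnegrE.
  by rewrite sk exprVn exprMn real_normK ?num_real// -natrX.
have := hs _ h1; have := hs _ h2.
rewrite invfM; have : 0 <= (k ^+ 2)^-1 by rewrite invr_ge0 sqr_ge0.
move: ((k ^+ 2)^-1) (complex.Re z ^+ 2) (complex.Im z ^+ 2) => x y t; lra.
Qed.

(** For [|k| < 1] the spectrum is at most 8 M^2 and 1 + k^2 <= 2; for [|k| >= 1] it is at most 2 /
    k^2 and 1 + k^2 <= 2 k^2. The sum of the two products covers both ranges. *)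
Definition tent_decay : R := 16 * Mt ^+ 2 + 4.

Lemma tent_decay_gt0 : 0 < tent_decay.
Proof. by rewrite ltr_wpDl// mulr_ge0// sqr_ge0. Qed.

Lemma power_spectrum_tentC_le (k : R) : power_spectrum tentC k <= tent_decay * cauchy_weight k.
Proof.
have M0 : 0 <= Mt ^+ 2 by exact: sqr_ge0.
have k20 := sqr_ge0 k.
rewrite ler_pdivlMr; last by rewrite ltr_pwDl.
have [k1|k1] := leP 1 `|k|.
  have k21 : 1 <= k ^+ 2 by rewrite -real_normK ?num_real// expr_ge1.
  have := power_spectrum_tentC_decay k1.
  rewrite ler_pdivlMr; last by lra.
  have := power_spectrum_ge0 tentC k; rewrite /tent_decay.
  move: (power_spectrum _ _) => x x0 hx.
  have : x * (1 + k ^+ 2) <= x * k ^+ 2 + x * k ^+ 2.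
    by rewrite -mulrDr; apply: ler_wpM2l => //; lra.
  lra.
have k21 : k ^+ 2 <= 1 by rewrite -real_normK ?num_real// expr_le1// ltW.
have h : power_spectrum tentC k <= 8 * Mt ^+ 2.
  have := @power_spectrum_mul_tentC_le R (fun=> 1) 1 k (continuousC_cst _).
  rewrite expr1n mulr1 /= normr1 normr0.
  under [X in power_spectrum X]eq_fun do rewrite mul1r.
  by apply=> // _.
have := power_spectrum_ge0 tentC k; move: h; move: (power_spectrum _ _) => x hx x0.
have : x * (1 + k ^+ 2) <= x * 2 by apply: ler_wpM2l => //; lra.
rewrite /tent_decay; lra.
Qed.

Lemma continuous_power_spectrum_tentC : continuous (power_spectrum (@tentC R)).
Proof.
have ht (h : R -> R) : continuous h -> (forall y, `|h y| <= 1) ->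
    continuous (fun k : R => Rintegral mu1 setT (fun x : R => h (2 * pi * (k * x)) * tent x)).
  move=> ch h1 k.
  have hc2 (p : R -> R) : continuous p -> continuous (fun x => h (2 * pi * p x)).
    move=> cp; apply: (@continuous_compR R (fun x => 2 * pi * p x)) => //.
    by apply: continuousRM => // x; exact: cvg_cst.
  have clin (c : R) : continuous (fun x : R => c * x).
    by apply: continuousRM => x; [exact: cvg_cst|exact: cvg_id].
  have clin' (c : R) : continuous (fun x : R => x * c).
    by apply: continuousRM => x; [exact: cvg_id|exact: cvg_cst].
  have int l : mu1.-integrable setT (EFin \o (fun x : R => h (2 * pi * (l * x)) * tent x)).
    apply: (compact_support_integrable (r := 8^-1)).
      by apply: continuousRM; [exact: hc2|exact: continuous_tent].
    by move=> x hx; rewrite tent_supp// mulr0.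
  apply: (@continuity_under_integral R _ _ mu1
     (fun k x => h (2 * pi * (k * x)) * tent x) setT measurableT (k - 1) (k + 1)
     _ _ tent).
  - by move=> x _; exact: int.
  - apply: aeW => y _ x _; move: x; apply: continuousRM => x; last exact: cvg_cst.
    exact: hc2.
  - exact: integrable_tent.
  - move=> x _; apply: aeW => y _; rewrite normrM (ger0_norm (tent_ge0 y)).
    by rewrite ler_piMl// tent_ge0.
  - by apply: mem_set => /=; rewrite in_itv /=; apply/andP; split; lra.
have -> : power_spectrum (@tentC R) = fun k : R =>
    Rintegral mu1 setT (fun x : R => cos (2 * pi * (k * x)) * tent x) *
    Rintegral mu1 setT (fun x : R => cos (2 * pi * (k * x)) * tent x) +
    Rintegral mu1 setT (fun x : R => sin (2 * pi * (k * x)) * tent x) *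
    Rintegral mu1 setT (fun x : R => sin (2 * pi * (k * x)) * tent x).
  apply/funext => k; rewrite power_spectrumE -!expr2.
  congr (_ ^+ 2 + _ ^+ 2); apply: eq_Rintegral => x _.
    by rewrite ReM /= mulr0 subr0.
  by rewrite ImM /= mulr0 add0r.
by apply: continuousRD; apply: continuousRM; apply: ht => //;
  [exact: continuous_cos|exact: cos_max|exact: continuous_cos|exact: cos_max
  |exact: continuous_sin|exact: sin_max|exact: continuous_sin|exact: sin_max].
Qed.

Lemma continuous_cauchy_weight : continuous cauchy_weight.
Proof.
move=> k; apply: (@cvgV R _ _ _ (fun k => 1 + k ^+ 2)).
  by rewrite gt_eqF// ltr_pwDl// sqr_ge0.
apply: cvgD; first exact: cvg_cst.
by apply: cvgM; exact: cvg_id.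
Qed.

End Kernel.

(** * Integrability of 1 / (1 + k^2) against translation bounded measures *)

Section CauchyWeight.
Variable R : realType.
Notation mu1 := (@lebesgue_measure R).

Definition translation_bounded_measure (mu : set (measurableTypeR R) -> \bar R) : Prop :=
  exists C : R, forall t : R, (mu `[t, (t + 1)%R]%classic <= C%:E)%E.

Variable mu : {measure set (measurableTypeR R) -> \bar R}.
Hypothesis mu_tb : translation_bounded_measure mu.

Lemma tb_bounded_lty (A : set (measurableTypeR R)) (a b : R) : measurable A -> 
  A `<=` `[a, b] -> (mu A < +oo)%E.
Proof.
move=> mA Aab; have [C hC] := mu_tb.
have le_mu (B D : set (measurableTypeR R)) : measurable B -> measurable D -> B `<=` D ->
    (mu B <= mu D)%E by move=> mB mD; apply: le_measure; exact: mem_set.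
pose n := (Num.truncn (b - a)).+1.
have h m : (mu `[a, (a + m%:R)%R]%classic < +oo)%E.
  elim: m => [|m IH].
    apply: (@le_lt_trans _ _ (mu `[a, (a + 1)%R]%classic)).
      apply: le_mu; [exact: measurable_itv..|].
      by apply: subset_itvl; rewrite bnd_simp; lra.
    by apply: le_lt_trans (hC a) _; rewrite ltry.
  apply: (@le_lt_trans _ _ (mu (`[a, (a + m%:R)%R]%classic `|`
      `[(a + m%:R)%R, (a + m%:R + 1)%R]%classic))).
    apply: le_mu; [exact: measurable_itv|by apply: measurableU; exact: measurable_itv|].
    move=> x /=; rewrite !in_itv /= -natr1 => /andP[h1 h2].
    by have [h3|h3] := leP x (a + m%:R); [left|right]; rewrite ?h1 ?h3//= ?(ltW h3)//; lra.
  apply: le_lt_trans (measureU2 _ _ _) _; [exact: measurable_itv..|].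
  by rewrite lte_add_pinfty//; apply: le_lt_trans (hC _) _; rewrite ltry.
apply: le_lt_trans (h n); apply: le_mu => //.
apply: subset_trans Aab _; apply: subset_itvl; rewrite bnd_simp.
have := truncnS_gt (b - a); rewrite -/n; lra.
Qed.

(** On the pair [J n] of unit intervals at distance n from the origin, the weight is at most 1 / (1
    + n^2) and the mass at most 2 C; the products are summable. *)
Lemma cauchy_weight_integrable : mu.-integrable setT (EFin \o (@cauchy_weight R)).
Proof.
have [C hC] := mu_tb.
have C0 : 0 <= C by rewrite -lee_fin; apply: le_trans (hC 0); exact: measure_ge0.
have mw : measurable_fun [set: measurableTypeR R] (@cauchy_weight R).
  exact: (continuous_measurable_fun (@continuous_cauchy_weight R)).
apply/integrableP; split; first exact/measurable_EFinP.
pose J (n : nat) : set (measurableTypeR R) :=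
  `[n%:R, (n%:R + 1)%R]%classic `|` `[(- n%:R - 1)%R, (- n%:R - 1 + 1)%R]%classic.
have mJ n : measurable (J n) by apply: measurableU; exact: measurable_itv.
have hJ n : (mu (J n) <= (2 * C)%:E)%E.
  apply: le_trans (measureU2 _ _ _) _; [exact: measurable_itv..|].
  by rewrite mulr_natl mulr2n EFinD; apply: leeD; exact: hC.
pose c (n : nat) : R := cauchy_weight n%:R.
pose f (n : nat) (x : measurableTypeR R) : \bar R := (c n * \1_(J n) x)%:E.
have c0 n : 0 <= c n by exact/ltW/cauchy_weight_gt0.
have f0 n x : (0 <= f n x)%E by rewrite lee_fin mulr_ge0// indicE ler0n.
have mf n : measurable_fun setT (f n).
  by apply/measurable_EFinP/measurable_funM => //; exact: measurable_indic.
have fw x : (`|(cauchy_weight x)%:E| <= \sum_(0 <= n <oo) f n x)%E.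
  pose n := Num.truncn `|x|.
  have /andP[n1 n2] : n%:R <= `|x| < n.+1%:R by exact: truncn_itv.
  apply: (@le_trans _ _ (f n x)).
    rewrite lee_fin gtr0_norm ?cauchy_weight_gt0// indicE mem_set ?mulr1; last first.
      rewrite -natr1 in n2; rewrite /J /= !in_itv /=.
      have [x0|x0] := leP 0 x; [left|right].
        by rewrite (ger0_norm x0) in n1 n2; rewrite n1 (ltW n2).
      rewrite (ltr0_norm x0) in n1 n2; apply/andP; split; lra.
    rewrite lef_pV2 ?posrE ?ltr_pwDl ?sqr_ge0// lerD2l -[leRHS]real_normK ?num_real//.
    by rewrite ler_pXn2r// nnegrE.
  apply: (le_trans _ (nneseries_lim_ge n.+1 _)) => //.
  by rewrite big_nat_recr//= leeDr// sume_ge0.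
(* A telescoping majorant, based on (N + 1) (N + 2) <= 4 (1 + N^2). *)
have partial N : \sum_(0 <= n < N) c n <= 4 - 4 / N.+1%:R.
  elim: N => [|N IH]; first by rewrite big_geq// divr1 subrr.
  rewrite big_nat_recr//=; apply: le_trans (lerD IH (lexx _)) _.
  rewrite /c /cauchy_weight -lerBrDl.
  have n1 : (0 : R) <= N%:R by [].
  have -> : 4 - 4 / N.+2%:R - (4 - 4 / N.+1%:R) = 4 / ((N%:R + 1) * (N%:R + 2)) :> R.
    by rewrite -!natr1; field; apply/andP; split; lra.
  rewrite -[4 / _]invrK invfM invrK lef_pV2 ?posrE; last 2 first.
  - by rewrite ltr_pwDl// sqr_ge0.
  - by rewrite mulr_gt0// mulr_gt0; lra.
  have := sqr_ge0 (N%:R - 2^-1 : R); rewrite !expr2; lra.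
apply: (@le_lt_trans _ _ (\int[mu]_x \sum_(0 <= n <oo) f n x)%E).
  apply: ge0_le_integral => //.
  - by apply/measurable_EFinP; exact: measurableT_comp.
  - by apply: (ge0_emeasurable_sum (P := xpredT)).
  - by move=> x _; exact: fw.
rewrite integral_nneseries//.
apply: (@le_lt_trans _ _ (8 * C)%:E); last by rewrite ltry.
apply: lime_le; first by apply: is_cvg_nneseries => n _ _; exact: integral_ge0.
apply: nearW => N.
apply: (@le_trans _ _ (\sum_(0 <= n < N) (c n * (2 * C))%:E)%E).
  apply: lee_sum => n _; rewrite /f.
  under eq_integral do rewrite EFinM.
  rewrite ge0_integralZl_EFin//; last exact/measurable_EFinP/measurable_indic.
  by rewrite integral_indic// setIT EFinM; apply: lee_wpmul2l => //; rewrite lee_fin.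
rewrite sumEFin lee_fin -mulr_suml.
apply: (@le_trans _ _ (4 * (2 * C))); last by lra.
apply: ler_wpM2r; first by rewrite mulr_ge0.
by apply: le_trans (partial N) _; rewrite gerBl divr_ge0.
Qed.

End CauchyWeight.

Lemma Rintegral_dominated_cvg d (T : measurableType d) (R : realType)
    (m : {measure set T -> \bar R}) (F_ : nat -> T -> R) (F G : T -> R) :
  (forall n, measurable_fun setT (F_ n)) -> measurable_fun setT F ->
  (forall x, F_ n x @[n --> \oo] --> F x) -> m.-integrable setT (EFin \o G) ->
  (forall n x, `|F_ n x| <= G x) ->
  Rintegral m setT (F_ n) @[n --> \oo] --> Rintegral m setT F.
Proof.
move=> mF_ mF cF iG FG.
have [||||iF _ cI] := @dominated_convergence _ _ _ m setT measurableT
  (fun n => EFin \o F_ n) (EFin \o F) (EFin \o G) _ _ _ iG.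
- by move=> n; exact/measurable_EFinP.
- exact/measurable_EFinP.
- by apply: aeW => x _; apply: cvg_EFin; [exact: nearW|exact: cF].
- by apply: aeW => x n _; rewrite /= lee_fin.
apply: (@fine_cvg _ _ _ _ (fun n => (\int[m]_x (EFin \o F_ n) x)%E)).
rewrite fineK//; exact: integrable_fin_num iF.
Qed.

Section DominatedClass.
Variable R : realType.
Variables (I : finType) (mu : I -> {measure set (measurableTypeR R) -> \bar R}).
Variables (u : I -> R -> R) (U : R).
Hypothesis mu_tb : forall a, translation_bounded_measure (mu a).
Hypothesis mu_u : forall a, measurable_fun [set: measurableTypeR R] (u a).
Hypothesis u_le : forall a k, `|u a k| <= U.

(** A linear relation between locally finite measures, kept as a weighted family: no difference of
    possibly infinite values is ever formed. *)
Definition pairing (g : R -> R) : R :=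
  \sum_a Rintegral (mu a) setT (fun k => u a k * g k).

(* Translation bounded measures integrate [cauchy_weight], which makes the class
   [annihilated] below stable under dominated limits. *)
Definition dominated_by (C : R) (g : R -> R) : Prop :=
  measurable_fun [set: measurableTypeR R] g /\ forall k, `|g k| <= C * cauchy_weight k.

Definition annihilated (g : R -> R) : Prop :=
  (exists C, dominated_by C g) /\ pairing g = 0.

Lemma dominated_pairing_le C g : dominated_by C g ->
  forall a k, `|u a k * g k| <= U * C * cauchy_weight k.
Proof. by move=> [_ h] a k; rewrite normrM -mulrA; apply: ler_pM. Qed.

Lemma integrable_weight a (C : R) :
  (mu a).-integrable setT (EFin \o (fun k => C * cauchy_weight k)).
Proof. by apply: integrable_scale => //; exact: cauchy_weight_integrable. Qed.

Lemma integrable_pairing C g a : dominated_by C g ->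
  (mu a).-integrable setT (EFin \o (fun k => u a k * g k)).
Proof.
move=> dg; apply: le_integrable (integrable_weight a (U * C)) => //.
  by apply/measurable_EFinP/measurable_funM => //; case: dg.
move=> k _; rewrite lee_fin; apply: le_trans (dominated_pairing_le dg a k) _.
exact: ler_norm.
Qed.

Lemma annihilatedD g h : annihilated g -> annihilated h -> annihilated (fun k => g k + h k).
Proof.
move=> [[C dg] g0] [[D dh] h0]; split.
  exists (C + D); split; first by apply: measurable_funD; [case: dg|case: dh].
  by move=> k; rewrite mulrDl; apply: le_trans (ler_normD _ _) _; apply: lerD;
    [case: dg|case: dh].
rewrite -[RHS](addr0 0) -{1}g0 -h0 /pairing -big_split /=; apply: eq_bigr => a _.
under eq_Rintegral do rewrite mulrDr.
by rewrite RintegralD//; apply: integrable_pairing; [exact: dg|exact: dh].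
Qed.

Lemma annihilatedZ c g : annihilated g -> annihilated (fun k => c * g k).
Proof.
move=> [[C dg] g0]; split.
  exists (`|c| * C); split; first by apply: measurable_funM => //; case: dg.
  by move=> k; rewrite normrM -mulrA ler_wpM2l//; case: dg.
rewrite -[RHS](mulr0 c) -{1}g0 /pairing mulr_sumr; apply: eq_bigr => a _.
under eq_Rintegral do rewrite mulrCA.
by rewrite RintegralZl//; apply: integrable_pairing dg.
Qed.

Lemma annihilatedB g h : annihilated g -> annihilated h -> annihilated (fun k => g k - h k).
Proof.
move=> ag ah; under eq_fun do rewrite -mulN1r.
by apply: annihilatedD => //; exact: annihilatedZ.
Qed.

Lemma annihilated_cvg C (g_ : nat -> R -> R) (g : R -> R) :
  (forall n, annihilated (g_ n)) -> (forall n, dominated_by C (g_ n)) ->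
  measurable_fun [set: measurableTypeR R] g ->
  (forall k, g_ n k @[n --> \oo] --> g k) -> annihilated g.
Proof.
move=> ag dg mg cg.
have gC k : `|g k| <= C * cauchy_weight k.
  have h : `|g_ n k| @[n --> \oo] --> `|g k| by apply: cvg_norm; exact: cg.
  rewrite -(cvg_lim (@Rhausdorff R) h).
  by apply: limr_le; [exact: cvgP h|apply: nearW => n; case: (dg n)].
split; first by exists C.
have h : pairing (g_ n) @[n --> \oo] --> pairing g.
  rewrite /pairing; apply: cvg_big => [|a _]; first exact: add_continuous.
  apply: (@Rintegral_dominated_cvg _ (measurableTypeR R) R (mu a)
    (fun n k => u a k * g_ n k) (fun k => u a k * g k)
    (fun k => U * C * cauchy_weight k)).
  - by move=> n; apply: measurable_funM => //; case: (dg n).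
  - exact: measurable_funM.
  - by move=> k; apply: cvgM; [exact: cvg_cst|exact: cg].
  - exact: integrable_weight.
  - by move=> n k; exact: dominated_pairing_le (dg n) a k.
have h0 : pairing (g_ n) @[n --> \oo] --> (0 : R).
  rewrite (_ : (fun n => pairing (g_ n)) = fun=> 0); first exact: cvg_cst.
  by apply/funext => n; case: (ag n).
exact: (cvg_unique _ h h0).
Qed.

End DominatedClass.

Section SigmaFiniteMeasure.
Context d (T : measurableType d) (R : realType).
Variables (mu : {measure set T -> \bar R}) (sf : sigma_finite setT mu).

(** An alias of [mu] that carries the proof, so that the sigma-finite structure demanded by Fubini
    can be attached to a measure for which it is only a hypothesis. *)
Definition as_sigma_finite of sigma_finite setT mu : set T -> \bar R := mu.
HB.instance Definition _ := Measure.on (as_sigma_finite sf).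
HB.instance Definition _ := Measure_isSigmaFinite.Build _ _ _ (as_sigma_finite sf) sf.

End SigmaFiniteMeasure.

Section Fubini_locally_finite.
Variable R : realType.
Notation mu1 := (@lebesgue_measure R).
Variable mu : {measure set (measurableTypeR R) -> \bar R}.
Hypothesis mu_tb : translation_bounded_measure mu.

Lemma tb_sigma_finite : sigma_finite setT mu.
Proof.
exists (fun n => `[- n%:R, n%:R]%classic).
  apply/seteqP; split => // x _; exists (Num.truncn `|x|).+1 => //=.
  by rewrite in_itv /= -ler_norml ltW// truncnS_gt.
move=> n; split; first exact: measurable_itv.
by apply: (tb_bounded_lty mu_tb (a := - n%:R) (b := n%:R)) => //; exact: measurable_itv.
Qed.

(** The majorant [W] of the inner integrals of |F| yields joint integrability by Tonelli;
    integrability of all slices makes the real-valued inner integrals faithful. *)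
Lemma Rintegral_Fubini (F : R -> R -> R) (W : R -> R) :
  measurable_fun [set: measurableTypeR R * measurableTypeR R] (fun x => F x.1 x.2) ->
  (forall k, mu1.-integrable setT (EFin \o F k)) ->
  (forall t, mu.-integrable setT (EFin \o F ^~ t)) ->
  mu.-integrable setT (EFin \o W) ->
  (forall k, Rintegral mu1 setT (fun t => `|F k t|) <= W k) ->
  mu1.-integrable setT (EFin \o (fun t => Rintegral mu setT (F ^~ t))) /\
  Rintegral mu setT (fun k => Rintegral mu1 setT (F k)) =
  Rintegral mu1 setT (fun t => Rintegral mu setT (F ^~ t)).
Proof.
move=> mF i1 i2 iW FW.
pose m : {sigma_finite_measure set (measurableTypeR R) -> \bar R} :=
  as_sigma_finite tb_sigma_finite.
pose f : measurableTypeR R * measurableTypeR R -> \bar R := fun x => (F x.1 x.2)%:E.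
have mf : measurable_fun setT f by exact/measurable_EFinP.
have maf : measurable_fun setT (abse \o f).
  by apply/measurable_EFinP; exact: measurableT_comp.
have ifp : (m \x mu1)%E.-integrable setT f.
  apply/integrable12ltyP => //.
  apply: (@le_lt_trans _ _ (\int[mu]_k (W k)%:E)%E).
    apply: ge0_le_integral => //.
    - by move=> k _; exact: integral_ge0.
    - by apply: (measurable_fun_fubini_tonelli_F (abse \o f)) => [|x]; [exact: maf|exact: abse_ge0].
    - by case/integrableP : iW.
    - move=> k _; rewrite /f /= -[leLHS]fineK ?lee_fin; first exact: FW.
      exact: (integrable_fin_num measurableT (integrable_norm (i1 k))).
  by have := integrable_fin_num measurableT iW; rewrite ge0_fin_numE//; apply: integral_ge0 => k _; rewrite lee_fin; apply: le_trans (FW k); apply: Rintegral_ge0.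
have e1 : (fun k => (\int[mu1]_t f (k, t))%E) = EFin \o (fun k => Rintegral mu1 setT (F k)).
  by apply/funext => k; rewrite /= fineK//; exact: integrable_fin_num (i1 k).
have e2 : (fun t => (\int[m]_k f (k, t))%E) = EFin \o (fun t => Rintegral mu setT (F ^~ t)).
  by apply/funext => t; rewrite /= fineK//; exact: integrable_fin_num (i2 t).
split.
  rewrite -e2; apply/integrableP; split; first exact: (measurable_fubini_G ifp).
  have h21 := (integrable21ltyP m mu1 mf).1 ifp.
  apply: le_lt_trans h21; apply: ge0_le_integral => //.
  - by apply: measurableT_comp => //; exact: (measurable_fubini_G ifp).
  - by apply: (measurable_fun_fubini_tonelli_G (abse \o f)) => [|x]; [exact: maf|exact: abse_ge0].
  - move=> t _; apply: le_abse_integral => //.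
    by case/integrableP : (i2 t).
have := Fubini ifp; rewrite e1 e2 /Rintegral => h.
by congr fine; exact: h.
Qed.

End Fubini_locally_finite.

(** * Smoothed indicators of intervals and bounds uniform in the scale *)

Section Uniqueness.
Variable R : realType.
Notation mu1 := (@lebesgue_measure R).
Notation K := (power_spectrum (@tentC R)).

Lemma lebesgue_translation_bounded : translation_bounded_measure mu1.
Proof.
exists 1 => t; rewrite lebesgue_measure_itv /= lte_fin ltrDl ltr01 -EFinB lee_fin; lra.
Qed.

Lemma measurable_K : measurable_fun [set: measurableTypeR R] K.
Proof. exact: (continuous_measurable_fun (@continuous_power_spectrum_tentC R)). Qed.

Lemma measurable_KN : measurable_fun [set: measurableTypeR R] (fun s : R => K (- s)).
Proof.
have cN : continuous (fun s : R => - s).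
  by apply: (continuousRN (u := fun s : R => s)) => s; exact: cvg_id.
exact: (continuous_measurable_fun (continuous_compR cN
  (@continuous_power_spectrum_tentC R))).
Qed.

Lemma cauchy_weightN (s : R) : cauchy_weight (- s) = cauchy_weight s.
Proof. by rewrite /cauchy_weight sqrrN. Qed.

Lemma cauchy_weight_le1 (s : R) : cauchy_weight s <= 1.
Proof. by rewrite invf_le1 ?ltr_pwDl ?sqr_ge0// lerDl sqr_ge0. Qed.

(** Peetre's inequality, from k^2 <= 2 (k - t)^2 + 2 t^2; a dilation by [N >= 1] only makes the
    left-hand side smaller. *)
Lemma cauchy_weight_affine_le (N t k : R) : 1 <= N ->
  cauchy_weight (N * (k - t)) <= 2 * (1 + t ^+ 2) * cauchy_weight k.
Proof.
move=> N1; rewrite ler_pdivlMr ?ltr_pwDl ?sqr_ge0//.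
rewrite mulrC ler_pdivrMr ?ltr_pwDl ?sqr_ge0//.
have N2 : 1 <= N ^+ 2 by rewrite expr_ge1// (le_trans ler01 N1).
have h : k ^+ 2 <= 2 * (k - t) ^+ 2 + 2 * t ^+ 2.
  have := sqr_ge0 (k - t - t); rewrite !expr2; lra.
apply: (@le_trans _ _ (2 * (1 + t ^+ 2) * (1 + (k - t) ^+ 2))).
  have := mulr_ge0 (sqr_ge0 t) (sqr_ge0 (k - t)); lra.
apply: ler_wpM2l; first by rewrite mulr_ge0// addr_ge0// sqr_ge0.
by rewrite lerD2l exprMn ler_peMl// sqr_ge0.
Qed.

(** The reflected argument results from the substitution s = N (t - k) in K (N (k - t)). *)
Definition kernel_mass : R := Rintegral mu1 setT (fun s => K (- s)).

Lemma integrable_kernel : mu1.-integrable setT (EFin \o (fun s => K (- s))).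
Proof.
have iw := cauchy_weight_integrable lebesgue_translation_bounded.
apply: le_integrable (integrable_scale measurableT (tent_decay R) iw) => //.
  by apply/measurable_EFinP; exact: measurable_KN.
move=> s _; rewrite lee_fin ger0_norm ?power_spectrum_ge0//.
by rewrite -cauchy_weightN; apply: le_trans (power_spectrum_tentC_le _) (ler_norm _).
Qed.

Lemma integrable_kernel_indic (A : set R) : measurable (A : set (measurableTypeR R)) ->
  mu1.-integrable setT (EFin \o (fun s => \1_A s * K (- s))).
Proof.
move=> mA; apply: le_integrable integrable_kernel => //.
  apply/measurable_EFinP; apply: measurable_funM; first exact: measurable_indic.
  by case/integrableP : integrable_kernel => /measurable_EFinP.
move=> s _; rewrite lee_fin normrM indicE ler_piMl// normr_nat.
by case: (_ \in _).
Qed.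

(** The convolution of the indicator of [a, b] with N K (N .), evaluated at k after the substitution
    s = N (t - k); [kernel_windowE] makes the link. *)
Definition kernel_window (N a b k : R) : R :=
  Rintegral mu1 setT (fun s => \1_`[N * (a - k), N * (b - k)] s * K (- s)).

Lemma kernel_window_ge0 N a b k : 0 <= kernel_window N a b k.
Proof.
by apply: Rintegral_ge0 => s _; rewrite mulr_ge0 ?power_spectrum_ge0// indicE ler0n.
Qed.

Lemma kernel_window_le N a b k : kernel_window N a b k <= kernel_mass.
Proof.
apply: le_Rintegral => //; first by apply: integrable_kernel_indic; exact: measurable_itv.
  exact: integrable_kernel.
move=> s _; rewrite ler_piMl ?power_spectrum_ge0// indicE; by case: (_ \in _).
Qed.

(** For such k the whole window has |s| >= N |k| / 2, where the kernel is at most 4 [tent_decay] /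
    (N^2 k^2). Times the length N (b - a) this leaves 1 / (N k^2), and 1 / k^2 <= 2 / (1 + k^2)
    doubles the constant to 8. *)
Lemma kernel_window_far N a b k : 1 <= N -> a < b ->
  2 * Num.max `|a| `|b| + 1 < `|k| ->
  kernel_window N a b k <= 8 * tent_decay R * (b - a) * cauchy_weight k.
Proof.
move=> N1 ab kab.
have N0 : 0 < N by lra.
set m := Num.max _ _ in kab.
have am : `|a| <= m by rewrite le_max lexx.
have bm : `|b| <= m by rewrite le_max lexx orbT.
have m0 : 0 <= m by exact: le_trans am.
have k1 : 1 <= `|k| by lra.
have k0 : 0 < k ^+ 2 by rewrite -real_normK ?num_real// exprn_gt0//; lra.
have d0 := tent_decay_gt0 R.
set I := `[N * (a - k), N * (b - k)]%classic.
have NI : N * (a - k) < N * (b - k) by rewrite ltr_pM2l// ltrD2r.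
have lI : mu1 I = (N * (b - k) - N * (a - k))%:E.
  by rewrite /I lebesgue_measure_itv /= lte_fin NI EFinB.
have mI : measurable (I : set (measurableTypeR R)) by exact: measurable_itv.
have fI : (mu1 I < +oo)%E by rewrite lI ltry.
pose c := 4 * tent_decay R / (N ^+ 2 * k ^+ 2).
have N2 : 0 < N ^+ 2 by rewrite exprn_gt0.
have c0 : 0 <= c.
  by apply: divr_ge0; apply: mulr_ge0 => //; [exact: ltW|exact: ltW|exact: ltW].
apply: (@le_trans _ _ (c * (N * (b - k) - N * (a - k)))).
  have -> : c * (N * (b - k) - N * (a - k)) = Rintegral mu1 setT (fun s => c * \1_I s).
    rewrite RintegralZl//; last exact: integrable_indic_lty.
    by rewrite /Rintegral integral_indic// setIT /= lI.
  apply: le_Rintegral => //.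
  - exact: integrable_kernel_indic.
  - by apply: integrable_scale => //; exact: integrable_indic_lty.
  - move=> s _; rewrite indicE; case: (boolP (s \in _)) => [sI|_]; last by rewrite mul0r mulr0.
    rewrite mul1r mulr1; move/set_mem : sI; rewrite /I /= in_itv /= => /andP[s1 s2].
    apply: le_trans (power_spectrum_tentC_le _) _; rewrite cauchy_weightN.
    have sk : N ^+ 2 * k ^+ 2 <= 4 * s ^+ 2.
      have h : N * `|k| <= 2 * `|s|.
        have [k0'|k0'] := leP 0 k.
          rewrite (ger0_norm k0') in kab *.
          have : s <= - (N * (k / 2)).
            apply: le_trans s2 _; rewrite -mulrN ler_pM2l//.
            by have := ler_norm b; lra.
          have := ler_norm (- s); rewrite normrN; lra.
        rewrite (ltr0_norm k0') in kab *.
        have : N * (- k / 2) <= s.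
          apply: le_trans s1; rewrite ler_pM2l//.
          by have := ler_norm (- a); rewrite normrN; lra.
        have := ler_norm s; lra.
      have : (N * `|k|) ^+ 2 <= (2 * `|s|) ^+ 2.
        by rewrite ler_pXn2r// nnegrE mulr_ge0// ltW.
      by rewrite !exprMn !real_normK ?num_real//; lra.
    rewrite /c /cauchy_weight -mulrA [leRHS]mulrCA ler_pM2l//.
    rewrite -[4 / _]invrK invfM invrK lef_pV2 ?posrE; last 2 first.
    + by rewrite ltr_pwDl// sqr_ge0.
    + by rewrite mulr_gt0// ?invr_gt0// mulr_gt0.
    lra.
have -> : c * (N * (b - k) - N * (a - k)) = 4 * tent_decay R * (b - a) * (N * k ^+ 2)^-1.
  have nk : k != 0 by apply: contraTneq k1 => ->; rewrite normr0 ler10.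
  by rewrite /c; field; rewrite nk gt_eqF.
rewrite -[8](_ : 4 * 2 = 8); last by rewrite -natrM.
rewrite -!mulrA ler_pM2l// [leRHS]mulrCA ler_pM2l// [leRHS]mulrCA ler_pM2l ?subr_gt0//.
rewrite /cauchy_weight ler_pdivlMr ?ltr_pwDl ?sqr_ge0// (ler_pdivrMl _ _ (mulr_gt0 N0 k0)).
have k21 : 1 <= k ^+ 2 by rewrite -real_normK ?num_real// expr_ge1.
have : 1 * k ^+ 2 <= N * k ^+ 2 by rewrite ler_pM2r.
lra.
Qed.

(** The first summand covers [|k|] up to 2 max(|a|, |b|) + 1, where the window has at most the full
    mass, the second the range of [kernel_window_far]. Neither depends on N, as dominated
    convergence requires. *)
Definition window_const (a b : R) : R :=
  kernel_mass * (1 + (2 * Num.max `|a| `|b| + 1) ^+ 2) + 8 * tent_decay R * (b - a).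

Lemma kernel_mass_ge0 : 0 <= kernel_mass.
Proof. by apply: Rintegral_ge0 => s _; exact: power_spectrum_ge0. Qed.

Lemma kernel_window_bound N a b k : 1 <= N -> a < b ->
  `|kernel_window N a b k| <= window_const a b * cauchy_weight k.
Proof.
move=> N1 ab; rewrite ger0_norm ?kernel_window_ge0// /window_const mulrDl.
have w0 := cauchy_weight_gt0 k; have d0 := tent_decay_gt0 R; have T0 := kernel_mass_ge0.
set B := 2 * _ + 1.
have B0 : 0 <= B by rewrite addr_ge0// mulr_ge0// le_max normr_ge0.
have [kB|kB] := ltP B `|k|.
  apply: le_trans (kernel_window_far N1 ab kB) _; rewrite lerDr.
  by rewrite !mulr_ge0 ?(ltW w0)// addr_ge0// sqr_ge0.
apply: (@le_trans _ _ (kernel_mass * (1 + B ^+ 2) * cauchy_weight k)); last first.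
  by rewrite lerDl !mulr_ge0 ?(ltW w0)// ?(ltW d0)//; lra.
apply: le_trans (kernel_window_le _ _ _ _) _.
rewrite -mulrA ler_peMr// /cauchy_weight ler_pdivlMr ?ltr_pwDl ?sqr_ge0// mul1r lerD2l.
by rewrite -[X in X <= _]real_normK ?num_real// ler_pXn2r// nnegrE.
Qed.

End Uniqueness.

(** * The pointwise limit of the smoothed indicators *)

Section WindowLimit.
Variable R : realType.
Notation mu1 := (@lebesgue_measure R).
Notation K := (power_spectrum (@tentC R)).

(** For large n the sign of c decides. Only at c = 0, that is, at an end point of the interval, does
    a condition on s remain; this is the source of the half masses. *)
Lemma near_le_linear (c s : R) :
  \forall n \near \oo, (n.+1%:R * c <= s) = (c < 0) || ((c == 0) && (0 <= s)).
Proof.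
have [->|c0] := eqVneq c 0; first by apply: nearW => n; rewrite mulr0 ltxx.
exists (Num.truncn (`|s| / `|c|)) => // n /= hn.
have c0' : 0 < `|c| by rewrite normr_gt0.
have h : `|s| < n.+1%:R * `|c|.
  rewrite -ltr_pdivrMr//; apply: lt_le_trans (truncnS_gt _) _.
  by rewrite ler_nat.
rewrite orbF; have [cn|cp] := ltP c 0.
  rewrite (ltr0_norm cn) mulrN in h.
  by have := ler_norm (- s); rewrite normrN; lra.
have cp' : 0 < c by rewrite lt_neqAle eq_sym c0.
rewrite (gtr0_norm cp') in h; apply/negbTE; rewrite -ltNge.
by apply: le_lt_trans h; exact: ler_norm.
Qed.

Lemma kernel_window_cvg_set (a b k : R) (S : set R) :
  measurable (S : set (measurableTypeR R)) ->
  (forall s, \forall n \near \oo,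
    (n.+1%:R * (a - k) <= s) && (s <= n.+1%:R * (b - k)) = (s \in S)) ->
  kernel_window n.+1%:R a b k @[n --> \oo] --> Rintegral mu1 setT (fun s => \1_S s * K (- s)).
Proof.
move=> mS hS.
apply: (@Rintegral_dominated_cvg _ (measurableTypeR R) R mu1
  (fun n s => \1_`[n.+1%:R * (a - k), n.+1%:R * (b - k)] s * K (- s)) _ (fun s => K (- s))).
- move=> n; apply: measurable_funM; last exact: measurable_KN.
  by apply: measurable_indic; exact: measurable_itv.
- by apply: measurable_funM; [exact: measurable_indic|exact: measurable_KN].
- move=> s; apply: cvgM; last exact: cvg_cst.
  apply/cvgrPdist_le => e e0; apply: filterS (hS s) => n hn.
  rewrite !indicE -hn (_ : (s \in _) = (n.+1%:R * (a - k) <= s <= n.+1%:R * (b - k))).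
    by rewrite subrr normr0 ltW.
  by apply/idP/idP => [/set_mem|h]; [|apply: mem_set]; rewrite /= in_itv.
- exact: integrable_kernel.
- move=> n s; rewrite ger0_norm; last by rewrite mulr_ge0 ?power_spectrum_ge0// indicE.
  by rewrite ler_piMl ?power_spectrum_ge0// indicE; case: (_ \in _).
Qed.

Definition half_mass_pos : R := Rintegral mu1 setT (fun s => \1_`[0, +oo[ s * K (- s)).
Definition half_mass_neg : R := Rintegral mu1 setT (fun s => \1_`]-oo, 0] s * K (- s)).

Lemma kernel_mass_gt0 : 0 < kernel_mass R.
Proof.
pose I : set (measurableTypeR R) := `[-1, 1]%classic.
have mI : measurable I by exact: measurable_itv.
have lI : mu1 I = (2 : R)%:E.
  rewrite /I lebesgue_measure_itv /= lte_fin (_ : -1 < 1 :> R); last by lra.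
  by rewrite -EFinB opprK.
have fI : (mu1 I < +oo)%E by rewrite lI ltry.
have M0 : 0 < tent_mass R ^+ 2 / 4 by rewrite divr_gt0// exprn_gt0// tent_mass_gt0.
apply: (@lt_le_trans _ _ (tent_mass R ^+ 2 / 4 * 2)); first by rewrite mulr_gt0.
have -> : tent_mass R ^+ 2 / 4 * 2 = Rintegral mu1 setT (fun s => tent_mass R ^+ 2 / 4 * \1_I s).
  rewrite RintegralZl//; last exact: integrable_indic_lty.
  by rewrite /Rintegral integral_indic// setIT /= lI.
apply: le_Rintegral => //.
- by apply: integrable_scale => //; exact: integrable_indic_lty.
- exact: integrable_kernel.
- move=> s _; rewrite indicE; case: (boolP (s \in _)) => [/set_mem|_]; last first.
    by rewrite mulr0 power_spectrum_ge0.
  rewrite /I /= in_itv /= => /andP[s1 s2]; rewrite mulr1.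
  by apply: power_spectrum_tentC_ge; rewrite ler_norml; apply/andP; split; lra.
Qed.

(** The two half-lines cover the line, so the sum is at least [kernel_mass]. Positivity of the sum
    is what allows point masses to be divided out, whatever the two summands are. *)
Lemma half_mass_gt0 : 0 < half_mass_pos + half_mass_neg.
Proof.
apply: lt_le_trans kernel_mass_gt0 _.
have i1 := integrable_kernel_indic (A := `[0, +oo[%classic) (measurable_itv _).
have i2 := integrable_kernel_indic (A := `]-oo, 0]%classic) (measurable_itv _).
rewrite /half_mass_pos /half_mass_neg -RintegralD//; apply: le_Rintegral => //.
- exact: integrable_kernel.
- exact: integrable_add.
- move=> s _; rewrite -mulrDl ler_peMl ?power_spectrum_ge0// !indicE.
  have [s0|s0] := leP 0 s.
    by rewrite mem_set /= ?in_itv/= ?s0// lerDl.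
  by rewrite (mem_set (u := s) (A := `]-oo, 0]%classic)) /= ?in_itv/= ?(ltW s0)// lerDr.
Qed.

(* The convolution of an interval with the approximate identity N K(N .); the
   half masses at the end points need not be equal, they are removed separately. *)
Definition window_limit (a b k : R) : R :=
  kernel_mass R * \1_`]a, b[ k + half_mass_pos * \1_[set a] k + half_mass_neg * \1_[set b] k.

Lemma kernel_window_cvg (a b k : R) : a < b ->
  kernel_window n.+1%:R a b k @[n --> \oo] --> window_limit a b k.
Proof.
move=> ab.
have ev (s : R) : \forall n \near \oo,
    (n.+1%:R * (a - k) <= s) && (s <= n.+1%:R * (b - k)) =
    ((a < k) || ((a == k) && (0 <= s))) && ((k < b) || ((k == b) && (s <= 0))).
  have h2 := near_le_linear (k - b) (- s).
  apply: filterS2 (near_le_linear (a - k) s) h2 => n -> h.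
  rewrite subr_lt0 subr_eq0; congr (_ && _).
  by rewrite -[s <= _]lerN2 -mulrN opprB h subr_lt0 subr_eq0 oppr_ge0.
pose S : set R := [set s | ((a < k) || ((a == k) && (0 <= s))) && ((k < b) || ((k == b) && (s <= 0)))].
have c (S' : set R) : measurable (S' : set (measurableTypeR R)) ->
    (forall s, (((a < k) || ((a == k) && (0 <= s))) && ((k < b) || ((k == b) && (s <= 0)))) = (s \in S')) ->
    kernel_window n.+1%:R a b k @[n --> \oo] --> Rintegral mu1 setT (fun s => \1_S' s * K (- s)).
  by move=> mS' hS; apply: kernel_window_cvg_set => // s; have := ev s; under eq_near do rewrite hS.
have c0 : ((k < a) || (b < k)) -> kernel_window n.+1%:R a b k @[n --> \oo] --> (0 : R).
  move=> h; have := c set0 measurable0.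
  rewrite (_ : Rintegral _ _ _ = 0); last first.
    by under eq_Rintegral do rewrite indic0 mul0r; rewrite Rintegral_cst// mul0r.
  apply=> s; rewrite in_set0; case/orP: h => h.
    by rewrite ltNge (ltW h) gt_eqF.
  by rewrite andbC ltNge (ltW h) gt_eqF.
rewrite /window_limit !indicE.
have -> : (k \in `]a, b[%classic) = (a < k < b) by apply/idP/idP => [/set_mem|h]; [|apply: mem_set]; rewrite /= in_itv.
have m1 (z : R) : (k \in [set z]) = (k == z).
  by apply/idP/eqP => [/set_mem|->] //; apply: mem_set.
rewrite !m1.
have [ka|ka|ka] := ltgtP k a.
- rewrite (lt_eqF (lt_trans ka ab)) /= !mulr0 !addr0; apply: c0; by rewrite ka.
- have [kb|kb|kb] := ltgtP k b.
  + rewrite /= !mulr0 !addr0 mulr1.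
    have -> : kernel_mass R = Rintegral mu1 setT (fun s => \1_[set: R] s * K (- s)).
      by apply: eq_Rintegral => s _; rewrite indicE in_setT mul1r.
    by apply: c => // s; rewrite ka kb in_setT.
  + rewrite /= !mulr0 !addr0; apply: c0; by rewrite kb orbT.
  + rewrite /= !mulr0 !add0r mulr1; apply: c; first exact: measurable_itv.
    move=> s; rewrite ka -kb eqxx ltxx /=.
    by apply/idP/idP => [h|/set_mem]; [apply: mem_set|]; rewrite /= in_itv.
- have -> : (k == b) = false by rewrite ka lt_eqF.
  rewrite /= !mulr0 mulr1 add0r addr0; apply: c; first exact: measurable_itv.
  move=> s; rewrite ka eqxx ltxx ab /= andbT.
  by apply/idP/idP => [h|/set_mem]; [apply: mem_set|]; rewrite /= in_itv /= andbT.
Qed.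

End WindowLimit.

(** * From power spectra to bounded Borel sets *)

Section UniquenessTheorem.
Variable R : realType.
Notation mu1 := (@lebesgue_measure R).
Notation K := (power_spectrum (@tentC R)).
Variables (I : finType) (mu : I -> {measure set (measurableTypeR R) -> \bar R}).
Variables (u : I -> R -> R) (U : R).
Hypothesis mu_tb : forall a, translation_bounded_measure (mu a).
Hypothesis mu_u : forall a, measurable_fun [set: measurableTypeR R] (u a).
Hypothesis u_le : forall a k, `|u a k| <= U.
Hypothesis pairing0 : forall f, Cc f -> pairing mu u (power_spectrum f) = 0.
Local Notation annihilated := (annihilated mu u).

Lemma measurable_kernel_shift (N t : R) :
  measurable_fun [set: measurableTypeR R] (fun k : R => K (N * (k - t))).
Proof.
apply: (@continuous_measurable_fun R).
apply: (continuous_compR (u := fun k => N * (k - t)));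
  last exact: continuous_power_spectrum_tentC.
apply: continuousRM => x; first exact: cvg_cst.
by apply: cvgB; [exact: cvg_id|exact: cvg_cst].
Qed.

Lemma kernel_shift_dominated (N t : R) : 1 <= N ->
  dominated_by (tent_decay R * (2 * (1 + t ^+ 2))) (fun k => K (N * (k - t))).
Proof.
move=> N1; split; first exact: measurable_kernel_shift.
move=> k; rewrite ger0_norm ?power_spectrum_ge0//.
apply: le_trans (power_spectrum_tentC_le _) _.
by rewrite -mulrA ler_pM2l ?tent_decay_gt0//; exact: cauchy_weight_affine_le.
Qed.

(** Up to the factor N^2, the shifted kernel is itself the power spectrum of a modulated and dilated
    tent, so the hypothesis applies to it. *)
Lemma kernel_shift_annihilated (N t : R) : 1 <= N -> pairing mu u (fun k => K (N * (k - t))) = 0.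
Proof.
move=> N1; have N0 : 0 < N by lra.
have Ni : 0 < N^-1 by rewrite invr_gt0.
pose f : R -> R[i] := fun x => cexp (- t * x) * tentC (N^-1 * x + 0).
have cf : Cc f by apply: Cc_modulate; apply: Cc_affine => //; exact: Cc_tentC.
have e k : power_spectrum f k = N ^+ 2 * K (N * (k - t)).
  rewrite !power_spectrumE /f (invfourier_modulate (fun x => tentC (N^-1 * x + 0))).
  rewrite invfourier_affine//; last exact: Cc_tentC.
  rewrite mulr0 mul0r oppr0 [cexp 0](_ : _ = 1) ?mulr1; last by rewrite /cexp mulr0 cos0 sin0.
  rewrite invrK [(k - t) * N]mulrC; move: (invfourier _ _) => z.
  by rewrite !ReImE /= !mul0r subr0 addr0; ring.
have [mK hK] := kernel_shift_dominated t N1.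
have af : annihilated (power_spectrum f).
  split; last exact: pairing0.
  exists (N ^+ 2 * (tent_decay R * (2 * (1 + t ^+ 2)))).
  rewrite (funext e); split; first exact: measurable_funM.
  by move=> k; rewrite normrM (ger0_norm (sqr_ge0 N)) -[leRHS]mulrA ler_wpM2l ?sqr_ge0.
have [_] := annihilatedZ mu_tb mu_u u_le (N ^- 2) af.
rewrite (_ : (fun k => N ^- 2 * power_spectrum f k) = fun k => K (N * (k - t)))//.
by apply/funext => k; rewrite e mulKf// expf_eq0 gt_eqF.
Qed.

Lemma kernel_windowE (N a b k : R) : 0 < N ->
  Rintegral mu1 setT (fun t => \1_`[a, b] t * K (N * (k - t))) = N^-1 * kernel_window N a b k.
Proof.
move=> N0; rewrite /kernel_window.
rewrite -(Rintegral_affine (- (N * k)) N0); last exact: integrable_kernel_indic.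
apply: eq_Rintegral => t _; congr (_ * K _); last by ring.
rewrite !indicE; congr (_%:R); congr nat_of_bool.
have e : (t \in `[a, b]%classic) = (a <= t <= b).
  by apply/idP/idP => [/set_mem|h]; [|apply: mem_set]; rewrite /= in_itv.
rewrite e; apply/idP/idP => [/andP[h1 h2]|/set_mem].
  apply: mem_set; rewrite /= in_itv /= !mulrBr !lerD2r !ler_pM2l//.
  by rewrite h1.
by rewrite /= in_itv /= !mulrBr !lerD2r !ler_pM2l.
Qed.

Lemma measurable_kernel_joint (N a b : R) :
  measurable_fun [set: measurableTypeR R * measurableTypeR R]
    (fun x => \1_`[a, b] x.2 * K (N * (x.1 - x.2))).
Proof.
apply: measurable_funM.
  by apply: measurableT_comp; [apply: measurable_indic; exact: measurable_itv|exact: measurable_snd].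
have ml : measurable_fun [set: measurableTypeR R * measurableTypeR R]
    ((fun x => N * (x.1 - x.2)) : _ -> measurableTypeR R).
  apply: measurable_funM => //.
  by apply: measurable_funB; [exact: measurable_fst|exact: measurable_snd].
exact: (measurableT_comp (@measurable_K R) ml).
Qed.

Lemma integrable_kernel_shift_indic (N a b k : R) :
  mu1.-integrable setT (EFin \o (fun t => \1_`[a, b] t * K (N * (k - t)))).
Proof.
apply: le_integrable (integrable_scale measurableT (tent_decay R)
   (@integrable_indic_lty _ _ _ mu1 `[a, b]%classic (measurable_itv _) _)) => //.
- apply/measurable_EFinP/measurable_funM.
    by apply: measurable_indic; exact: measurable_itv.
  apply: (@continuous_measurable_fun R).
  apply: (continuous_compR (u := fun t => N * (k - t)));
    last exact: continuous_power_spectrum_tentC.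
  apply: continuousRM => x; first exact: cvg_cst.
  by apply: cvgB; [exact: cvg_cst|exact: cvg_id].
- move=> t _; have i0 : (0 : R) <= \1_`[a, b] t by rewrite indicE.
  have K0 := power_spectrum_ge0 (@tentC R) (N * (k - t)).
  have D0 := ltW (tent_decay_gt0 R).
  rewrite lee_fin /= (ger0_norm (mulr_ge0 i0 K0)) (ger0_norm (mulr_ge0 D0 i0)).
  rewrite mulrC ler_wpM2r//; apply: le_trans (power_spectrum_tentC_le _) _.
  by rewrite ler_piMr ?cauchy_weight_le1.
- exact: (tb_bounded_lty (@lebesgue_translation_bounded R) (a := a) (b := b)).
Qed.

Lemma measurable_kernel_window (N a b : R) : 0 < N ->
  measurable_fun [set: measurableTypeR R] (kernel_window N a b).
Proof.
move=> N0.
have -> : kernel_window N a b = fun k => N * fine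
    (\int[mu1]_t ((fun x : measurableTypeR R * measurableTypeR R =>
      (\1_`[a, b] x.2 * K (N * (x.1 - x.2)))%:E) (k, t)))%E.
  apply/funext => k; rewrite -[LHS](mulVKf (lt0r_neq0 N0)) -kernel_windowE//.
apply: measurable_funM => //; apply: measurableT_comp; first exact: fine_measurable.
apply: (measurable_fun_fubini_tonelli_F (fun x : measurableTypeR R * measurableTypeR R =>
      (\1_`[a, b] x.2 * K (N * (x.1 - x.2)))%:E)) => [|x].
  by apply/measurable_EFinP; exact: measurable_kernel_joint.
by rewrite lee_fin mulr_ge0 ?power_spectrum_ge0// indicE.
Qed.

Lemma kernel_window_dominated (N a b : R) : 1 <= N -> a < b ->
  dominated_by (window_const a b) (kernel_window N a b).
Proof.
move=> N1 ab; split; last by move=> k; exact: kernel_window_bound.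
by apply: measurable_kernel_window; lra.
Qed.

Lemma Rintegral_sum d (T : measurableType d) (m : {measure set T -> \bar R}) (J : Type)
    (s : seq J) (F : J -> T -> R) : (forall i, m.-integrable setT (EFin \o F i)) ->
  Rintegral m setT (fun x => \sum_(i <- s) F i x) = \sum_(i <- s) Rintegral m setT (F i).
Proof.
move=> iF.
have iS (r : seq J) : m.-integrable setT (EFin \o (fun x => \sum_(i <- r) F i x)).
  elim: r => [|i r IH]; first by under eq_fun do rewrite big_nil; exact: integrable0.
  by under eq_fun do rewrite big_cons; exact: integrable_add.
elim: s => [|i s IH].
  by rewrite big_nil; under eq_Rintegral do rewrite big_nil; rewrite Rintegral_cst// mul0r.
by rewrite big_cons -IH; under eq_Rintegral do rewrite big_cons; rewrite RintegralD.
Qed.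

(** By Fubini this is an integral over t in [a, b] of pairings with K (N (. - t)), each of which
    vanishes. *)
Lemma kernel_window_annihilated (N a b : R) : 1 <= N -> a < b ->
  pairing mu u (kernel_window N a b) = 0.
Proof.
move=> N1 ab; have N0 : 0 < N by lra.
have U0 (c : I) : 0 <= U by apply: le_trans (u_le c 0).
pose F c k t := u c k * (\1_`[a, b] t * K (N * (k - t))).
have hF c : mu1.-integrable setT (EFin \o (fun t => Rintegral (mu c) setT (F c ^~ t))) /\
  Rintegral (mu c) setT (fun k => Rintegral mu1 setT (F c k)) =
  Rintegral mu1 setT (fun t => Rintegral (mu c) setT (F c ^~ t)).
  apply: (@Rintegral_Fubini _ _ (mu_tb c) (F c) (fun k => U * (window_const a b * cauchy_weight k))).
  - apply: measurable_funM; last exact: measurable_kernel_joint.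
    by apply: (measurableT_comp (mu_u c)); exact: measurable_fst.
  - by move=> k; apply: integrable_scale => //; exact: integrable_kernel_shift_indic.
  - move=> t; rewrite (_ : F c ^~ t = fun k => \1_`[a, b] t * (u c k * K (N * (k - t)))); last first.
      by apply/funext => k; rewrite /F mulrCA.
    apply: integrable_scale => //.
    exact: (integrable_pairing mu_tb mu_u u_le c (kernel_shift_dominated t N1)).
  - under eq_fun do rewrite mulrA.
    exact: integrable_weight.
  - move=> k; under eq_Rintegral do rewrite normrM.
    rewrite RintegralZl//; last exact/integrable_norm/integrable_kernel_shift_indic.
    apply: ler_pM => //; first by apply: Rintegral_ge0.
    rewrite (_ : Rintegral _ _ _ = N^-1 * kernel_window N a b k); last first.
      rewrite -kernel_windowE//; apply: eq_Rintegral => t _; rewrite ger0_norm//.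
      by rewrite mulr_ge0 ?power_spectrum_ge0// indicE.
    apply: le_trans (le_trans (ler_norm _) (kernel_window_bound k N1 ab)).
    by rewrite ler_piMl ?kernel_window_ge0// invf_le1.
have [mW hW] := kernel_window_dominated N1 ab.
have e c : Rintegral (mu c) setT (fun k => u c k * kernel_window N a b k) =
    N * Rintegral mu1 setT (fun t => Rintegral (mu c) setT (F c ^~ t)).
  rewrite -(hF c).2 (_ : (fun k => Rintegral mu1 setT (F c k)) =
      fun k => N^-1 * (u c k * kernel_window N a b k)).
    rewrite RintegralZl//; first by rewrite mulVKf// gt_eqF.
    exact: (integrable_pairing mu_tb mu_u u_le c (kernel_window_dominated N1 ab)).
  apply/funext => k; rewrite /F RintegralZl//; last exact: integrable_kernel_shift_indic.
  by rewrite kernel_windowE// mulrCA.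
rewrite /pairing; under eq_bigr do rewrite e.
rewrite -mulr_sumr -Rintegral_sum; last by move=> c; exact: (hF c).1.
rewrite (_ : (fun t => _) = fun=> 0); first by rewrite Rintegral_cst// mul0r mulr0.
apply/funext => t.
transitivity (\1_`[a, b] t * pairing mu u (fun k => K (N * (k - t)))); last first.
  by rewrite kernel_shift_annihilated// mulr0.
rewrite /pairing mulr_sumr; apply: eq_bigr => c _.
rewrite -RintegralZl//; first by apply: eq_Rintegral => k _; rewrite /F mulrCA.
exact: (integrable_pairing mu_tb mu_u u_le c (kernel_shift_dominated t N1)).
Qed.

Lemma window_limit_annihilated a b : a < b -> annihilated (window_limit a b).
Proof.
move=> ab.
have n1 (n : nat) : 1 <= n.+1%:R :> R by rewrite ler1n.
apply: (annihilated_cvg mu_tb mu_u u_le (C := window_const a b)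
  (g_ := fun n => kernel_window n.+1%:R a b)).
- move=> n; split; first by exists (window_const a b); exact: kernel_window_dominated.
  exact: kernel_window_annihilated.
- by move=> n; exact: kernel_window_dominated.
- have mc (c : R) (A : set (measurableTypeR R)) : measurable A ->
      measurable_fun [set: measurableTypeR R] (fun k => c * \1_A k).
    by move=> mA; apply: measurable_funM => //; exact: measurable_indic.
  apply: measurable_funD; last by apply: mc; exact: measurable_set1.
  by apply: measurable_funD; apply: mc; [exact: measurable_itv|exact: measurable_set1].
- by move=> k; exact: kernel_window_cvg.
Qed.

Lemma dominated_indic (A : set (measurableTypeR R)) (r : R) : measurable A ->
  A `<=` `[- r, r] -> dominated_by (1 + r ^+ 2) (\1_A).
Proof.
move=> mA Ar; split; first exact: measurable_indic.
move=> k; rewrite indicE; case: (boolP (k \in A)) => [/set_mem/Ar|_]; last first.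
  by rewrite normr0 mulr_ge0 ?addr_ge0 ?sqr_ge0// ltW// cauchy_weight_gt0.
rewrite /= in_itv /= -ler_norml normr1 => kr.
rewrite ler_pdivlMr ?ltr_pwDl ?sqr_ge0// mul1r lerD2l -[leLHS]real_normK ?num_real//.
by rewrite ler_pXn2r// nnegrE ?normr_ge0//; apply: le_trans kr.
Qed.

(** Shared by the approximations of a point from the right and from the left: all windows stay
    inside one interval around x, which provides the common majorant. *)
Lemma annihilated_set1_aux (x : R) (g_ : nat -> R -> R) (c : R) :
  (forall n, annihilated (g_ n)) ->
  (forall n k, `|g_ n k| <= (kernel_mass R + half_mass_pos R + half_mass_neg R) *
     \1_`[x - 1, x + 1] k) ->
  (forall k, g_ n k @[n --> \oo] --> c * \1_[set x] k) ->
  annihilated (fun k => c * \1_[set x] k).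
Proof.
move=> ag hg cg.
set D := _ + _ + _ in hg.
have D0 : 0 <= D.
  rewrite !addr_ge0 ?kernel_mass_ge0//; apply: Rintegral_ge0 => s _;
  by rewrite mulr_ge0 ?power_spectrum_ge0// indicE.
pose r := `|x| + 1.
have [|_ hI] := @dominated_indic `[x - 1, x + 1]%classic r (measurable_itv _).
  move=> k /=; rewrite !in_itv /= /r => /andP[k1 k2].
  by have := ler_norm x; have := ler_norm (- x); rewrite normrN => h1 h2; apply/andP; split; lra.
apply: (annihilated_cvg mu_tb mu_u u_le (C := D * (1 + r ^+ 2)) (g_ := g_)) => //.
- move=> n; split; first by case: (ag n) => -[C []].
  move=> k; apply: le_trans (hg n k) _; rewrite -mulrA ler_wpM2l//.
  by have := hI k; rewrite ger0_norm// indicE.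
- by apply: measurable_funM => //; apply: measurable_indic; exact: measurable_set1.
Qed.

Lemma near_invn_lt (e : R) : 0 < e -> \forall n \near \oo, n.+1%:R^-1 < e.
Proof. by move=> e0; near=> n; near: n; exact: near_infty_natSinv_lt (PosNum e0). Unshelve. all: end_near. Qed.

Lemma indic1E (A : set R) (k : R) : A k -> \1_A k = 1 :> R.
Proof. by move=> Ak; rewrite indicE mem_set. Qed.

Lemma indic0E (A : set R) (k : R) : ~ A k -> \1_A k = 0 :> R.
Proof. by move=> Ak; rewrite indicE memNset. Qed.

Lemma window_limit_le (a b x k : R) : x - 1 <= a -> b <= x + 1 -> a < b ->
  `|window_limit a b k| <= (kernel_mass R + half_mass_pos R + half_mass_neg R) *
     \1_`[x - 1, x + 1] k.
Proof.
move=> xa bx ab.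
have T0 := kernel_mass_ge0 R.
have hp0 : 0 <= half_mass_pos R.
  by apply: Rintegral_ge0 => s _; rewrite mulr_ge0 ?power_spectrum_ge0// indicE.
have hm0 : 0 <= half_mass_neg R.
  by apply: Rintegral_ge0 => s _; rewrite mulr_ge0 ?power_spectrum_ge0// indicE.
have i0 (A : set R) : 0 <= \1_A k :> R by rewrite indicE.
have i1 (A : set R) : \1_A k <= 1 :> R by rewrite indicE; case: (_ \in _).
rewrite /window_limit ger0_norm ?addr_ge0 ?mulr_ge0//.
have [kI|kI] := pselect (`[x - 1, x + 1]%classic k).
  rewrite (indic1E kI) mulr1; apply: lerD; [apply: lerD|]; by rewrite ler_piMr.
rewrite !indic0E ?mulr0 ?addr0// => h; apply: kI; rewrite /= in_itv /=.
- by move: h; rewrite /= in_itv /= => /andP[h1 h2]; apply/andP; split; lra.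
- by move: h => ->; apply/andP; split; lra.
- by move: h => ->; apply/andP; split; lra.
Qed.

(** Windows shrinking to their left end x leave [half_mass_pos] at x, those shrinking to their right
    end leave [half_mass_neg]. Adding the two limits avoids having to know that either constant is
    nonzero. *)
Lemma annihilated_set1 (x : R) : annihilated (\1_[set x]).
Proof.
have n0 (n : nat) : 0 < n.+1%:R^-1 :> R by rewrite invr_gt0.
have n1 (n : nat) : n.+1%:R^-1 <= 1 :> R by rewrite invf_le1// ler1n.
have hp : annihilated (fun k => half_mass_pos R * \1_[set x] k).
  apply: (annihilated_set1_aux (g_ := fun n => window_limit x (x + n.+1%:R^-1))).
  - by move=> n; apply: window_limit_annihilated; rewrite ltrDl.
  - move=> n k; apply: window_limit_le; rewrite ?ltrDl ?lerD2l//; lra.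
  - move=> k; apply/cvgrPdist_le => e e0; rewrite /window_limit.
    (* A given k eventually lies outside the open window and off its moving end point, so only the
       weight at the fixed end x can persist. *)
    have h : \forall n \near \oo, ~ (`]x, (x + n.+1%:R^-1)[%classic k) /\
        ~ ([set (x + n.+1%:R^-1)] k).
      have [kx|kx] := leP k x.
        apply: nearW => n; split; rewrite /= ?in_itv/=; first by move=> /andP[]; lra.
        by move: (n0 n); move: (n.+1%:R^-1) => v v0 kv; move: kx; rewrite kv; lra.
      have kx0 : 0 < k - x by lra.
      apply: filterS (near_invn_lt kx0) => n hn.
      move: hn; move: (n.+1%:R^-1) => v hn.
      by split; rewrite /= ?in_itv/=; [move=> /andP[]; lra|move=> kv; move: hn; rewrite kv; lra].
    apply: filterS h => n [h1 h2].
    by rewrite (indic0E h1) (indic0E h2) !mulr0 add0r addr0 subrr normr0 ltW.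
have hm : annihilated (fun k => half_mass_neg R * \1_[set x] k).
  apply: (annihilated_set1_aux (g_ := fun n => window_limit (x - n.+1%:R^-1) x)).
  - by move=> n; apply: window_limit_annihilated; rewrite ltrBlDr ltrDl.
  - move=> n k; by apply: window_limit_le; move: (n0 n) (n1 n); move: (n.+1%:R^-1) => v; lra.
  - move=> k; apply/cvgrPdist_le => e e0; rewrite /window_limit.
    have h : \forall n \near \oo, ~ (`](x - n.+1%:R^-1), x[%classic k) /\
        ~ ([set (x - n.+1%:R^-1)] k).
      have [kx|kx] := leP x k.
        apply: nearW => n; split; rewrite /= ?in_itv/=; first by move=> /andP[]; lra.
        by move: (n0 n); move: (n.+1%:R^-1) => v v0 kv; move: kx; rewrite kv; lra.
      have kx0 : 0 < x - k by lra.
      apply: filterS (near_invn_lt kx0) => n hn.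
      move: hn; move: (n.+1%:R^-1) => v hn.
      by split; rewrite /= ?in_itv/=; [move=> /andP[]; lra|move=> kv; move: hn; rewrite kv; lra].
    apply: filterS h => n [h1 h2].
    by rewrite (indic0E h1) (indic0E h2) !mulr0 !add0r subrr normr0 ltW.
have := annihilatedZ mu_tb mu_u u_le (half_mass_pos R + half_mass_neg R)^-1
  (annihilatedD mu_tb mu_u u_le hp hm).
rewrite (_ : (fun k => _) = \1_[set x])//; apply/funext => k.
by rewrite -mulrDl mulKf// gt_eqF// half_mass_gt0.
Qed.

Lemma annihilated_ocitv (a b : R) : annihilated (\1_`]a, b]).
Proof.
have [ab|ba] := ltP a b; last first.
  rewrite set_itv_ge ?bnd_simp -?leNgt// indic0; split.
    exists 0; split; first exact: measurable_cst.
    by move=> k; rewrite normr0 mul0r.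
  by rewrite /pairing big1// => c _; under eq_Rintegral do rewrite mulr0; rewrite Rintegral_cst// mul0r.
have T0 := kernel_mass_gt0 R.
(* End-point corrections: afterwards the weight is 0 at a and the full [kernel_mass] at b, as for
   the half-open interval. *)
have h1 := annihilatedZ mu_tb mu_u u_le (- half_mass_pos R) (annihilated_set1 a).
have h2 := annihilatedZ mu_tb mu_u u_le (kernel_mass R - half_mass_neg R) (annihilated_set1 b).
have h3 := annihilatedD mu_tb mu_u u_le (window_limit_annihilated ab)
  (annihilatedD mu_tb mu_u u_le h1 h2).
have := annihilatedZ mu_tb mu_u u_le (kernel_mass R)^-1 h3.
rewrite (_ : (fun k => _) = \1_`]a, b])//; apply/funext => k.
rewrite (_ : \1_`]a, b] k = \1_`]a, b[ k + \1_[set b] k); last first.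
  have [->|kb] := eqVneq k b.
    rewrite (indic1E (A := [set b]))// indic1E; last by rewrite /= in_itv /= ab lexx.
    by rewrite indic0E ?add0r//= in_itv /= ltxx andbF.
  rewrite (indic0E (A := [set b])) ?addr0; last by apply/eqP.
  rewrite !indicE; congr (_%:R); congr nat_of_bool.
  by apply/idP/idP => /set_mem; rewrite /= in_itv /= => /andP[ak kb'];
    apply: mem_set; rewrite /= in_itv /= ak/= ?(ltW kb')// lt_neqAle kb.
rewrite /window_limit; apply: (mulfI (lt0r_neq0 T0)); rewrite mulVKf ?gt_eqF//; ring.
Qed.

(** A Dynkin argument over half-open intervals. The class is taken relative to one bounded interval
    [J] containing [A], so that complements and countable unions keep the same majorant. *)
Theorem annihilated_bounded_borel (A : set R) : bounded_borel A -> annihilated (\1_A).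
Proof.
move=> [mA [a [b Aab]]].
pose r := `|a| + `|b| + 1.
pose J : set (measurableTypeR R) := `](- r), r]%classic.
have mJ : measurable J by exact: measurable_itv.
have AJ : A `<=` J.
  move=> x /Aab; rewrite /J /= !in_itv /= /r => /andP[h1 h2].
  have := ler_norm b; have := ler_norm (- a); rewrite normrN.
  have := normr_ge0 a; have := normr_ge0 b => *; apply/andP; split; lra.
have JJ : J `<=` `[- r, r] by apply: subset_itvr => //; rewrite bnd_simp.
suff h : forall S, <<s @ocitv R >> S -> annihilated (\1_(S `&` J)).
  by rewrite -(setIidl AJ); apply: h.
have dI (S : set (measurableTypeR R)) : measurable S -> dominated_by (1 + r ^+ 2) (\1_(S `&` J)).
  by move=> mS; apply: dominated_indic; [exact: measurableI|move=> x [_ /JJ]].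
apply: (@dynkin_induction _ (measurableTypeR R)) => //.
- exact: ocitvI.
- by rewrite setTI; exact: annihilated_ocitv.
- move=> _ [[c d] _ <-] /=.
  have -> : `]c, d]%classic `&` J = `](Num.max c (- r)), (Num.min d r)]%classic.
    apply/seteqP; split => x; rewrite /J /= !in_itv /= gt_max le_min.
      by move=> [/andP[-> ->] /andP[-> ->]].
    by move=> /andP[/andP[-> ->] /andP[-> ->]].
  exact: annihilated_ocitv.
- move=> S mS hS.
  have := annihilatedB mu_tb mu_u u_le (annihilated_ocitv (- r) r) hS.
  rewrite (_ : (fun k => _) = \1_(~` S `&` J))//; apply/funext => k.
  rewrite -/J !indicE !in_setI in_setC.
  by case: (k \in S); case: (k \in J); rewrite /= ?subrr ?subr0.
- move=> F mF tF hF.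
  pose g n : R -> R := fun k => \sum_(i < n) \1_(F i `&` J) k.
  have gE n k : g n k = \1_((\bigcup_(i in `I_n) F i) `&` J) k.
    elim: n => [|n IH].
      by rewrite /g big_ord0 II0 bigcup_set0 set0I indic0.
    rewrite /g big_ord_recr /= -/(g n k) IH IIS bigcup_setU bigcup_set1 setIUl.
    rewrite !indicE in_setU.
    have [k1|k1] := boolP (k \in (\bigcup_(i in `I_n) F i) `&` J); last by rewrite /= add0r.
    have [k2|k2] := boolP (k \in F n `&` J); last by rewrite addr0.
    move: k1 k2 => /set_mem[[i /= iltn Fi] _] /set_mem[Fn _].
    have /trivIsetP/(_ i n Logic.I Logic.I) := tF; rewrite (ltn_eqF iltn) => /(_ isT) e.
    by have : (F i `&` F n) k by []; rewrite e.
  apply: (annihilated_cvg mu_tb mu_u u_le (C := 1 + r ^+ 2) (g_ := g)).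
  + elim=> [|n IH].
      rewrite /g; under eq_fun do rewrite big_ord0.
      by have := annihilatedZ mu_tb mu_u u_le 0 (hF 0%N); under eq_fun do rewrite mul0r.
    rewrite /g; under eq_fun do rewrite big_ord_recr /=.
    exact: annihilatedD.
  + move=> n; rewrite (funext (gE n)); apply: dI.
    by apply: bigcup_measurable => i _.
  + apply: measurable_indic; apply: measurableI => //; exact: bigcup_measurable.
  + move=> k; apply/cvgrPdist_le => e e0.
    have [[[i _ Fi] Jk]|nk] := pselect ((\bigcup_i F i `&` J) k).
      exists i.+1 => // n /= hn; rewrite gE !indic1E ?subrr ?normr0 ?ltW//.
        by split => //; exists i.
      by split => //; exists i.
    apply: nearW => n; rewrite gE !indic0E ?subrr ?normr0 ?ltW//.
    by move=> [[i _ Fi] Jk]; apply: nk; split => //; exists i.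
Qed.

End UniquenessTheorem.

(** * Supertiles and the renormalization of pair correlations *)

Section Supertiles.
Variables (R : realType) (L : nat) (rho : 'I_L -> seq 'I_L) (lam : R) (ell : 'rV[R]_L).
Hypothesis lam_gt1 : 1 < lam.
Hypothesis ell_natural : natural_lengths rho lam ell.

Let lam_gt0 : 0 < lam. Proof. exact: lt_trans lam_gt1. Qed.
Let ell_gt0 i : 0 < ell 0 i. Proof. by case: ell_natural. Qed.

Definition inflated_tiles (j : 'I_L) : seq ('I_L * R) :=
  [seq (i, t) | i <- enum 'I_L, t <- rel_pos rho ell i j].

(** Tiles with their offsets in the q-fold inflated prototile placed at 0. Each level inflates the
    tiles of the previous one, just as [iter] unfolds [inflate]. *)
Fixpoint supertile (q : nat) (j : 'I_L) : seq ('I_L * R) :=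
  if q is q'.+1 then
    [seq (z.1, lam * p.2 + z.2) | p <- supertile q' j, z <- inflated_tiles p.1]
  else [:: (j, 0)].

Let offset (j : 'I_L) (p : nat) : R := \sum_(a <- take p (rho j)) ell 0 a.

Lemma mem_inflated_tiles j z : z \in inflated_tiles j ->
  exists2 p, onth (rho j) p = Some z.1 & z.2 = offset j p.
Proof.
move=> /allpairsPdep[i [t [_ + ->]]] /=.
by move=> /mapP[p]; rewrite mem_filter => /andP[/eqP hp _] ->; exists p.
Qed.

Lemma offsetS j p a : onth (rho j) p = Some a -> offset j p.+1 = offset j p + ell 0 a.
Proof.
move=> h; have hp : (p < size (rho j))%N by rewrite -onthTE h.
by rewrite /offset (take_nth a hp) -(odflt_onth a) h big_rcons /= addrC.
Qed.

Lemma offset_le j p p' : (p <= p')%N -> offset j p <= offset j p'.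
Proof.
move=> pp; rewrite /offset -(cat_take_drop p (take p' (rho j))) take_takel//.
by rewrite big_cat /= lerDl; apply: sumr_ge0 => i _; exact: ltW.
Qed.

Lemma sum_lengths j : \sum_(a <- rho j) ell 0 a = lam * ell 0 j.
Proof.
case: ell_natural => _ /rowP/(_ j); rewrite !mxE => <-.
under [RHS]eq_bigr do rewrite mxE.
elim: (rho j) => [|a s IH]; first by rewrite big_nil big1// => i _; rewrite mulr0.
rewrite big_cons IH /=; under [RHS]eq_bigr do rewrite natrD mulrDr.
rewrite big_split /=; congr (_ + _).
rewrite (bigD1 a)//= eqxx mulr1 big1 ?addr0// => i ia.
by rewrite eq_sym (negbTE ia) mulr0.
Qed.

Lemma inflated_tiles_bounds j z : z \in inflated_tiles j ->
  0 <= z.2 /\ z.2 + ell 0 z.1 <= lam * ell 0 j.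
Proof.
move=> /mem_inflated_tiles[p hp ->]; split.
  by rewrite /offset; apply: sumr_ge0 => i _; exact: ltW.
rewrite -(offsetS hp) -sum_lengths.
have -> : \sum_(a <- rho j) ell 0 a = offset j (size (rho j)) by rewrite /offset take_size.
by apply: offset_le; rewrite -onthTE hp.
Qed.

(** The tiles are laid end to end in the order of the word: a tile of larger index starts only where
    one of smaller index has ended, so a common point forces equal indices. *)
Lemma inflated_tiles_overlap j z z' x : z \in inflated_tiles j -> z' \in inflated_tiles j ->
  z.2 <= x < z.2 + ell 0 z.1 -> z'.2 <= x < z'.2 + ell 0 z'.1 -> z = z'.
Proof.
move=> /mem_inflated_tiles[p hp e] /mem_inflated_tiles[p' hp' e'] /andP[h1 h2] /andP[h3 h4].
have key u v (w w' : 'I_L * R) : onth (rho j) u = Some w.1 -> w.2 = offset j u ->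
    w'.2 = offset j v -> x < w.2 + ell 0 w.1 -> w'.2 <= x -> (v <= u)%N.
  move=> hu ew ew' xw xw'; rewrite leqNgt; apply/negP => uv.
  have := offset_le j uv; rewrite (offsetS hu) -ew -ew'; lra.
have pp : p = p' by apply/eqP; rewrite eqn_leq (key _ _ _ _ hp' e' e h4 h1) (key _ _ _ _ hp e e' h2 h3).
move: hp' e'; rewrite -pp hp => -[ee] e'.
by rewrite [z]surjective_pairing [z']surjective_pairing ee e e'.
Qed.

Lemma uniq_inflated_tiles j : uniq (inflated_tiles j).
Proof.
apply: allpairs_uniq_dep => [|i _|]; first exact: enum_uniq.
  rewrite map_inj_in_uniq ?filter_uniq ?iota_uniq// => p p'.
  rewrite !mem_filter => /andP[/eqP hp _] /andP[/eqP hp' _] e.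
  have key u v : onth (rho j) u = Some i -> offset j u = offset j v -> (v <= u)%N.
    move=> hu euv; rewrite leqNgt; apply/negP => uv.
    have := offset_le j uv; rewrite (offsetS hu) euv; have := ell_gt0 i; lra.
  by apply/eqP; rewrite eqn_leq (key _ _ hp' (esym e)) (key _ _ hp e).
by move=> [a b] [a' b'] _ _ /= [-> ->].
Qed.

Lemma supertile_bounds q j z : z \in supertile q j ->
  0 <= z.2 /\ z.2 + ell 0 z.1 <= lam ^+ q * ell 0 j.
Proof.
elim: q z => [|q IH] z /=; first by rewrite inE => /eqP -> /=; rewrite expr0 add0r mul1r.
move=> /allpairsPdep[p [y [/IH[p1 p2] /inflated_tiles_bounds[y1 y2] ->]]] /=.
split; first by rewrite addr_ge0// mulr_ge0// ltW.
rewrite exprS -mulrA -addrA; apply: (@le_trans _ _ (lam * p.2 + lam * ell 0 p.1)).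
  by rewrite lerD2l.
by rewrite -mulrDr ler_pM2l.
Qed.

(** The point x / lam lies in both parent tiles, which agree by induction; inside one inflated tile
    [inflated_tiles_overlap] decides. *)
Lemma supertile_overlap q j z z' x : z \in supertile q j -> z' \in supertile q j ->
  z.2 <= x < z.2 + ell 0 z.1 -> z'.2 <= x < z'.2 + ell 0 z'.1 -> z = z'.
Proof.
elim: q z z' x => [|q IH] z z' x /=; first by rewrite !inE => /eqP -> /eqP ->.
move=> /allpairsPdep[p [y [ps yi ->]]] /allpairsPdep[p' [y' [ps' yi' ->]]] /= /andP[h1 h2] /andP[h3 h4].
have [y1 y2] := inflated_tiles_bounds yi; have [y1' y2'] := inflated_tiles_bounds yi'.
have pp : p = p'.
  apply: (IH _ _ (x / lam)) => //.
    by rewrite ler_pdivlMr// ltr_pdivrMr// mulrDl ![_ * lam]mulrC; apply/andP; split; lra.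
  by rewrite ler_pdivlMr// ltr_pdivrMr// mulrDl ![_ * lam]mulrC; apply/andP; split; lra.
subst p'.
have -> // : y = y'.
by apply: (inflated_tiles_overlap (x := x - lam * p.2) yi yi'); apply/andP; split; lra.
Qed.

Lemma uniq_supertile q j : uniq (supertile q j).
Proof.
elim: q => [//|q IH] /=.
apply: allpairs_uniq_dep => // [p _|]; first exact: uniq_inflated_tiles.
move=> u u' /allpairsPdep[p [y [ps yi ->]]] /allpairsPdep[p' [y' [ps' yi' ->]]] /= [e1 e2].
have [y1 y2] := inflated_tiles_bounds yi; have [y1' y2'] := inflated_tiles_bounds yi'.
have e0 := ell_gt0 y.1; have e0' := ell_gt0 y'.1.
have pp : p = p'.
  apply: (supertile_overlap (x := (lam * p.2 + y.2) / lam) ps ps').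
    by rewrite ler_pdivlMr// ltr_pdivrMr// mulrDl ![_ * lam]mulrC; apply/andP; split; lra.
  by rewrite e2 ler_pdivlMr// ltr_pdivrMr// mulrDl ![_ * lam]mulrC; apply/andP; split; lra.
subst p'; congr Tagged.
have e3 : y.2 = y'.2 by exact: addrI e2.
by rewrite [y]surjective_pairing [y']surjective_pairing e1 e3.
Qed.

Lemma iter_inflateP q (T : tile_set R L) i x :
  iter q (inflate rho lam ell) T (i, x) <->
  exists2 p, T p & exists2 t, (i, t) \in supertile q p.1 & x = lam ^+ q * p.2 + t.
Proof.
have memP j (t : R) (i' : 'I_L) : (t \in rel_pos rho ell i' j) = ((i', t) \in inflated_tiles j).
  apply/idP/allpairsPdep => [ht|[i2 [t2 [_ ht [-> ->]]]]//].
  by exists i', t; split => //; rewrite mem_enum.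
elim: q i x => [|q IH] i x /=.
  split=> [Tx|[[j y] Tp [t]]]; last by rewrite inE /= => /eqP[-> ->] ->; rewrite expr0 mul1r addr0.
  by exists (i, x) => //; exists 0; rewrite ?inE// expr0 mul1r addr0.
split.
  move=> [[j y] /IH[p Tp [s hs ->]] [t /= ht ->]].
  exists p => //; exists (lam * s + t); last by rewrite exprS; ring.
  apply/allpairsPdep; exists (j, s), (i, t); split => //.
  by rewrite -memP.
move=> [p Tp [u /allpairsPdep[[j s] [[i' t] [hs hz [-> ->]]]] ->]].
exists (j, lam ^+ q * p.2 + s); first by apply/IH; exists p => //; exists s.
by exists t; [rewrite memP|rewrite exprS /=; ring].
Qed.

(** Divided by lam^q, the common left endpoint lies in both p and p', and in a tiling only one tile
    contains a given point. This makes the sorting of tile pairs by supertiles free of double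
    counting. *)
Lemma supertile_decomposition_unique q (T : tile_set R L) p p' z z' :
  is_tiling ell T -> T p -> T p' -> z \in supertile q p.1 -> z' \in supertile q p'.1 ->
  lam ^+ q * p.2 + z.2 = lam ^+ q * p'.2 + z'.2 -> p = p' /\ z.2 = z'.2.
Proof.
move=> Tt Tp Tp' hz hz' e.
have [z1 z2] := supertile_bounds hz; have [z1' z2'] := supertile_bounds hz'.
have e0 := ell_gt0 z.1; have e0' := ell_gt0 z'.1.
have lq : 0 < lam ^+ q by rewrite exprn_gt0.
have pp : p = p'.
  have [p0 [_ p0u]] := Tt ((lam ^+ q * p.2 + z.2) / lam ^+ q).
  transitivity p0; [apply/esym|]; apply: p0u; split => //.
    by rewrite ler_pdivlMr// ltr_pdivrMr// mulrDl ![_ * lam ^+ q]mulrC; apply/andP; split; lra.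
  by rewrite e ler_pdivlMr// ltr_pdivrMr// mulrDl ![_ * lam ^+ q]mulrC; apply/andP; split; lra.
by split => //; move: e; rewrite pp; exact: addrI.
Qed.

(** The cocycle is the Fourier matrix of the q-fold inflation. The induction splits off the leftmost
    factor B(k): the innermost offsets have frequency k, those of the parents are scaled by lam and
    have frequency lam k. *)
Lemma fourier_cocycleE q k i j : fourier_cocycle rho lam ell q k i j =
  \sum_(z <- supertile q j | z.1 == i) cexp (k * z.2).
Proof.
have B i' j' k' : fourier_mx rho ell k' i' j' = \sum_(z <- inflated_tiles j' | z.1 == i') cexp (k' * z.2).
  rewrite mxE [RHS]big_mkcond /= /inflated_tiles big_allpairs_dep big_enum /= (bigD1 i')//=.
  rewrite [X in _ = _ + X]big1 ?addr0; last first.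
    by move=> a ai; rewrite big1// => b _; rewrite (negbTE ai).
  by apply: eq_bigr => t _; rewrite eqxx.
elim: q k i j => [|q IH] k i j.
  rewrite /fourier_cocycle big_geq// mxE /= big_cons big_nil /= eq_sym.
  by case: eqP => _; rewrite /= ?addr0// mulr0 /cexp mulr0 cos0 sin0.
have -> : fourier_cocycle rho lam ell q.+1 k =
    fourier_mx rho ell k *m fourier_cocycle rho lam ell q (lam * k).
  rewrite /fourier_cocycle big_nat_recl//= expr0 mul1r; congr (_ *m _).
  by apply: eq_bigr => m _; congr fourier_mx; rewrite exprSr mulrA.
rewrite mxE; under eq_bigr do rewrite IH mulr_sumr.
rewrite [RHS]big_mkcond /= big_allpairs_dep /=.
transitivity (\sum_(p <- supertile q j) fourier_mx rho ell k i p.1 * cexp (lam * k * p.2)).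
  rewrite (exchange_big_dep xpredT)//=; apply: eq_bigr => p _.
  by rewrite (big_pred1 p.1) => // m; rewrite eq_sym.
apply: eq_bigr => p _; rewrite B mulr_suml -big_mkcond /=.
apply: eq_bigr => y _; rewrite -cexpD; congr cexp; ring.
Qed.

End Supertiles.

(** * Finite local complexity *)

Section Tilings.
Variables (R : realType) (L : nat) (ell : 'rV[R]_L).
Hypothesis ell_gt0 : forall i, 0 < ell 0 i.
Variable T : tile_set R L.
Hypothesis T_tiling : is_tiling ell T.

Lemma tile_unique p p' y : T p -> T p' -> p.2 <= y < p.2 + ell 0 p.1 ->
  p'.2 <= y < p'.2 + ell 0 p'.1 -> p = p'.
Proof.
move=> Tp Tp' h h'; have [p0 [_ u]] := T_tiling y.
by rewrite -(u p) // -(u p').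
Qed.

Lemma next_tile p : T p -> exists a, T (a, p.2 + ell 0 p.1).
Proof.
move=> Tp; have [[a x] [[Ta /= /andP[h1 h2]] _]] := T_tiling (p.2 + ell 0 p.1).
have e0 := ell_gt0 p.1.
suff -> : p.2 + ell 0 p.1 = x by exists a.
apply/eqP; rewrite eq_le h1 andbT leNgt; apply/negP => hx.
pose y := Num.max x p.2.
have e0' := ell_gt0 a.
have e : (a, x) = p.
  apply: (tile_unique (y := y) Ta Tp) => /=.
    by rewrite le_max lexx gt_max /=; apply/andP; split; lra.
  by rewrite le_max lexx orbT gt_max /=; apply/andP; split; lra.
by move: h2; rewrite -e /= ltxx.
Qed.

(** Sums of fewer than n tile lengths: a finite list of candidates for the distance between tiles
    that are fewer than n steps apart. *)
Fixpoint reachable (n : nat) : set R :=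
  if n is n'.+1 then [set 0] `|` \bigcup_(a in [set: 'I_L]) ((fun s => ell 0 a + s) @` reachable n')
  else set0.

Lemma finite_reachable n : finite_set (reachable n).
Proof.
elim: n => [|n IH] /=; first exact: finite_set0.
rewrite finite_setU; split; first exact: finite_set1.
by apply: bigcup_finite => // a _; exact: finite_image.
Qed.

Lemma min_length : exists2 e : R, 0 < e & forall i, e <= ell 0 i.
Proof.
(* A lower bound for all lengths without taking a minimum; the summand 1 keeps it positive for an
   empty alphabet. *)
exists (1 + \sum_i (ell 0 i)^-1)^-1.
  by rewrite invr_gt0 ltr_pwDl// sumr_ge0// => i _; rewrite invr_ge0 ltW.
move=> i; rewrite -[leRHS]invrK lef_pV2 ?posrE ?invr_gt0//; last first.
  by rewrite ltr_pwDl// sumr_ge0// => j _; rewrite invr_ge0 ltW.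
rewrite (bigD1 i)//= addrCA lerDl addr_ge0// sumr_ge0// => j _.
by rewrite invr_ge0 ltW.
Qed.

(** Walking from tile to tile towards the target uses up at least e of the distance at each step, so
    n steps suffice. *)
Lemma reachableP e : 0 < e -> (forall i, e <= ell 0 i) -> forall n p j z, T p -> T (j, p.2 + z) ->
  0 <= z -> z < n%:R * e -> reachable n z.
Proof.
move=> e0 he; elim=> [|n IH] p j z Tp Tz z0 zn; first by move: zn; rewrite mul0r; lra.
have [->|z1] := eqVneq z 0; [by left|right].
have lz : ell 0 p.1 <= z.
  rewrite leNgt; apply/negP => zl.
  have /(congr1 snd) /= h : p = (j, p.2 + z).
    apply: (tile_unique (y := p.2 + z) Tp Tz) => /=.
      by apply/andP; split; lra.
    by have := ell_gt0 j => ej; apply/andP; split; lra.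
  by move/eqP: z1; apply; lra.
have [a Ta] := next_tile Tp.
exists p.1 => //; exists (z - ell 0 p.1); last by ring.
apply: (IH _ j _ Ta) => /=; last 2 first.
- by lra.
- by move: zn; rewrite -natr1 mulrDl mul1r; have := he p.1; lra.
by rewrite -addrA (addrC (ell 0 p.1)) subrK.
Qed.

(** Nonnegative differences are reachable within a number of steps bounded by B / e; negative ones
    become nonnegative when the two tiles exchange roles. *)
Lemma finite_diff_set i j (B : R) : finite_set (diff_set T i j `&` `[- B, B]).
Proof.
have [e e0 he] := min_length.
pose n := (Num.truncn (B / e)).+1.
have Bn : B < n%:R * e by rewrite -ltr_pdivrMr//; exact: truncnS_gt.
apply: (@sub_finite_set _ _ (reachable n `|` (-%R @` reachable n))); last first.
  by rewrite finite_setU; split; [|apply: finite_image]; exact: finite_reachable.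
move=> z [[x Ti Tj] zB].
have /andP[z1 z2] : - B <= z <= B by move: zB; rewrite /= in_itv.
have [z0|z0] := leP 0 z.
  by left; apply: (reachableP (p := (i, x)) e0 he Ti Tj) => //; lra.
right; exists (- z); last by rewrite opprK.
apply: (reachableP (p := (j, x + z)) (j := i) e0 he Tj) => /=; rewrite ?addrK//; try lra.
Qed.

Lemma finite_points i (B : R) : finite_set (points T i `&` `[- B, B]).
Proof.
have [[x0 [Tx0 hx0]]|h] := pselect (exists x, points T i x /\ `[- B, B]%classic x); last first.
  rewrite (_ : _ `&` _ = set0); first exact: finite_set0.
  by rewrite -subset0 => x [Tx hx]; apply: h; exists x.
apply: (@sub_finite_set _ _ ((fun z => x0 + z) @` (diff_set T i i `&` `[- (2 * B), 2 * B]))).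
  move=> x [Tx hx]; exists (x - x0); last by ring.
  split; first by exists x0 => //; rewrite addrC subrK.
  by move: hx hx0; rewrite /= !in_itv /= => /andP[h1 h2] /andP[h3 h4]; apply/andP; split; lra.
by apply: finite_image; exact: finite_diff_set.
Qed.

End Tilings.

(** * Densities under disjoint unions and affine maps *)

Section Densities.
Variable R : realType.
Implicit Types (X Y : set R).

(** Without this property [fset_set] may fall back to the empty finite set, and the count in
    [has_dens] loses its meaning. *)
Definition locally_finite X := forall B : R, finite_set (X `&` `[- B, B]).

Lemma has_dens_unique X a b : has_dens X a -> has_dens X b -> a = b.
Proof. by move=> h1 h2; apply: cvg_unique h1 h2. Qed.

Lemma has_dens0 : has_dens (set0 : set R) 0.
Proof.
rewrite /has_dens; under eq_fun do rewrite set0I fset_set0 cardfs0 mul0r.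
exact: cvg_cst.
Qed.

Lemma locally_finiteU X Y : locally_finite X -> locally_finite Y -> locally_finite (X `|` Y).
Proof. by move=> h1 h2 B; rewrite setIUl finite_setU. Qed.

Lemma has_densU X Y a b : locally_finite X -> locally_finite Y -> X `&` Y = set0 ->
  has_dens X a -> has_dens Y b -> has_dens (X `|` Y) (a + b).
Proof.
move=> fX fY XY hX hY; rewrite /has_dens.
rewrite (_ : (fun r : R => _) = fun r => #|` fset_set (X `&` `[- r, r])|%:R / (2 * r) +
   #|` fset_set (Y `&` `[- r, r])|%:R / (2 * r)); first exact: cvgD.
apply/funext => r; rewrite -mulrDl -natrD; congr (_%:R / _).
rewrite setIUl fset_setU// cardfsU.
rewrite (_ : (_ `&` _)%fset = fset0) ?cardfs0 ?subn0//.
apply/fsetP => x; rewrite inE in_fset0 !in_fset_set//.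
apply/negbTE/negP => /andP[/set_mem[Xx _] /set_mem[Yx _]].
by have : (X `&` Y) x by []; rewrite XY.
Qed.

Lemma has_dens_bigcup (I : eqType) (s : seq I) (X : I -> set R) (a : I -> R) : uniq s ->
  (forall e, locally_finite (X e)) -> (forall e, e \in s -> has_dens (X e) (a e)) ->
  (forall e e', e \in s -> e' \in s -> (X e `&` X e') !=set0 -> e = e') ->
  locally_finite (\bigcup_(e in [set` s]) X e) /\
  has_dens (\bigcup_(e in [set` s]) X e) (\sum_(e <- s) a e).
Proof.
move=> + fX; elim: s => [_ _ _|e s IH /= /andP[es us] ha hd].
  rewrite big_nil (_ : \bigcup_(e in _) X e = set0); last first.
    by rewrite -subset0 => x [e]; rewrite /= in_nil.
  by split; [move=> B; rewrite set0I; exact: finite_set0|exact: has_dens0].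
have [||IH1 IH2] := IH us.
- by move=> e' e's; apply: ha; rewrite inE e's orbT.
- by move=> e1 e2 h1 h2; apply: hd; rewrite inE ?h1 ?h2 orbT.
rewrite big_cons (_ : \bigcup_(_ in _) _ = X e `|` \bigcup_(e in [set` s]) X e); last first.
  apply/seteqP; split => x.
    move=> [e']; rewrite /= inE => /orP[/eqP ->|e's] Xx; first by left.
    by right; exists e'.
  by move=> [Xx|[e' /= e's Xx]]; [exists e|exists e'] => //=; rewrite inE ?eqxx// e's orbT.
split; first exact: locally_finiteU.
apply: has_densU => //; last by apply: ha; rewrite inE eqxx.
rewrite -subset0 => x [Xe [e' /= e's Xe']].
have ee : e = e' by apply: hd; rewrite ?inE ?eqxx ?e's ?orbT//; exists x.
by move: es; rewrite ee e's.
Qed.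

(** The preimage of [- r, r] lies between two symmetric intervals whose half-lengths differ from r /
    c by |t| / c only; the counts are squeezed and the shift disappears in the limit. *)
Lemma has_dens_affine X (a c t : R) : 0 < c -> locally_finite X -> has_dens X a ->
  locally_finite ((fun y => c * y + t) @` X) /\ has_dens ((fun y => c * y + t) @` X) (c^-1 * a).
Proof.
move=> c0 fX hX; set f := fun y => _; set Y := f @` X.
have fK : injective f by move=> x y /addIr/(mulfI (lt0r_neq0 c0)).
have fY : locally_finite Y.
  move=> B; apply: (@sub_finite_set _ _ (f @` (X `&` `[- ((B + `|t|) / c), (B + `|t|) / c]))).
    move=> _ [[x Xx <-]]; rewrite /f /= in_itv /= => /andP[h1 h2]; exists x => //; split => //.
    rewrite /= in_itv /= -mulNr ler_pdivrMr// ler_pdivlMr//.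
    by have := ler_norm t; have := ler_norm (- t); rewrite normrN => *; apply/andP; split; lra.
  exact: finite_image.
split => //.
pose lo (r : R) := (r - `|t|) / c; pose hi (r : R) := (r + `|t|) / c.
have cardf (r : R) : #|` fset_set (f @` (X `&` `[- r, r]))| = #|` fset_set (X `&` `[- r, r])|.
  by rewrite fset_set_image// card_imfset.
have le1 r : (#|` fset_set (X `&` `[- lo r, lo r])| <= #|` fset_set (Y `&` `[- r, r])|)%N.
  rewrite -cardf; apply: fsubset_leq_card; rewrite -fset_set_sub//; last exact: finite_image.
  move=> _ [x [Xx + <-]]; rewrite /= !in_itv /= /lo -mulNr ler_pdivrMr// ler_pdivlMr// => /andP[h1 h2].
  split; first by exists x.
  rewrite /f.
  by have := ler_norm t; have := ler_norm (- t); rewrite normrN => *; apply/andP; split; lra.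
have le2 r : (#|` fset_set (Y `&` `[- r, r])| <= #|` fset_set (X `&` `[- hi r, hi r])|)%N.
  rewrite -[leqRHS]cardf; apply: fsubset_leq_card; rewrite -fset_set_sub//; last exact: finite_image.
  move=> _ [[x Xx <-]]; rewrite /f /= in_itv /= => /andP[h1 h2]; exists x => //; split => //.
  rewrite /= in_itv /= /hi -mulNr ler_pdivrMr// ler_pdivlMr//.
  by have := ler_norm t; have := ler_norm (- t); rewrite normrN => *; apply/andP; split; lra.
have lim_of (g : R -> R) (s : R) : (forall r, g r = (r + s) / c) ->
    (fun r : R => #|` fset_set (X `&` `[- g r, g r])|%:R / (2 * r)) @ +oo --> c^-1 * a.
  move=> gE.
  have gy : g r @[r --> +oo] --> +oo.
    apply/cvgryPge => A; near=> r; rewrite gE ler_pdivlMr//.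
    have : A * c - s <= r by near: r; apply: nbhs_pinfty_ge; rewrite num_real.
    lra.
  have h1 := cvg_comp _ _ gy hX.
  have h2 : g r / r @[r --> +oo] --> c^-1.
    have : c^-1 + s / c * r^-1 @[r --> +oo] --> c^-1 + s / c * 0.
      apply: cvgD; first exact: cvg_cst.
      apply: cvgM; first exact: cvg_cst.
      have np : \forall r \near +oo, 0 < (@id R r) by exact: nbhs_pinfty_gt.
      have h0 : (@id R r) @[r --> +oo] --> +oo by exact: cvg_id.
      exact ((gtr0_cvgV0 np).2 h0).
    rewrite mulr0 addr0; apply: cvg_trans; apply: near_eq_cvg; near=> r.
    have r0 : 0 < r by near: r; exact: nbhs_pinfty_gt.
    by rewrite gE; field; rewrite !gt_eqF.
  have h3 : (fun r : R => #|` fset_set (X `&` `[- g r, g r])|%:R / (2 * g r) * (g r / r))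
      @ +oo --> a * c^-1 by apply: cvgM; [exact: h1|exact: h2].
  rewrite [c^-1 * a]mulrC; apply: cvg_trans h3; apply: near_eq_cvg; near=> r.
  have r0 : 0 < r by near: r; exact: nbhs_pinfty_gt.
  have g0 : 0 < g r.
    rewrite gE divr_gt0//.
    have : - s < r by near: r; apply: nbhs_pinfty_gt; rewrite num_real.
    lra.
  by rewrite /=; field; rewrite !gt_eqF.
apply: (@squeeze_cvgr _ _ _ _ (fun r : R => #|` fset_set (X `&` `[- lo r, lo r])|%:R / (2 * r))
   (fun r : R => #|` fset_set (X `&` `[- hi r, hi r])|%:R / (2 * r))).
- near=> r; have r0 : 0 < r by near: r; exact: nbhs_pinfty_gt.
  by rewrite !ler_pM2r ?invr_gt0 ?mulr_gt0// !ler_nat le1 le2.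
- exact: lim_of.
- exact: lim_of.
Unshelve. all: end_near. Qed.

End Densities.

(** * Pair correlations on the coarser scale *)

Section PairCorrelations.
Variables (R : realType) (L : nat) (rho : 'I_L -> seq 'I_L) (lam : R) (ell : 'rV[R]_L).
Hypothesis lam_gt1 : 1 < lam.
Hypothesis ell_natural : natural_lengths rho lam ell.
Variables (T0 T : tile_set R L) (d : R) (nu : 'I_L -> 'I_L -> R -> R).
Hypothesis T0_tiling : is_tiling ell T0.
Hypothesis T_hull : hull ell T0 T.
Hypothesis nu_corr : pair_correlation ell T0 d nu.

Let ell_gt0 i : 0 < ell 0 i. Proof. by case: ell_natural. Qed.
Let lamX_gt0 q : 0 < lam ^+ q. Proof. by rewrite exprn_gt0// (lt_trans _ lam_gt1). Qed.

Lemma hull_refl : hull ell T0 T0.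
Proof.
split => // e e0; exists 0, 0; split; first by rewrite normr0 ltW.
by move=> p _ _; rewrite /translate /= subr0.
Qed.

(** The coefficient can be computed in T itself, so a pair that never occurs in T has coefficient 0.
    Hence sums over [diff_set T] may be extended to larger index sets. *)
Lemma nu_neq0 i j z : nu i j z != 0 -> diff_set T i j z.
Proof.
have [a ha ->] := nu_corr T_hull i j z.
apply: contra_neqP => h; rewrite (_ : a = 0) ?mul0r//.
apply: (has_dens_unique ha).
rewrite (_ : [set x | _] = set0); first exact: has_dens0.
by rewrite -subset0 => x [h1 h2]; apply: h; exists x.
Qed.

(* The pieces of type i of all q-fold supertiles: (m, r) stands for the tile of
   type i at offset r inside the supertile of type m. *)
Definition pieces (q : nat) (i : 'I_L) : seq ('I_L * R) :=
  [seq (m, w.2) | m <- enum 'I_L, w <- [seq w <- supertile rho lam ell q m | w.1 == i]].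

Lemma mem_pieces q i e : (e \in pieces q i) = ((i, e.2) \in supertile rho lam ell q e.1).
Proof.
apply/allpairsPdep/idP => [[m [w [_ + ->]]]|h] /=.
  by rewrite mem_filter => /andP[/eqP <- hw]; rewrite -surjective_pairing.
exists e.1, (i, e.2); split; first by rewrite mem_enum.
  by rewrite mem_filter eqxx.
by rewrite /= -surjective_pairing.
Qed.

Lemma uniq_pieces q i : uniq (pieces q i).
Proof.
apply: allpairs_uniq_dep => [|m _|]; first exact: enum_uniq.
  by rewrite filter_uniq//; exact: uniq_supertile.
move=> u u' /allpairsPdep[m [w [_ + ->]]] /allpairsPdep[m' [w' [_ + ->]]] /=.
rewrite !mem_filter => /andP[/eqP e1 _] /andP[/eqP e2 _] [mm ww].
by subst m'; congr Tagged; rewrite [w]surjective_pairing [w']surjective_pairing e1 e2 ww.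
Qed.

Lemma sum_pieces (V : nmodType) q i (F : 'I_L -> R -> V) :
  \sum_(e <- pieces q i) F e.1 e.2 =
  \sum_m \sum_(w <- supertile rho lam ell q m | w.1 == i) F m w.2.
Proof.
by rewrite big_allpairs_dep big_enum; apply: eq_bigr => m _; rewrite big_filter.
Qed.

Definition piece_pairs (q : nat) (i j : 'I_L) : seq (('I_L * R) * ('I_L * R)) :=
  [seq (e1, e2) | e1 <- pieces q i, e2 <- pieces q j].

(** Each of the two tiles of a pair at distance z lies in one supertile. Sorting the pairs by
    supertile types m, n and inner offsets r, s splits them into disjoint affine images of the pairs
    of types m, n at the coarse distance (z + r - s) / lam^q. *)
Lemma nu_renormalization q i j z : iter q (inflate rho lam ell) T0 = T0 ->
  nu i j z = (lam ^+ q)^-1 * \sum_(e <- piece_pairs q i j)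
     nu e.1.1 e.2.1 ((z + e.1.2 - e.2.2) / lam ^+ q).
Proof.
move=> fixq; set c := lam ^+ q; have c0 : 0 < c by exact: lamX_gt0.
pose A i j z : set R := [set x | points T0 i x /\ points T0 j (x + z)].
have [a aP] : exists a : 'I_L -> 'I_L -> R -> R, forall i j z,
    has_dens (A i j z) (a i j z) /\ nu i j z = a i j z / d.
  have /choice[a aP] : forall k : 'I_L * 'I_L * R, exists b,
      has_dens (A k.1.1 k.1.2 k.2) b /\ nu k.1.1 k.1.2 k.2 = b / d.
    by move=> [[i' j'] z'] /=; have [b] := nu_corr hull_refl i' j' z'; exists b.
  by exists (fun i j z => a (i, j, z)) => i' j' z'; exact: (aP (i', j', z')).
have lfA i' j' z' : locally_finite (A i' j' z').
  move=> B; apply: sub_finite_set (finite_points ell_gt0 T0_tiling i' B).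
  by move=> x [[]].
pose w (e : ('I_L * R) * ('I_L * R)) := (z + e.1.2 - e.2.2) / c.
pose X (e : ('I_L * R) * ('I_L * R)) : set R :=
  (fun y => c * y + e.1.2) @` A e.1.1 e.2.1 (w e).
have hX e := has_dens_affine e.1.2 c0 (lfA e.1.1 e.2.1 (w e)) (aP e.1.1 e.2.1 (w e)).1.
have wE e y : c * (y + w e) + e.2.2 = c * y + e.1.2 + z.
  by rewrite /w; field; rewrite gt_eqF.
have mP e : e \in piece_pairs q i j -> (i, e.1.2) \in supertile rho lam ell q e.1.1 /\
    (j, e.2.2) \in supertile rho lam ell q e.2.1.
  by move=> /allpairsP[[e1 e2] /= [h1 h2 ->]] /=; rewrite -!mem_pieces.
have [||_ hU] := @has_dens_bigcup R _ (piece_pairs q i j) X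
    (fun e => c^-1 * a e.1.1 e.2.1 (w e)) _ (fun e => (hX e).1) (fun e _ => (hX e).2).
- by apply: allpairs_uniq; rewrite ?uniq_pieces// => -[? ?] [? ?].
- move=> e e' /mP[h1 h2] /mP[h1' h2'] [x [[y [Ty Ty2] yx] [y' [Ty' Ty2'] yx']]].
  have [p1 o1] := supertile_decomposition_unique (T := T0) (p := (e.1.1, y)) (p' := (e'.1.1, y'))
    (z := (i, e.1.2)) (z' := (i, e'.1.2)) lam_gt1 ell_natural T0_tiling Ty Ty' h1 h1'
    (etrans yx (esym yx')).
  have [p2 o2] := supertile_decomposition_unique (T := T0) (p := (e.2.1, y + w e)) (p' := (e'.2.1, y' + w e'))
    (z := (j, e.2.2)) (z' := (j, e'.2.2)) lam_gt1 ell_natural T0_tiling Ty2 Ty2' h2 h2'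
    (etrans (etrans (wE e y) (congr1 (+%R^~ z) (etrans yx (esym yx')))) (esym (wE e' y'))).
  case: p1 p2 => p1 _ [p2 _]; move: o1 o2 p1 p2 => /=.
  by case: (e) => [[? ?] [? ?]]; case: (e') => [[? ?] [? ?]] /= -> -> -> ->.
have AE : A i j z = \bigcup_(e in [set` piece_pairs q i j]) X e.
  apply/seteqP; split => x.
    rewrite /A /points /= => -[]; rewrite -{1 2}fixq.
    move=> /iter_inflateP[[m y] Ty [r hr ex]].
    move=> /iter_inflateP[[n y'] Ty' [s hs ex']].
    exists ((m, r), (n, s)).
      by apply/allpairsP; exists ((m, r), (n, s)); split; rewrite ?mem_pieces.
    exists y; last by rewrite /= ex.
    split => //=; rewrite /points /= (_ : y + w _ = y')//.
    apply: (mulfI (lt0r_neq0 c0)); apply: (@addIr _ s).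
    by rewrite (wE ((m, r), (n, s)) y) /= -ex.
  move=> [e /mP[h1 h2] [y [Ty Ty2] <-]]; split; rewrite /points /= -fixq.
    by apply/iter_inflateP; exists (e.1.1, y) => //; exists e.1.2.
  apply/iter_inflateP; exists (e.2.1, y + w e) => //.
  by exists e.2.2 => //=; rewrite -wE.
rewrite -AE in hU; have [h1 ->] := aP i j z.
rewrite (has_dens_unique h1 hU) -mulr_sumr -mulrA; congr (_ * _).
by rewrite mulr_suml; apply: eq_bigr => e _; rewrite (aP _ _ _).2.
Qed.

Definition bounded_support (g : R -> R[i]) := exists B : R, forall z, B < `|z| -> g z = 0.

Let diff_finite i j B : finite_set (diff_set T i j `&` `[- B, B]).
Proof. by apply: (finite_diff_set ell_gt0); case: T_hull. Qed.

(** Any duplicate-free list that catches the support of g can replace the index set; surplus points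
    contribute nothing, by [nu_neq0]. *)
Lemma UpsilonE i j g (E : seq R) : uniq E ->
  (forall z, diff_set T i j z -> g z != 0 -> z \in E) ->
  Upsilon T nu i j g = \sum_(z <- E) (nu i j z)%:C * g z.
Proof.
move=> uE hE; rewrite /Upsilon /dirac_comb.
pose S := [set z | diff_set T i j z /\ g z != 0].
rewrite -(fsbig_widen S); last 2 first.
- by move=> z [].
- move=> z [Dz nSz] /=; case: (eqVneq (g z) 0) => [->|gz]; first by rewrite mulr0.
  by exfalso; apply: nSz.
apply: fsbig_fwiden => //; first by move=> z [Dz gz]; exact: hE.
move=> z [Ez nSz] /=; case: (eqVneq (g z) 0) => [->|gz]; first by rewrite mulr0.
case: (eqVneq (nu i j z) 0) => [->|nz]; first by rewrite mul0r.
by exfalso; apply: nSz; split => //; exact: nu_neq0.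
Qed.

Lemma bounded_support_cover i j (B : R) (g : R -> R[i]) : (forall z, B < `|z| -> g z = 0) ->
  forall z, diff_set T i j z -> g z != 0 -> (diff_set T i j `&` `[- B, B]) z.
Proof.
move=> hB z Dz gz; split => //; rewrite /= in_itv /= -ler_norml leNgt.
by apply: contra gz => /hB ->.
Qed.

Lemma Upsilon_sum i j (J : Type) (s : seq J) (c : J -> R[i]) (G : J -> R -> R[i]) (B : R) :
  (forall k z, B < `|z| -> G k z = 0) ->
  Upsilon T nu i j (fun z => \sum_(k <- s) c k * G k z) =
  \sum_(k <- s) c k * Upsilon T nu i j (G k).
Proof.
move=> hB; set E := fset_set (diff_set T i j `&` `[- B, B]).
have hE g : (forall z, B < `|z| -> g z = 0) ->
    Upsilon T nu i j g = \sum_(z <- E) (nu i j z)%:C * g z.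
  move=> hg; apply: UpsilonE => [|z Dz gz]; first exact: fset_uniq.
  rewrite in_fset_set//.
  by apply: mem_set; exact: bounded_support_cover gz.
rewrite hE; last by move=> z hz; rewrite big1// => k _; rewrite hB// mulr0.
under [RHS]eq_bigr do rewrite (hE _ (hB _)) mulr_sumr.
rewrite [RHS]exchange_big /=; apply: eq_bigr => z _.
by rewrite mulr_sumr; apply: eq_bigr => k _; rewrite mulrCA.
Qed.

Lemma Upsilon_renormalization q i j g : iter q (inflate rho lam ell) T0 = T0 ->
  bounded_support g ->
  Upsilon T nu i j g = ((lam ^+ q)^-1)%:C * \sum_(e <- piece_pairs q i j)
     Upsilon T nu e.1.1 e.2.1 (fun w => g (lam ^+ q * w + (e.2.2 - e.1.2))).
Proof.
move=> fixq [B hB]; set c := lam ^+ q; have c0 : 0 < c by exact: lamX_gt0.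
pose phi (e : ('I_L * R) * ('I_L * R)) w := c * w + (e.2.2 - e.1.2).
pose psi (e : ('I_L * R) * ('I_L * R)) z := (z + e.1.2 - e.2.2) / c.
have psiK e : cancel (phi e) (psi e) by move=> w; rewrite /phi /psi; field; rewrite gt_eqF.
have phiK e : cancel (psi e) (phi e) by move=> w; rewrite /phi /psi; field; rewrite gt_eqF.
pose B' (e : ('I_L * R) * ('I_L * R)) := (B + `|e.2.2 - e.1.2|) / c.
have hB' e w : B' e < `|w| -> g (phi e w) = 0.
  rewrite /B' ltr_pdivrMr// => h; apply: hB.
  have : `|c * w| <= `|phi e w| + `|e.2.2 - e.1.2|.
    by rewrite -{1}[c * w](addrK (e.2.2 - e.1.2)); exact: ler_normB.
  by rewrite normrM (gtr0_norm c0) mulrC; lra.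
pose S e := phi e @` (diff_set T e.1.1 e.2.1 `&` `[- B' e, B' e]).
(* One finite set holding the relevant distances of both scales: all sums then run over [E] or its
   bijective images under [psi e], and can be exchanged. *)
pose SS := (diff_set T i j `&` `[- B, B]) `|` \bigcup_(e in [set` piece_pairs q i j]) S e.
have fS : finite_set SS.
  rewrite finite_setU; split; first exact: diff_finite.
  by apply: bigcup_finite => [|e _]; [exact: finite_seq|exact/finite_image/diff_finite].
set E := fset_set SS.
rewrite (UpsilonE (E := E)); last 2 first.
- exact: fset_uniq.
- move=> z Dz gz; rewrite in_fset_set//; apply: mem_set; left.
  exact: bounded_support_cover gz.
under eq_bigr do rewrite (nu_renormalization _ _ _ fixq) rmorphM rmorph_sum -mulrA mulr_suml.
rewrite -mulr_sumr exchange_big /=; congr (_ * _).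
rewrite big_seq [RHS]big_seq; apply: eq_bigr => e he.
rewrite (UpsilonE (E := [seq psi e z | z <- E])); last 2 first.
- by rewrite map_inj_uniq ?fset_uniq//; exact: can_inj (phiK e).
- move=> w Dw gw; apply/mapP; exists (phi e w); last by rewrite psiK.
  rewrite in_fset_set//; apply: mem_set; right; exists e => //; exists w => //.
  exact: (bounded_support_cover (g := fun w => g (phi e w)) (hB' e)).
rewrite big_map; apply: eq_bigr => z _.
by rewrite -/(phi e (psi e z)) phiK.
Qed.

End PairCorrelations.

(** * Complex measures through their positive components *)

Section ComplexMeasureUniqueness.
Variable R : realType.
Local Notation measureR := {measure set (measurableTypeR R) -> \bar R}.
Implicit Types (m : measureR) (gam : cmeasure R) (f : R -> R[i]).

Lemma tb_growth m : translation_bounded_measure m ->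
  exists2 C : R, 0 <= C & forall a b : R, a <= b ->
    (m `[a, b]%classic <= (C * (b - a + 1))%:E)%E.
Proof.
move=> [C hC].
have C0 : 0 <= C by rewrite -lee_fin; apply: le_trans (hC 0); exact: measure_ge0.
exists C => // a b ab.
have le_mu (B D : set (measurableTypeR R)) : measurable B -> measurable D -> B `<=` D ->
    (m B <= m D)%E by move=> mB mD; apply: le_measure; exact: mem_set.
(* The extra term at n = 0 is there because a degenerate interval can still carry mass. *)
have h n : (m `[a, (a + n%:R)%R]%classic <= (C * n%:R + (n == 0%N)%:R * C)%:E)%E.
  elim: n => [|n IH].
    rewrite mulr0 add0r mul1r; apply: le_trans (hC a).
    by apply: le_mu; [exact: measurable_itv..|]; apply: subset_itvl; rewrite bnd_simp; lra.
  rewrite mul0r addr0; case: n IH => [|n] IH; first by rewrite mulr1; exact: hC.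
  apply: (@le_trans _ _ (m (`[a, (a + n.+1%:R)%R]%classic `|`
      `[(a + n.+1%:R)%R, (a + n.+1%:R + 1)%R]%classic))).
    apply: le_mu; [exact: measurable_itv|by apply: measurableU; exact: measurable_itv|].
    move=> x /=; rewrite !in_itv /= -(natr1 n.+1) => /andP[h1 h2].
    by have [h3|h3] := leP x (a + n.+1%:R); [left|right]; rewrite ?h1 ?h3//= ?(ltW h3)//; lra.
  apply: le_trans (measureU2 _ _ _) _; [exact: measurable_itv..|].
  rewrite -(natr1 n.+1) mulrDr mulr1 EFinD; apply: leeD; last exact: hC.
  by move: IH; rewrite mul0r addr0.
pose n := (Num.truncn (b - a)).
have /andP[n1 n2] : n%:R <= b - a < n.+1%:R by apply: truncn_itv; rewrite subr_ge0.
apply: (@le_trans _ _ (m `[a, (a + n.+1%:R)%R]%classic)).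
  by apply: le_mu; [exact: measurable_itv..|]; apply: subset_itvl; rewrite bnd_simp; lra.
apply: le_trans (h n.+1) _; rewrite mul0r addr0 lee_fin ler_wpM2l// -natr1; lra.
Qed.

Lemma tb_affine_image m (c : R) : 0 < c -> translation_bounded_measure m ->
  translation_bounded_measure (affine_image c 0 m).
Proof.
move=> c0 /tb_growth[C C0 hC]; exists (C * (c^-1 + 1)) => t; rewrite /affine_image /pushforward.
have -> : (fun x : R => c * x + 0) @^-1` `[t, t + 1] = `[(t / c), ((t + 1) / c)%R]%classic.
  by apply/seteqP; split => x /=; rewrite !in_itv /= addr0 ler_pdivrMr// ler_pdivlMr// mulrC.
apply: le_trans (hC _ _ _) _; first by rewrite ler_pM2r ?invr_gt0//; lra.
by rewrite lee_fin ler_wpM2l// -mulrBl addrAC subrr add0r mul1r.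
Qed.

(** The four positive parts under one index, to be recombined with the coefficients 1, -1, i, -i of
    [component_sign]; results on positive measures then apply index by index. *)
Definition component gam (l : 'I_4) : measureR :=
  nth (re_pos gam) [:: re_pos gam; re_neg gam; im_pos gam; im_neg gam] l.

Definition component_sign (l : 'I_4) : R[i] := nth 0 [:: 1; -1; 'i%C; - 'i%C] l.

Lemma sum_components (F : 'I_4 -> R) : \sum_l component_sign l * (F l)%:C =
  (F ord0 - F (lift ord0 ord0)) +i*
  (F (lift ord0 (lift ord0 ord0)) - F (lift ord0 (lift ord0 (lift ord0 ord0)))).
Proof.
rewrite !big_ord_recl big_ord0 /component_sign /=.
by apply: eqC; rewrite !ReImE /=; ring.
Qed.

Lemma cintegralE gam h :
  cintegral gam h = \sum_l component_sign l * (Rintegral (component gam l) setT h)%:C.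
Proof. by rewrite sum_components. Qed.

Lemma cmeasure_valE gam A :
  cmeasure_val gam A = \sum_l component_sign l * (fine (component gam l A))%:C.
Proof. by rewrite sum_components. Qed.

Lemma component_lty gam l (a b : R) : (component gam l `[a, b]%classic < +oo)%E.
Proof.
have [h1 h2 h3 h4] := cmeasure_loc_fin gam a b.
by case: l => -[|[|[|[|//]]]] ?.
Qed.

Lemma component_integrable gam l h : cintegrable gam h ->
  (component gam l).-integrable setT (EFin \o h).
Proof. by move=> [h1 h2 h3 h4]; case: l => -[|[|[|[|//]]]] ?. Qed.

Lemma transform_integrable Mu gam l f : is_fourier_transform Mu gam -> Cc f ->
  (component gam l).-integrable setT (EFin \o power_spectrum f).
Proof. by move=> h /h[hf _]; exact: component_integrable. Qed.

(** The absolute integrability in the definition of a transform holds for each component separately,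
    so the gliding hump applies although the complex combination is not positive. *)
Lemma transform_tb Mu gam l : is_fourier_transform Mu gam ->
  translation_bounded_measure (component gam l).
Proof.
move=> h; apply: translation_bounded; first exact: component_lty.
by move=> f; exact: transform_integrable h.
Qed.

Definition boundedC (g : R -> R[i]) := exists U, forall k,
  `|complex.Re (g k)| <= U /\ `|complex.Im (g k)| <= U.

Lemma boundedC_cst (z : R[i]) : boundedC (fun=> z).
Proof.
exists (`|complex.Re z| + `|complex.Im z|) => k.
by rewrite lerDl lerDr !normr_ge0.
Qed.

Lemma boundedC_cexp (t : R) : boundedC (fun k => cexp (k * t)).
Proof. by exists 1 => k; rewrite /= cos_max sin_max. Qed.

Lemma boundedCD g h : boundedC g -> boundedC h -> boundedC (fun k => g k + h k).
Proof.
move=> [U hU] [V hV]; exists (U + V) => k; rewrite !ReImE.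
have [a b] := hU k; have [a' b'] := hV k.
by split; apply: le_trans (ler_normD _ _) _; exact: lerD.
Qed.

Lemma boundedCM g h : boundedC g -> boundedC h -> boundedC (fun k => g k * h k).
Proof.
move=> [U hU] [V hV]; exists (U * V + U * V) => k; rewrite !ReImE.
have [a b] := hU k; have [a' b'] := hV k.
split.
  by apply: le_trans (ler_normB _ _) _; rewrite !normrM; apply: lerD; apply: ler_pM.
by apply: le_trans (ler_normD _ _) _; rewrite !normrM; apply: lerD; apply: ler_pM.
Qed.

Lemma boundedC_conj g : boundedC g -> boundedC (fun k => (g k)^*).
Proof. by move=> [U hU]; exists U => k; rewrite ReJ ImJ normrN. Qed.

Lemma boundedC_sum (J : Type) (s : seq J) (P : pred J) (F : J -> R -> R[i]) :
  (forall i, boundedC (F i)) -> boundedC (fun k => \sum_(i <- s | P i) F i k).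
Proof.
move=> hF; elim: s => [|i s IH].
  by under eq_fun do rewrite big_nil; exact: boundedC_cst.
under eq_fun do rewrite big_cons; case: (P i) => //; exact: boundedCD.
Qed.

Lemma continuousC_sum (J : Type) (s : seq J) (P : pred J) (F : J -> R -> R[i]) :
  (forall i, continuousC (F i)) -> continuousC (fun k => \sum_(i <- s | P i) F i k).
Proof.
move=> hF; elim: s => [|i s IH].
  by under eq_fun do rewrite big_nil; exact: continuousC_cst.
under eq_fun do rewrite big_cons; case: (P i) => //; exact: continuousCD.
Qed.

Section family.
Variables (I : finType) (mu : I -> measureR) (W : I -> R -> R[i]).
Hypothesis mu_tb : forall a, translation_bounded_measure (mu a).
Hypothesis cW : forall a, continuousC (W a).
Hypothesis bW : forall a, boundedC (W a).
Hypothesis W0 : forall f, Cc f ->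
  \sum_a mintegralC (mu a) (fun k => W a k * (power_spectrum f k)%:C) = 0.

(** Power spectra and indicators are real, so the complex relation is equivalent to two real ones,
    with the real and the imaginary parts of the weights. *)
Theorem weighted_uniqueness A : bounded_borel A ->
  \sum_a mintegralC (mu a) (fun k => W a k * (\1_A k)%:C) = 0.
Proof.
move=> bA.
have [U hU] : exists U, forall a k, `|complex.Re (W a k)| <= U /\ `|complex.Im (W a k)| <= U.
  have /choice[V hV] := bW.
  have V0 a : 0 <= V a by apply: le_trans (hV a 0).1.
  exists (\sum_a V a) => a k; have [h1 h2] := hV a k.
  have h : V a <= \sum_a V a by rewrite (bigD1 a)//= lerDl sumr_ge0.
  by split; apply: le_trans h.
have mRe a : measurable_fun [set: measurableTypeR R] (fun k => complex.Re (W a k)).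
  exact: (continuous_measurable_fun (cW a).1).
have mIm a : measurable_fun [set: measurableTypeR R] (fun k => complex.Im (W a k)).
  exact: (continuous_measurable_fun (cW a).2).
have eRe (h : R -> R) : complex.Re (\sum_a mintegralC (mu a) (fun k => W a k * (h k)%:C)) =
    pairing mu (fun a k => complex.Re (W a k)) h.
  rewrite Re_sum /pairing; apply: eq_bigr => a _ /=; apply: eq_Rintegral => k _.
  by rewrite !ReImE /= mulr0 subr0.
have eIm (h : R -> R) : complex.Im (\sum_a mintegralC (mu a) (fun k => W a k * (h k)%:C)) =
    pairing mu (fun a k => complex.Im (W a k)) h.
  rewrite Im_sum /pairing; apply: eq_bigr => a _ /=; apply: eq_Rintegral => k _.
  by rewrite !ReImE /= mulr0 add0r.
have pRe : annihilated mu (fun a k => complex.Re (W a k)) (\1_A).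
  apply: (annihilated_bounded_borel mu_tb mRe (fun a k => (hU a k).1)) => // f cf.
  by rewrite -eRe W0.
have pIm : annihilated mu (fun a k => complex.Im (W a k)) (\1_A).
  apply: (annihilated_bounded_borel mu_tb mIm (fun a k => (hU a k).2)) => // f cf.
  by rewrite -eIm W0.
by apply: eqC; [rewrite eRe pRe.2|rewrite eIm pIm.2].
Qed.

End family.

Lemma mintegralC_real m (z : R[i]) (h : R -> R) : m.-integrable setT (EFin \o h) ->
  mintegralC m (fun k => z * (h k)%:C) = z * (Rintegral m setT h)%:C.
Proof.
move=> ih; have iC : integrableC m (fun k => (h k)%:C) by split => //; exact: integrable0.
rewrite mintegralCZ//; congr (_ * _); apply: eqC => //=.
by rewrite Rintegral_cst// mul0r.
Qed.

Lemma Rintegral_indic m (A : set (measurableTypeR R)) : measurable A ->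
  Rintegral m setT (\1_A) = fine (m A).
Proof. by move=> mA; rewrite /Rintegral integral_indic// setIT. Qed.

Lemma bounded_borel_lty m A : translation_bounded_measure m -> bounded_borel A -> (m A < +oo)%E.
Proof. by move=> tbm [mA [a [b Aab]]]; exact: (tb_bounded_lty tbm mA Aab). Qed.

Lemma integrableC_weight m (V : R -> R[i]) (h : R -> R) : continuousC V -> boundedC V ->
  m.-integrable setT (EFin \o h) -> integrableC m (fun k => V k * (h k)%:C).
Proof.
move=> [c1 c2] [U hU] ih.
have mh : measurable_fun [set: measurableTypeR R] h.
  by case/integrableP : ih => /measurable_EFinP.
have U0 : 0 <= U by apply: le_trans (hU 0).1.
have key (g : R -> R) : continuous g -> (forall k, `|g k| <= U) ->
    m.-integrable setT (EFin \o (fun k => g k * h k)).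
  move=> cg gU; apply: le_integrable (integrable_scale measurableT U ih) => //.
    apply/measurable_EFinP/measurable_funM => //.
    exact: (continuous_measurable_fun cg).
  by move=> k _; rewrite lee_fin /= !normrM ler_wpM2r// (ger0_norm U0).
split.
  rewrite (_ : (fun x => _) = fun k => complex.Re (V k) * h k); last first.
    by apply/funext => k; rewrite !ReImE /= mulr0 subr0.
  by apply: key => // k; exact: (hU k).1.
rewrite (_ : (fun x => _) = fun k => complex.Im (V k) * h k); last first.
  by apply/funext => k; rewrite !ReImE /= mulr0 add0r.
by apply: key => // k; exact: (hU k).2.
Qed.

(** The components of [gam] and the measures [M b], the latter with weights - V, form one family to
    which [weighted_uniqueness] applies. *)
Theorem transform_unique Mu gam (J : finType) (M : J -> measureR) (V : J -> R -> R[i]) :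
  is_fourier_transform Mu gam ->
  (forall b, translation_bounded_measure (M b)) ->
  (forall b f, Cc f -> (M b).-integrable setT (EFin \o power_spectrum f)) ->
  (forall b, continuousC (V b)) -> (forall b, boundedC (V b)) ->
  (forall f, Cc f -> cintegral gam (power_spectrum f) =
     \sum_b mintegralC (M b) (fun k => V b k * (power_spectrum f k)%:C)) ->
  forall A, bounded_borel A ->
    cmeasure_val gam A = \sum_b mintegralC (M b) (fun k => V b k * (\1_A k)%:C).
Proof.
move=> hg tbM iM cV bV hf A bA.
pose mu (x : 'I_4 + J) := match x with inl l => component gam l | inr b => M b end.
pose W (x : 'I_4 + J) k : R[i] :=
  match x with inl l => component_sign l | inr b => -1 * V b k end.
have e (h : R -> R) : (forall l, (component gam l).-integrable setT (EFin \o h)) ->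
    (forall b, integrableC (M b) (fun k => V b k * (h k)%:C)) ->
    \sum_x mintegralC (mu x) (fun k => W x k * (h k)%:C) = cintegral gam h -
    \sum_b mintegralC (M b) (fun k => V b k * (h k)%:C).
  move=> ih iV; rewrite big_sumType /= cintegralE; congr (_ + _).
    by apply: eq_bigr => l _; rewrite mintegralC_real.
  rewrite -sumrN; apply: eq_bigr => b _; rewrite -[RHS]mulN1r -mintegralCZ//.
  by congr mintegralC; apply/funext => k; rewrite mulrA.
have iVb b (h : R -> R) : (M b).-integrable setT (EFin \o h) ->
    integrableC (M b) (fun k => V b k * (h k)%:C) by exact: integrableC_weight.
have tbg l := transform_tb l hg.
have := @weighted_uniqueness _ mu W _ _ _ _ A bA.
rewrite e; last 2 first.
- move=> l; apply: integrable_indic_lty; [by case: bA|exact: bounded_borel_lty].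
- by move=> b; apply: iVb; apply: integrable_indic_lty; [case: bA|exact: bounded_borel_lty].
rewrite cintegralE cmeasure_valE => h; apply/eqP; rewrite -subr_eq0; apply/eqP.
rewrite -[RHS]h; last 4 first.
- by case.
- by case=> [l|b]; [exact: continuousC_cst|apply: continuousCM => //; exact: continuousC_cst].
- by case=> [l|b]; [exact: boundedC_cst|apply: boundedCM => //; exact: boundedC_cst].
- move=> f cf; rewrite e; [by rewrite hf// subrr| |].
    by move=> l; exact: transform_integrable hg cf.
  by move=> b; apply: iVb; exact: iM.
congr (_ - _); apply: eq_bigr => l _; congr (_ * _%:C).
by rewrite Rintegral_indic//; case: bA.
Qed.

End ComplexMeasureUniqueness.

(** * Renormalization of the transforms *)

Section FourierRenormalization.
Variables (R : realType) (L : nat) (rho : 'I_L -> seq 'I_L) (lam : R) (ell : 'rV[R]_L).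
Hypothesis lam_gt1 : 1 < lam.
Hypothesis ell_natural : natural_lengths rho lam ell.
Variables (T0 T : tile_set R L) (d : R) (nu : 'I_L -> 'I_L -> R -> R).
Hypothesis T0_tiling : is_tiling ell T0.
Hypothesis T_hull : hull ell T0 T.
Hypothesis nu_corr : pair_correlation ell T0 d nu.
Variable Upsilonhat : 'I_L -> 'I_L -> cmeasure R.
Hypothesis UpsilonhatP : forall i j, is_fourier_transform (Upsilon T nu i j) (Upsilonhat i j).

Local Notation measureR := {measure set (measurableTypeR R) -> \bar R}.
Local Notation U_ i j l := (component (Upsilonhat i j) l).

Lemma autoconv_bounded_support (f : R -> R[i]) : Cc f -> bounded_support (autoconv f).
Proof.
move=> [_ _ [r fr]]; exists (r + r) => x hx; rewrite /autoconv.
rewrite (_ : (fun y => _) = fun=> 0).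
  by apply: eqC; rewrite /= Rintegral_cst// mul0r.
apply/funext => y; have [yr|yr] := ltP r `|y|; first by rewrite fr// mul0r.
rewrite [f (y - x)]fr ?conjc0 ?rmorph0 ?mulr0//.
have : `|x| <= `|y| + `|y - x|.
  by rewrite -{1}[x](subKr y); exact: ler_normB.
lra.
Qed.

(** A dilated power spectrum is again one, up to a constant; this carries integrability over to the
    rescaled measures. *)
Lemma power_spectrum_dilate (f : R -> R[i]) (c k : R) : 0 < c -> Cc f ->
  power_spectrum f (c^-1 * k + 0) = c ^+ 2 * power_spectrum (fun x => f (c * x + 0)) k.
Proof.
move=> c0 cf; rewrite !power_spectrumE invfourier_affine// mulr0 mul0r oppr0 addr0.
rewrite [cexp 0](_ : _ = 1) ?mulr1; last by rewrite /cexp mulr0 cos0 sin0.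
rewrite [c^-1 * k]mulrC; move: (invfourier _ _) => z.
by rewrite !ReImE /= !mul0r subr0 addr0; field; rewrite gt_eqF.
Qed.

Lemma integrable_dilate (m : measureR) (f : R -> R[i]) (c : R) : 0 < c -> Cc f ->
  (forall g, Cc g -> m.-integrable setT (EFin \o power_spectrum g)) ->
  m.-integrable setT (EFin \o (fun k => power_spectrum f (c^-1 * k + 0))).
Proof.
move=> c0 cf hm; rewrite (_ : (fun k => _) =
    (fun k => c ^+ 2 * power_spectrum (fun x => f (c * x + 0)) k)).
  by apply: integrable_scale => //; apply: hm; exact: Cc_affine.
by apply/funext => k; exact: power_spectrum_dilate.
Qed.

Lemma integrable_affine_image (m : measureR) (f : R -> R[i]) (c : R) : 0 < c -> Cc f ->
  (forall g, Cc g -> m.-integrable setT (EFin \o power_spectrum g)) ->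
  (affine_image c^-1 0 m).-integrable setT (EFin \o power_spectrum f).
Proof.
move=> c0 cf hm; apply: integrable_pushforward => //; first exact: measurable_affine.
  by case/integrableP : (hm f cf).
exact: integrable_dilate.
Qed.

(** The frequency counterpart of [w => autoconv f (c * w + t)], read in the coordinate k / c of the
    rescaled measure: the offset t appears as a phase, the dilation as the factor c^-1. *)
Definition twisted_spectrum (f : R -> R[i]) (c t k : R) : R[i] :=
  (c^-1)%:C * cexp (k * - t) * (power_spectrum f k)%:C.

Lemma mintegralC_twisted (m : measureR) (f : R -> R[i]) (c t : R) : 0 < c -> Cc f ->
  (forall g, Cc g -> m.-integrable setT (EFin \o power_spectrum g)) ->
  integrableC (affine_image c^-1 0 m) (twisted_spectrum f c t) /\
  mintegralC (affine_image c^-1 0 m) (twisted_spectrum f c t) =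
  mintegralC m (fun k => twisted_spectrum f c t (c^-1 * k + 0)).
Proof.
move=> c0 cf hm.
have cV (s : R) : continuousC (fun k : R => (c^-1)%:C * cexp (k * s)).
  apply: continuousCM; first exact: continuousC_cst.
  by under eq_fun do rewrite mulrC; exact: continuousC_cexp.
have bV (s : R) : boundedC (fun k : R => (c^-1)%:C * cexp (k * s)).
  by apply: boundedCM; [exact: boundedC_cst|exact: boundedC_cexp].
have i1 := integrableC_weight (cV (- t)) (bV (- t)) (integrable_affine_image c0 cf hm).
have i2 := integrableC_weight (cV (c^-1 * - t)) (bV (c^-1 * - t)) (integrable_dilate c0 cf hm).
have i2' : integrableC m (fun k => twisted_spectrum f c t (c^-1 * k + 0)).
  rewrite (_ : (fun k => _) = fun k => (c^-1)%:C * cexp (k * (c^-1 * - t)) *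
     (power_spectrum f (c^-1 * k + 0))%:C)//.
  by apply/funext => k; rewrite /twisted_spectrum; congr (_ * cexp _ * _); ring.
split; first exact: i1.
apply: eqC => /=; rewrite /Rintegral; congr fine.
  rewrite (integral_pushforward (measurable_affine _ _)) ?preimage_setT//.
    by case: i1 => /integrableP[].
  by case: i2'.
rewrite (integral_pushforward (measurable_affine _ _)) ?preimage_setT//.
  by case: i1 => _ /integrableP[].
by case: i2'.
Qed.

(** Polarization gives four autoconvolutions, to each of which the definition of the transform
    applies; on the frequency side the same combination reassembles to [twisted_spectrum]. *)
Lemma Upsilon_affine_autoconv i j (f : R -> R[i]) (c t : R) : 0 < c -> Cc f ->
  Upsilon T nu i j (fun w => autoconv f (c * w + t)) =
  \sum_l component_sign R l *
    mintegralC (affine_image c^-1 0 (U_ i j l)) (twisted_spectrum f c t).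
Proof.
move=> c0 cf.
pose phi (l : 'I_4) (y : R) : R[i] := f (c * y + t) + 'i%C ^+ l * f (c * y + 0).
have cphi l : Cc (phi l).
  apply: CcD; first exact: Cc_affine.
  by apply: CcM; [exact: continuousC_cst|exact: Cc_affine].
rewrite (_ : (fun w => _) = fun w => \sum_(l < 4) ((c / 4)%:C * 'i%C ^+ l) * autoconv (phi l) w);
  last first.
  apply/funext => w; rewrite autoconv_polarization// mulr_sumr.
  by apply: eq_bigr => l _; rewrite mulrA.
have [B hB] : exists B, forall l z, B < `|z| -> autoconv (phi l) z = 0.
  have /choice[b hb] := fun l => autoconv_bounded_support (cphi l).
  exists (\sum_l `|b l|) => l z hz; apply: hb; apply: le_lt_trans hz.
  by rewrite (bigD1 l)//=; apply: le_trans (ler_norm _) _; rewrite lerDl sumr_ge0.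
rewrite (Upsilon_sum ell_natural T_hull nu_corr i j _ _ hB).
have hi g : Cc g -> forall l, (U_ i j l).-integrable setT (EFin \o power_spectrum g).
  by move=> cg l; exact: (transform_integrable l (UpsilonhatP i j) cg).
transitivity (\sum_(l < 4) ((c / 4)%:C * 'i%C ^+ l) *
    \sum_(a < 4) component_sign R a * (Rintegral (U_ i j a) setT (power_spectrum (phi l)))%:C).
  apply: eq_bigr => l _; congr (_ * _).
  by rewrite -cintegralE; have [_] := UpsilonhatP i j (cphi l).
under eq_bigr do rewrite mulr_sumr.
rewrite exchange_big /=; apply: eq_bigr => a _.
have [_ ->] := mintegralC_twisted t c0 cf (fun g cg => hi g cg a).
under eq_bigr do rewrite mulrCA.
rewrite -mulr_sumr; congr (_ * _).
under eq_bigr => l _ do rewrite -mintegralC_real ?hi//.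
rewrite -mintegralC_sum; last first.
  move=> l; apply: integrableC_weight (hi _ (cphi l) a).
    exact: continuousC_cst.
  exact: boundedC_cst.
congr mintegralC; apply/funext => k.
transitivity ((c / 4)%:C * \sum_(l < 4) 'i%C ^+ l * (power_spectrum (phi l) k)%:C).
  by rewrite mulr_sumr; apply: eq_bigr => l _; rewrite mulrA.
rewrite /power_spectrum sqr_norm_invfourier_polarization// /twisted_spectrum addr0 [c^-1 * k]mulrC.
by congr (_ * cexp _ * _); ring.
Qed.

(** Here b = (m, n, l) stands for the l-th component of the transform of type (m, n). Of the two
    factors lam^-q, one stems from [Upsilon_renormalization], the other from the dilation in
    [twisted_spectrum]. *)
Definition cocycle_weight (q : nat) (i j : 'I_L) (b : 'I_L * 'I_L * 'I_4) (k : R) : R[i] :=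
  component_sign R b.2 * (((lam ^+ q)^-1)%:C * ((lam ^+ q)^-1)%:C) *
  (fourier_cocycle rho lam ell q k i b.1.1 * (fourier_cocycle rho lam ell q k j b.1.2)^*).

Lemma continuousC_fourier_cocycle q i j : continuousC (fun k => fourier_cocycle rho lam ell q k i j).
Proof.
under eq_fun do rewrite fourier_cocycleE.
by apply: continuousC_sum => z; under eq_fun do rewrite mulrC; exact: continuousC_cexp.
Qed.

Lemma boundedC_fourier_cocycle q i j : boundedC (fun k => fourier_cocycle rho lam ell q k i j).
Proof.
by under eq_fun do rewrite fourier_cocycleE; apply: boundedC_sum => z; exact: boundedC_cexp.
Qed.

Lemma continuousC_cocycle_weight q i j b : continuousC (cocycle_weight q i j b).
Proof.
apply: continuousCM; first exact: continuousC_cst.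
apply: continuousCM; first exact: continuousC_fourier_cocycle.
exact/continuousC_conj/continuousC_fourier_cocycle.
Qed.

Lemma boundedC_cocycle_weight q i j b : boundedC (cocycle_weight q i j b).
Proof.
apply: boundedCM; first exact: boundedC_cst.
apply: boundedCM; first exact: boundedC_fourier_cocycle.
exact/boundedC_conj/boundedC_fourier_cocycle.
Qed.

Lemma sum_cexp_mulJ (J J' : Type) (s : seq J) (s' : seq J') (x : J -> R) (y : J' -> R) :
  (\sum_(w <- s) cexp (x w)) * (\sum_(v <- s') cexp (y v))^*%R =
  \sum_(w <- s) \sum_(v <- s') cexp (x w - y v).
Proof.
rewrite mulr_suml; apply: eq_bigr => w _.
rewrite (big_morph _ (rmorphD Num.conj) (rmorph0 Num.conj)) mulr_sumr.
by apply: eq_bigr => v _; rewrite cexpD; congr (_ * _); exact/esym/cexpN.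
Qed.

(** The product of one cocycle entry and the conjugate of another is a double exponential sum over
    pairs of pieces, with exactly the phases that the offsets produce in [twisted_spectrum]. *)
Lemma cocycle_weightE q i j m n l f k :
  cocycle_weight q i j (m, n, l) k * (power_spectrum f k)%:C =
  ((lam ^+ q)^-1)%:C * component_sign R l *
  \sum_(w <- [seq w <- supertile rho lam ell q m | w.1 == i])
  \sum_(v <- [seq v <- supertile rho lam ell q n | v.1 == j])
     twisted_spectrum f (lam ^+ q) (v.2 - w.2) k.
Proof.
rewrite /cocycle_weight [(_, _, l).2]/= [(_, _, l).1.1]/= [(_, _, l).1.2]/=.
set s := [seq w <- supertile _ _ _ _ m | _]; set s' := [seq v <- _ | _].
rewrite !fourier_cocycleE -(big_filter _ (fun w => w.1 == i)) -/s.
rewrite -(big_filter _ (fun v => v.1 == j)) -/s'.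
have -> : \sum_(w <- s) \sum_(v <- s') twisted_spectrum f (lam ^+ q) (v.2 - w.2) k =
    ((lam ^+ q)^-1)%:C * (\sum_(w <- s) \sum_(v <- s') cexp (k * w.2 - k * v.2)) *
    (power_spectrum f k)%:C.
  rewrite mulr_sumr mulr_suml; apply: eq_bigr => w _.
  rewrite mulr_sumr mulr_suml; apply: eq_bigr => v _.
  by rewrite /twisted_spectrum opprB mulrBr.
rewrite -sum_cexp_mulJ; move: (\sum_(w <- s) _) (\sum_(v <- s') _) (component_sign _ _) => x y z.
move: (((lam ^+ q)^-1)%:C) (power_spectrum f k)%:C => a b.
change (z * (a * a) * (x * y^*%R) * b = a * z * (a * (x * y^*%R) * b)).
by move: (y^*%R) => y'; ring.
Qed.

Lemma transform_renormalization q i j f : iter q (inflate rho lam ell) T0 = T0 -> Cc f ->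
  cintegral (Upsilonhat i j) (power_spectrum f) =
  \sum_b mintegralC (affine_image (lam ^+ q)^-1 0 (U_ b.1.1 b.1.2 b.2))
    (fun k => cocycle_weight q i j b k * (power_spectrum f k)%:C).
Proof.
move=> fixq cf; have c0 : 0 < lam ^+ q by rewrite exprn_gt0// (lt_trans ltr01).
have [_ <-] := UpsilonhatP i j cf.
rewrite (Upsilon_renormalization lam_gt1 ell_natural T0_tiling T_hull nu_corr i j fixq
  (autoconv_bounded_support cf)).
pose I m n l t := mintegralC (affine_image (lam ^+ q)^-1 0 (U_ m n l)) (twisted_spectrum f (lam ^+ q) t).
pose S p m := [seq w <- supertile rho lam ell q m | w.1 == p].
have iI m n l t := (mintegralC_twisted t c0 cf
  (fun g cg => transform_integrable l (UpsilonhatP m n) cg)).1.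
transitivity (((lam ^+ q)^-1)%:C * \sum_m \sum_n \sum_l component_sign R l *
    \sum_(w <- S i m) \sum_(v <- S j n) I m n l (v.2 - w.2)).
  congr (_ * _); rewrite big_allpairs.
  under eq_bigr => e1 _ do under eq_bigr => e2 _ do rewrite Upsilon_affine_autoconv//.
  under eq_bigr => e1 _ do rewrite (sum_pieces _ _ _ _ j (fun n t =>
     \sum_l component_sign R l * I e1.1 n l (t - e1.2))).
  rewrite (sum_pieces _ _ _ _ i (fun m s => \sum_n \sum_(v <- supertile rho lam ell q n | v.1 == j)
     \sum_l component_sign R l * I m n l (v.2 - s))).
  apply: eq_bigr => m _; rewrite exchange_big /=; apply: eq_bigr => n _.
  under eq_bigr => w _ do rewrite exchange_big /=.
  rewrite exchange_big /=; apply: eq_bigr => l _.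
  rewrite mulr_sumr big_filter; apply: eq_bigr => w _.
  by rewrite mulr_sumr big_filter.
pose W m n l := mintegralC (affine_image (lam ^+ q)^-1 0 (U_ m n l))
  (fun k => cocycle_weight q i j (m, n, l) k * (power_spectrum f k)%:C).
transitivity (\sum_m \sum_n \sum_l W m n l); last first.
  rewrite pair_bigA /= (pair_bigA _ (fun p l => W p.1 p.2 l)) /=.
  by apply: eq_bigr => -[[m n] l] _.
rewrite mulr_sumr; apply: eq_bigr => m _.
rewrite mulr_sumr; apply: eq_bigr => n _.
rewrite mulr_sumr; apply: eq_bigr => l _.
rewrite /W (_ : (fun k => _) = fun k => ((lam ^+ q)^-1)%:C * component_sign R l *
    \sum_(w <- S i m) \sum_(v <- S j n) twisted_spectrum f (lam ^+ q) (v.2 - w.2) k); last first.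
  by apply/funext => k; exact: cocycle_weightE.
rewrite mintegralCZ; last by do 2 (apply: integrableC_sum => ?); exact: iI.
rewrite mulrA; congr (_ * _); rewrite mintegralC_sum; last first.
  by move=> w; apply: integrableC_sum => v; exact: iI.
by apply: eq_bigr => w _; rewrite mintegralC_sum// => v; exact: iI.
Qed.

(** The renormalization is available only against power spectra; both sides being built from
    translation bounded measures, uniqueness extends it to bounded Borel sets. *)
Theorem transform_value q i j A : iter q (inflate rho lam ell) T0 = T0 -> bounded_borel A ->
  cmeasure_val (Upsilonhat i j) A =
  \sum_b mintegralC (affine_image (lam ^+ q)^-1 0 (U_ b.1.1 b.1.2 b.2))
    (fun k => cocycle_weight q i j b k * (\1_A k)%:C).
Proof.
move=> fixq; have c0 : 0 < lam ^+ q by rewrite exprn_gt0// (lt_trans ltr01).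
apply: (transform_unique (UpsilonhatP i j)) => [b|b f cf|b|b|f cf].
- by apply: tb_affine_image; [rewrite invr_gt0|exact: transform_tb (UpsilonhatP _ _)].
- apply: integrable_affine_image => // g cg.
  exact: transform_integrable (UpsilonhatP _ _) cg.
- exact: continuousC_cocycle_weight.
- exact: boundedC_cocycle_weight.
- exact: transform_renormalization.
Qed.

End FourierRenormalization.

(** * Lyapunov exponents and decay *)

Section Growth.
Variables (R : realType) (L : nat).

(** The squared Frobenius norm. Unlike an abstract norm, it is visibly continuous in the entries,
    which makes the sets [tame] measurable. *)
Definition entries_sqr (A : 'M[R[i]]_L) : R :=
  \sum_i \sum_j (complex.Re (A i j) ^+ 2 + complex.Im (A i j) ^+ 2).

Lemma le_entries_sqr (A : 'M[R[i]]_L) i j :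
  complex.Re (A i j) ^+ 2 + complex.Im (A i j) ^+ 2 <= entries_sqr A.
Proof.
have ge0 i' j' : 0 <= complex.Re (A i' j') ^+ 2 + complex.Im (A i' j') ^+ 2.
  by rewrite addr_ge0 ?sqr_ge0.
rewrite /entries_sqr (bigD1 i)//= (bigD1 j)//= -addrA lerDl addr_ge0 ?sumr_ge0// => i' _.
by rewrite sumr_ge0.
Qed.

Lemma submult_norm_ge0 (N : 'M[R[i]]_L -> R) A : submult_norm N -> 0 <= N A.
Proof.
case=> _ ND NZ _.
have N0 : N 0 = 0 by rewrite -(scale0r (0 : 'M[R[i]]_L)) NZ normr0 mul0r.
have NN : N (- A) = N A by rewrite -scaleN1r NZ normrN1 mul1r.
have := ND A (- A); rewrite subrr N0 NN; lra.
Qed.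

(* A matrix entry is isolated by multiplying with elementary matrices on both sides. *)
Lemma entries_sqr_le_norm (N : 'M[R[i]]_L -> R) : submult_norm N ->
  exists2 C : R, 0 <= C & forall A, entries_sqr A <= C * N A ^+ 2.
Proof.
move=> hN; have N0 A := submult_norm_ge0 A hN; case: hN => Nz ND NZ NM.
exists (\sum_(i : 'I_L) \sum_(j : 'I_L) N (delta_mx j i) ^+ 2).
  by apply: sumr_ge0 => i _; apply: sumr_ge0 => j _; exact: sqr_ge0.
move=> A; rewrite mulr_suml; apply: ler_sum => i _.
rewrite mulr_suml; apply: ler_sum => j _; rewrite -sqr_normC -exprMn.
have z0 : 0 <= complex.Re `|A i j| by rewrite normc_def /= sqrtr_ge0.
rewrite ler_sqr ?nnegrE ?mulr_ge0//.
have d0 : 0 < N (delta_mx i i).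
  rewrite lt_neqAle N0 andbT eq_sym; apply/eqP => /Nz /matrixP /(_ i i).
  by rewrite !mxE !eqxx /=; apply/eqP; exact: oner_neq0.
have := NM (delta_mx i i *m A) (delta_mx j i).
have -> : delta_mx i i *m A *m delta_mx j i = A i j *: delta_mx i i.
  apply/matrixP => a b; rewrite !mxE (bigD1 j)//= big1 ?addr0; last first.
    by move=> c cj; rewrite [delta_mx j i c b]mxE (negbTE cj) mulr0.
  rewrite !mxE (bigD1 i)//= big1 ?addr0; last first.
    by move=> c ci; rewrite mxE (negbTE ci) andbF mul0r.
  by rewrite !mxE !eqxx andbT /= -mulrA mulrC -mulrA -natrM mulnb andbC.
rewrite NZ => h; rewrite -(ler_pM2r d0).
apply: le_trans h _; apply: le_trans (ler_wpM2r (N0 _) (NM _ _)) _.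
by rewrite mulrC mulrA mulrAC.
Qed.

Lemma limn_esup_lt (u : (\bar R)^nat) (c : \bar R) : (limn_esup u < c)%E ->
  exists n0 : nat, forall n, (n0 <= n)%N -> (u n < c)%E.
Proof.
move=> /ereal_inf_lt[_ [V [n0 _ hV] <-] hc]; exists n0 => n hn.
by apply: le_lt_trans hc; apply: ereal_sup_ubound; exists n => //; exact: hV.
Qed.

Lemma lyapunov_growth (N : 'M[R[i]]_L -> R) rho lam (ell : 'rV[R]_L) (k a b : R) :
  submult_norm N -> (lyapunov N rho lam ell k <= a%:E)%E -> a < b ->
  exists n0 : nat, forall n, (n0 <= n)%N ->
    N (fourier_cocycle rho lam ell n k) <= expR b ^+ n.
Proof.
move=> hN chi ab; have /limn_esup_lt[n0 h] := le_lt_trans chi (ab : (a%:E < b%:E)%E).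
(* The shift excludes n = 0, where n^-1 is 0 by convention and the bound says nothing. *)
exists n0.+1 => n hn; have := h n (ltnW hn).
have n0' : (0 : R) < n%:R by rewrite ltr0n; exact: leq_trans hn.
have [N0|N0] := leP (N (fourier_cocycle rho lam ell n k)) 0.
  by move=> _; apply: le_trans N0 _; rewrite exprn_ge0 ?expR_ge0.
rewrite lne_EFin// -EFinM lte_fin ltr_pdivrMl// => /ltW hb.
by rewrite -expRM_natl -[leLHS]lnK ?posrE// ler_expR.
Qed.

End Growth.

Section Decay.
Variables (R : realType).
Local Notation measureR := {measure set (measurableTypeR R) -> \bar R}.

Lemma component_sign_bound l (z : R[i]) (D : R) :
  `|complex.Re z| <= D -> `|complex.Im z| <= D ->
  `|complex.Re (component_sign R l * z)| <= D /\ `|complex.Im (component_sign R l * z)| <= D.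
Proof.
move=> h1 h2; case: l => -[|[|[|[|//]]]] ?; rewrite /component_sign /= !ReImE /=;
  by rewrite ?(mul0r, mul1r, mulN1r, oppr0, subr0, sub0r, addr0, add0r, normrN, opprK).
Qed.

(** From 2 |ab| <= a^2 + b^2, applied to the two products in each part. *)
Lemma mulJ_bound (x y : R[i]) (D : R) :
  complex.Re x ^+ 2 + complex.Im x ^+ 2 <= D -> complex.Re y ^+ 2 + complex.Im y ^+ 2 <= D ->
  `|complex.Re (x * y^*%R)| <= D /\ `|complex.Im (x * y^*%R)| <= D.
Proof.
rewrite !ReImE; move: (complex.Re x) (complex.Im x) (complex.Re y) (complex.Im y) => a b c e h1 h2.
have s1 := sqr_ge0 (a - c); have s2 := sqr_ge0 (a + c).
have s3 := sqr_ge0 (b - e); have s4 := sqr_ge0 (b + e).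
have s5 := sqr_ge0 (a - e); have s6 := sqr_ge0 (a + e).
have s7 := sqr_ge0 (b - c); have s8 := sqr_ge0 (b + c).
by split; rewrite ler_norml; apply/andP; split; nra.
Qed.

Lemma mintegralC_indic_bound (m : measureR) (V : R -> R[i]) (A : set R) (D M : R) :
  continuousC V -> boundedC V -> measurable (A : set (measurableTypeR R)) -> (m A <= M%:E)%E ->
  0 <= D -> (forall k, A k -> `|complex.Re (V k)| <= D /\ `|complex.Im (V k)| <= D) ->
  `|complex.Re (mintegralC m (fun k => V k * (\1_A k)%:C))| <= D * M /\
  `|complex.Im (mintegralC m (fun k => V k * (\1_A k)%:C))| <= D * M.
Proof.
move=> cV bV mA mAM D0 VD.
have iA : m.-integrable setT (EFin \o (\1_A : R -> R)).
  by apply: integrable_indic_lty => //; apply: le_lt_trans mAM _; exact: ltry.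
have [i1 i2] := integrableC_weight cV bV iA.
have MA : fine (m A) <= M.
  by rewrite -lee_fin fineK// ge0_fin_numE// (le_lt_trans mAM)// ltry.
have key (h : R -> R) : m.-integrable setT (EFin \o h) ->
    (forall k, `|h k| <= D * \1_A k) -> `|Rintegral m setT h| <= D * M.
  move=> ih hD; apply: (@le_trans _ _ (Rintegral m setT (fun k => D * \1_A k))).
    apply: le_trans (le_normr_Rintegral measurableT ih) _.
    apply: le_Rintegral => //; [exact: (integrable_norm ih)|exact: integrable_scale].
  by rewrite RintegralZl// Rintegral_indic// ler_wpM2l.
split; apply: key => // k; rewrite !ReImE /= mulr0 ?subr0 ?add0r normrM.
  rewrite indicE; case: (boolP (k \in A)) => [/set_mem/VD[h _]|_]; last by rewrite normr0 !mulr0.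
  by rewrite normr1 !mulr1.
rewrite indicE; case: (boolP (k \in A)) => [/set_mem/VD[_ h]|_]; last by rewrite normr0 !mulr0.
by rewrite normr1 !mulr1.
Qed.

(** The interval pulls back to [c a, c b], of length c (b - a); since [1 <= c], the additive
    constant of [tb_growth] is absorbed into the linear bound. *)
Lemma affine_image_growth (m : measureR) (a b : R) : a <= b -> translation_bounded_measure m ->
  exists2 K : R, 0 <= K & forall c, 1 <= c ->
    (affine_image c^-1 0 m `[a, b]%classic <= (K * c)%:E)%E.
Proof.
move=> ab /tb_growth[C C0 hC]; exists (C * (b - a + 1)).
  by rewrite mulr_ge0//; lra.
move=> c c1; have c0 : 0 < c by lra.
rewrite /affine_image /pushforward.
have -> : (fun x : R => c^-1 * x + 0) @^-1` `[a, b] = `[(c * a)%R, (c * b)%R]%classic.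
  by apply/seteqP; split => x /=; rewrite !in_itv /= addr0 ler_pdivrMl// ler_pdivlMl.
apply: le_trans (hC _ _ _) _; first by rewrite ler_pM2l.
rewrite lee_fin -mulrA ler_wpM2l//; nra.
Qed.

Lemma geometric_bound_le0 (x K r : R) (n0 : nat) : 0 <= r < 1 ->
  (forall n, (n0 <= n)%N -> x <= K * r ^+ n) -> x <= 0.
Proof.
move=> /andP[r0 r1] h; rewrite leNgt; apply/negP => x0.
have : (fun n : nat => K * r ^+ n) @ \oo --> K * 0.
  by apply: cvgMr; apply: cvg_expr; rewrite ger0_norm.
rewrite mulr0 => /cvgrPdist_lt /(_ x x0) [n1 _ hn1].
have := hn1 (maxn n0 n1) (leq_maxr _ _); rewrite /= sub0r normrN.
have := h (maxn n0 n1) (leq_maxl _ _); have := ler_norm (K * r ^+ maxn n0 n1); lra.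
Qed.

End Decay.

(** * Vanishing of the transforms where the cocycle grows slowly *)

Section TameSets.
Variables (R : realType) (L : nat) (rho : 'I_L -> seq 'I_L) (lam : R) (ell : 'rV[R]_L).
Hypothesis lam_gt1 : 1 < lam.
Hypothesis ell_natural : natural_lengths rho lam ell.
Variables (T0 T : tile_set R L) (d : R) (nu : 'I_L -> 'I_L -> R -> R).
Hypothesis T0_tiling : is_tiling ell T0.
Variable p : nat.
Hypothesis p_gt0 : (0 < p)%N.
Hypothesis T0_fixed : iter p (inflate rho lam ell) T0 = T0.
Hypothesis T_hull : hull ell T0 T.
Hypothesis nu_corr : pair_correlation ell T0 d nu.
Variable Upsilonhat : 'I_L -> 'I_L -> cmeasure R.
Hypothesis UpsilonhatP : forall i j, is_fourier_transform (Upsilon T nu i j) (Upsilonhat i j).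
Variables (C g : R).
Hypotheses (C_ge0 : 0 <= C) (g_ge0 : 0 <= g) (g_lam : g ^+ 2 < lam).

Local Notation U_ i j l := (component (Upsilonhat i j) l).

(** The threshold after which the Lyapunov bound takes effect depends on k; this set collects the k
    for which [n0] is late enough. On it the bound is uniform, and the sets increase with [n0]. *)
Definition tame (n0 : nat) : set R :=
  [set k | forall n, (n0 <= n)%N ->
     entries_sqr (fourier_cocycle rho lam ell n k) <= C * (g ^+ n) ^+ 2].

Lemma measurable_tame n0 : measurable (tame n0 : set (measurableTypeR R)).
Proof.
rewrite (_ : tame n0 = \bigcap_(n in [set n | (n0 <= n)%N])
  (fun k => entries_sqr (fourier_cocycle rho lam ell n k)) @^-1` `]-oo, C * (g ^+ n) ^+ 2]);
  last first.
  by apply/seteqP; split => k /= hk n hn; have := hk n hn; rewrite /= in_itv.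
apply: bigcap_measurable => [|n _]; first by exists n0 => /=.
rewrite -[X in measurable X]setTI; apply: (@continuous_measurable_fun R) => //.
rewrite /entries_sqr.
have h i j : continuous (fun k : R =>
    complex.Re (fourier_cocycle rho lam ell n k i j) ^+ 2 +
    complex.Im (fourier_cocycle rho lam ell n k i j) ^+ 2).
  have [c1 c2] := continuousC_fourier_cocycle rho lam ell n i j.
  by apply: continuousRD; [exact: (continuousRM c1 c1)|exact: (continuousRM c2 c2)].
have sum_cont (F : 'I_L -> R -> R) : (forall i, continuous (F i)) ->
    continuous (fun k => \sum_i F i k).
  move=> hF; elim: (index_enum _) => [|i s IH].
    by under eq_fun do rewrite big_nil; exact: cst_continuous.
  by under eq_fun do rewrite big_cons; exact: continuousRD.
by apply: (sum_cont) => i; apply: (sum_cont) => j; exact: h.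
Qed.

Lemma tame_nondecreasing : nondecreasing_seq tame.
Proof.
by move=> n m nm; apply/subsetPset => k hk q hq; apply: hk; exact: leq_trans hq.
Qed.

Lemma transform_tame_bound i j A n0 : bounded_borel A -> A `<=` tame n0 ->
  exists K : R, forall q, (n0 <= q)%N -> iter q (inflate rho lam ell) T0 = T0 ->
    `|complex.Re (cmeasure_val (Upsilonhat i j) A)| <= K * (g ^+ 2 / lam) ^+ q /\
    `|complex.Im (cmeasure_val (Upsilonhat i j) A)| <= K * (g ^+ 2 / lam) ^+ q.
Proof.
move=> bA AE; have [mA [a0 [b0 Aab0]]] := bA.
pose a := Num.min a0 b0; pose b := Num.max a0 b0.
have ab : a <= b by rewrite /a /b ge_min le_max lexx.
have Aab : A `<=` `[a, b].
  move=> k /Aab0 /=; rewrite !in_itv /= => /andP[h1 h2].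
  by rewrite /a /b ge_min h1 le_max h2 orbT.
have /choice[K hK] : forall c : 'I_L * 'I_L * 'I_4, exists K : R, 0 <= K /\
    forall x, 1 <= x -> (affine_image x^-1 0 (U_ c.1.1 c.1.2 c.2) `[a, b]%classic <= (K * x)%:E)%E.
  move=> c; have [K K0 hK] := affine_image_growth ab (transform_tb c.2 (UpsilonhatP c.1.1 c.1.2)).
  by exists K.
exists (\sum_c C * K c) => q hq fixq.
have lam0 : 0 < lam by apply: lt_trans lam_gt1.
have q1 : 1 <= lam ^+ q by rewrite exprn_ege1// ltW.
have q0 : 0 < lam ^+ q by rewrite exprn_gt0.
(* [D] bounds the weights on the tame set; times the mass [K c * lam ^+ q] of the rescaled interval
   it leaves the ratio g^2 / lam to the power q. *)
set D := (lam ^+ q)^-1 * (lam ^+ q)^-1 * (C * (g ^+ q) ^+ 2).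
have D0 : 0 <= D by rewrite !mulr_ge0 ?invr_ge0 ?exprn_ge0// ltW.
have e c : D * (K c * lam ^+ q) = C * K c * (g ^+ 2 / lam) ^+ q.
  rewrite /D expr_div_n -!exprM mulnC; field.
  by rewrite gt_eqF.
have h c : `|complex.Re (mintegralC (affine_image (lam ^+ q)^-1 0 (U_ c.1.1 c.1.2 c.2))
      (fun k => cocycle_weight rho lam ell q i j c k * (\1_A k)%:C))| <= C * K c * (g ^+ 2 / lam) ^+ q /\
    `|complex.Im (mintegralC (affine_image (lam ^+ q)^-1 0 (U_ c.1.1 c.1.2 c.2))
      (fun k => cocycle_weight rho lam ell q i j c k * (\1_A k)%:C))| <= C * K c * (g ^+ 2 / lam) ^+ q.
  rewrite -e; apply: mintegralC_indic_bound => //.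
  - exact: continuousC_cocycle_weight.
  - exact: boundedC_cocycle_weight.
  - apply: le_trans ((hK c).2 _ q1); apply: le_measure => //; exact: mem_set.
  move=> k /AE kE; rewrite /cocycle_weight -mulrA.
  have kC u v := le_trans (le_entries_sqr _ u v) (kE q hq).
  have [h1 h2] := mulJ_bound (kC i c.1.1) (kC j c.1.2).
  move: h1 h2; move: (_ * _^*%R) => z h1 h2.
  have rM (x : R) : `|x| <= C * (g ^+ q) ^+ 2 ->
      `|(lam ^+ q)^-1 * (lam ^+ q)^-1 * x| <= D.
    move=> hx; rewrite normrM /D ger0_norm ?ler_wpM2l// ?mulr_ge0// ?invr_ge0 ltW//.
  apply: component_sign_bound; rewrite !ReImE /= !(mul0r, mulr0, subr0, addr0, add0r).
    exact: rM.
  exact: rM.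
rewrite (transform_value lam_gt1 ell_natural T0_tiling T_hull nu_corr UpsilonhatP i j fixq bA).
rewrite Re_sum Im_sum mulr_suml; split.
  by apply: le_trans (ler_norm_sum _ _ _) _; apply: ler_sum => c _; exact: (h c).1.
by apply: le_trans (ler_norm_sum _ _ _) _; apply: ler_sum => c _; exact: (h c).2.
Qed.

Lemma transform_tame i j A n0 : bounded_borel A -> A `<=` tame n0 ->
  cmeasure_val (Upsilonhat i j) A = 0.
Proof.
move=> bA /(transform_tame_bound i j bA)[K hK].
have lam0 : 0 < lam by apply: lt_trans lam_gt1.
have r01 : 0 <= g ^+ 2 / lam < 1 by rewrite divr_ge0 ?sqr_ge0 ?(ltW lam0)//= ltr_pdivrMr ?mul1r.
have rp01 : 0 <= (g ^+ 2 / lam) ^+ p < 1.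
  by case/andP : r01 => r0 r1; rewrite exprn_ge0//= exprn_ilt1// -lt0n.
(* The tiling is fixed by the p-fold inflation, so the bound is read along the multiples of p, where
   it is geometric with ratio (g^2 / lam)^p. *)
have fixn n : iter (p * n) (inflate rho lam ell) T0 = T0.
  by elim: n => [|n IH]; rewrite ?muln0// mulnS iterD IH.
have h n : (n0 <= n)%N -> _ := fun hn => hK (p * n)%N (leq_trans hn (leq_pmull n p_gt0)) (fixn n).
have zero (x : R) : (forall n, (n0 <= n)%N -> `|x| <= K * (g ^+ 2 / lam) ^+ (p * n)) -> x = 0.
  move=> hx; apply/eqP; rewrite -normr_le0; apply: (@geometric_bound_le0 _ _ K _ n0 rp01) => n hn.
  by rewrite -exprM; exact: hx.
by apply: eqC; apply: zero => n hn; [exact: (h n hn).1|exact: (h n hn).2].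
Qed.

(** Vanishing is known only for the differences of components, not for the components themselves.
    Continuity from below makes each component converge along the increasing tame sets, and the zero
    differences pass to the limit. *)
Theorem transform_eventually_tame i j A : bounded_borel A -> A `<=` \bigcup_n tame n ->
  cmeasure_val (Upsilonhat i j) A = 0.
Proof.
move=> bA AE; have [mA [a [b Aab]]] := bA.
have eA : A = \bigcup_n (A `&` tame n) by rewrite -setI_bigcupr; apply/esym/setIidPl.
have mAn n : measurable (A `&` tame n : set (measurableTypeR R)).
  by apply: measurableI => //; exact: measurable_tame.
have lty l : (U_ i j l A < +oo)%E := bounded_borel_lty (transform_tb l (UpsilonhatP i j)) bA.
have cv l : fine (U_ i j l (A `&` tame n)) @[n --> \oo] --> fine (U_ i j l A).
  apply: fine_cvg; rewrite fineK ?ge0_fin_numE//.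
  rewrite [X in _ --> U_ i j l X]eA; apply: nondecreasing_cvg_mu => //.
    by apply: bigcup_measurable.
  by move=> n m nm; have /subsetPset h := tame_nondecreasing nm; apply/subsetPset => k [Ak /h].
have z n : cmeasure_val (Upsilonhat i j) (A `&` tame n) = 0.
  apply: (@transform_tame i j _ n); last by move=> k [].
  by split => //; exists a, b => k [/Aab].
have lim0 (l l' : 'I_4) : (forall n, fine (U_ i j l (A `&` tame n)) -
      fine (U_ i j l' (A `&` tame n)) = 0) -> fine (U_ i j l A) - fine (U_ i j l' A) = 0.
  move=> h; have hc : (fun _ : nat => 0 : R) @ \oo --> fine (U_ i j l A) - fine (U_ i j l' A).
    rewrite (_ : (fun _ => _) = fun n => fine (U_ i j l (A `&` tame n)) -
      fine (U_ i j l' (A `&` tame n))); first by apply: cvgB; exact: cv.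
    by apply/funext => n; rewrite h.
  by rewrite -(cvg_lim (@Rhausdorff R) hc) lim_cst.
apply: eqC => /=.
  apply: (lim0 ord0 (lift ord0 ord0)) => n.
  by transitivity (complex.Re (cmeasure_val (Upsilonhat i j) (A `&` tame n))); last by rewrite z.
apply: (lim0 (lift ord0 (lift ord0 ord0)) (lift ord0 (lift ord0 (lift ord0 ord0)))) => n.
by transitivity (complex.Im (cmeasure_val (Upsilonhat i j) (A `&` tame n))); last by rewrite z.
Qed.

(** [gam] is an arbitrary transform of the autocorrelation; uniqueness identifies it with the
    corresponding linear combination of the given transforms. *)
Theorem autocorrelation_transform_value (u : 'I_L -> R[i]) (gam : cmeasure R) A :
  is_fourier_transform (autocorrelation T d nu u) gam -> bounded_borel A ->
  cmeasure_val gam A =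
  d%:C * \sum_i \sum_j (u i)^* * u j * cmeasure_val (Upsilonhat i j) A.
Proof.
move=> hgam bA; have [mA _] := bA.
pose V (b : 'I_L * 'I_L * 'I_4) (_ : R) : R[i] :=
  d%:C * ((u b.1.1)^* * u b.1.2 * component_sign R b.2).
have E (F : 'I_L -> 'I_L -> 'I_4 -> R) :
    d%:C * \sum_i \sum_j (u i)^* * u j * \sum_l component_sign R l * (F i j l)%:C =
    \sum_b V b 0 * (F b.1.1 b.1.2 b.2)%:C.
  rewrite pair_bigA /= mulr_sumr.
  transitivity (\sum_e \sum_l V (e, l) 0 * (F e.1 e.2 l)%:C).
    by apply: eq_bigr => -[m n] _; rewrite /= mulrA mulr_sumr; apply: eq_bigr => l _; rewrite /V /= !mulrA.
  by rewrite pair_bigA /=; apply: eq_bigr => -[[m n] l] _.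
have iA l i j : (U_ i j l).-integrable setT (EFin \o (\1_A : R -> R)).
  apply: integrable_indic_lty => //.
  exact: bounded_borel_lty (transform_tb l (UpsilonhatP i j)) bA.
rewrite (@transform_unique _ _ _ _ (fun b => U_ b.1.1 b.1.2 b.2) V hgam) => //.
- transitivity (\sum_b V b 0 * (fine (U_ b.1.1 b.1.2 b.2 A))%:C).
    by apply: eq_bigr => b _; rewrite mintegralC_real// Rintegral_indic.
  rewrite -(E (fun i j l => fine (U_ i j l A))); congr (_ * _).
  by apply: eq_bigr => i _; apply: eq_bigr => j _; rewrite cmeasure_valE.
- by move=> b; exact: transform_tb (UpsilonhatP _ _).
- by move=> b f cf; exact: transform_integrable (UpsilonhatP _ _) cf.
- by move=> b; exact: continuousC_cst.
- by move=> b; exact: boundedC_cst.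
move=> f cf; have [_ <-] := hgam f cf.
transitivity (\sum_b V b 0 * (Rintegral (U_ b.1.1 b.1.2 b.2) setT (power_spectrum f))%:C).
  rewrite -(E (fun i j l => Rintegral (U_ i j l) setT (power_spectrum f))); congr (_ * _).
  apply: eq_bigr => i _; apply: eq_bigr => j _; congr (_ * _).
  by rewrite -cintegralE; have [_] := UpsilonhatP i j cf.
by apply: eq_bigr => b _; rewrite mintegralC_real//; exact: transform_integrable (UpsilonhatP _ _) cf.
Qed.

End TameSets.

Theorem theorem4p4 (R : realType) (L : nat) (rho : 'I_L -> seq 'I_L)
    (lam : R) (ell : 'rV[R]_L)
    (rho_primitive : primitive R rho)
    (lam_pf : pf_eigenvalue rho lam) (lam_gt1 : 1 < lam)
    (ell_natural : natural_lengths rho lam ell)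
    (T0 : tile_set R L) (T0_fixed : fixed_tiling rho lam ell T0)
    (T : tile_set R L) (T_hull : hull ell T0 T)
    (d : R) (d_dens : point_density ell T0 d)
    (nu : 'I_L -> 'I_L -> R -> R) (nu_corr : pair_correlation ell T0 d nu)
    (Upsilonhat : 'I_L -> 'I_L -> cmeasure R)
    (UpsilonhatP : forall i j : 'I_L,
       is_fourier_transform (Upsilon T nu i j) (Upsilonhat i j))
    (N : 'M[R[i]]_L -> R) (N_norm : submult_norm N)
    (B_reg : exists k : R, \det (fourier_mx rho ell k) != 0)
    (eps : R) (eps_gt0 : 0 < eps)
    (chi_le : {ae @lebesgue_measure R, forall k : R,
       (lyapunov N rho lam ell k <= (2^-1 * ln lam - eps)%:E)%E}) :
  (forall i j : 'I_L,
     is_ac_part (cmeasure_val (Upsilonhat i j)) (fun=> 0)) /\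
  (forall (u : 'I_L -> R[i]) (gammahat : cmeasure R),
     is_fourier_transform (autocorrelation T d nu u) gammahat ->
     singular (cmeasure_val gammahat)).
Proof.
have [T0_tiling [p p_gt0 fixp]] := T0_fixed.
have [C C0 hC] := entries_sqr_le_norm N_norm.
have lam0 : 0 < lam by apply: lt_trans lam_gt1.
(* Half of eps is spent on passing from the limsup to a bound for all large n; the other half leaves
   g^2 = lam e^(- eps), below lam. *)
pose g : R := expR (2^-1 * ln lam - eps / 2).
have g0 : 0 <= g by exact: expR_ge0.
have g_lam : g ^+ 2 < lam.
  by rewrite -expRM_natl -[ltRHS]lnK ?posrE// ltr_expR; move: (ln lam) => x; lra.
(* [S] is a measurable null set containing all exceptional k. It carries every transform: all that
   follows is that bounded Borel sets outside it have value 0. *)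
have [S [mS S0 chiS]] := chi_le.
have zero i j A : bounded_borel A -> A `<=` ~` S -> cmeasure_val (Upsilonhat i j) A = 0.
  move=> bA AS.
  suff AE : A `<=` \bigcup_n tame rho lam ell C g n.
    exact: (transform_eventually_tame lam_gt1 ell_natural T0_tiling p_gt0 fixp T_hull nu_corr
      UpsilonhatP C0 g0 g_lam i j bA AE).
  move=> k /AS kS.
  have chi : (lyapunov N rho lam ell k <= (2^-1 * ln lam - eps)%:E)%E.
    by apply: contrapT => h; apply: kS; exact: chiS.
  have [|n0 hn] := lyapunov_growth (b := 2^-1 * ln lam - eps / 2) N_norm chi.
    by move: (ln lam) => x; lra.
  exists n0 => // n n0n; apply: le_trans (hC _) _; rewrite ler_wpM2l//.
  by rewrite ler_sqr ?nnegrE ?exprn_ge0 ?submult_norm_ge0//; exact: hn.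
split=> [i j|u gammahat hgam].
  split; first by [].
  by exists S; split => // A bA AS; rewrite zero// subr0.
exists S; split => // A bA AS.
rewrite (autocorrelation_transform_value UpsilonhatP hgam bA).
rewrite big1 ?mulr0// => i _; rewrite big1// => j _.
by rewrite zero ?mulr0.
Qed.
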